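(* Let $L$ be discrete. Assume that (i) $\mathcal Z$ and $\mathcal Y$ are bounded subsets of Euclidean spaces; (ii) the kernel $K(s)$ is a positive, continuous, symmetric function with support $[-1,1]$ satisfying $\int K(s)\,\mathrm ds=1$, $\int K(s)s\,\mathrm ds=0$, $\int K(s)s^2\,\mathrm ds>0$; (iii) $\nabla_a^2p_{A\mid Z,L}(a\mid z,l)$ exists at $a$ for any $(z,l)\in\mathcal Z\times\mathcal L$; (iv) $nh_A\to\infty$, $h_A=o(1)$; (v) for each $k$, $\mathbb E[\|\hat\gamma_{h_A,a}^{(n,-k)}-\gamma_{h_A,a}^o\|_2^2]=o(h_A^{-1/2})$, $\mathbb E[\|\hat\rho_\pi^{(n,-k)}-\rho_\pi^o\|_2^2]=o(1)$, and $\|\hat\gamma_{h_A,a}^{(n,-k)}-\gamma_{h_A,a}^o\|_2\,\|\hat\rho_\pi^{(n,-k)}-\rho_\pi^o\|_2=o_p(1/\sqrt{nh_A})$. Then $$\tilde\zeta_{\pi,h_A}^{(n)}(a,l)=\zeta_\pi^o(a,l)+O_p\big(1/\sqrt{nh_A}+h_A^2\big).$$ Define $\mathrm{bias}_\zeta(a,l):=\frac{h_A^2}2\,\mathbb E[p_{A\mid Z,L}''(a\mid Z,L)(\pi(Z,L)-\rho_\pi^o(L))\mid L=l]\int K(x)x^2\,\mathrm dx$ (derivatives with respect to $a$). If $h_A=O(n^{-1/5})$, then $$\sqrt{nh_A}\,\big\{\tilde\zeta_{\pi,h_A}^{(n)}(a,l)-\zeta_\pi^o(a,l)-\mathrm{bias}_\zeta(a,l)\big\}\overset{d}{\to}N(0,\sigma_{\pi,\zeta}^*(a,l)^2),$$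 where $$\sigma_{\pi,\zeta}^*(a,l)^2:=\frac{p_{A\mid L}(a\mid l)}{p_L(l)}\int K(x)^2\,\mathrm dx\cdot\mathbb E[\{\pi(Z,L)-\rho_\pi^o(L)\}^2\mid A=a,L=l].$$
   Context: Setting. $\{O_i\}_{i=1}^n$ are i.i.d. copies of $O=[L,Z,A,Y]$, where $Y\in\mathcal Y\subseteq\mathbb R$ is an outcome, $A$ a continuous treatment whose support $\mathcal A\subseteq\mathbb R$ is closed (interior $\mathring{\mathcal A}$), $Z\in\mathcal Z\subseteq\mathbb R^{d_Z}$ an instrument, and $L\in\mathcal L=\{1,\dots,|\mathcal L|\}$ a discrete observed confounder with mass function $p_L$. Throughout, $p_{A\mid L}(a\mid L)>0$ for all $a\in\mathring{\mathcal A}$ almost surely. $\pi(Z,L)$ is a prespecified weighting function, $a\in\mathring{\mathcal A}$ a target point, $l\in\mathcal L$. Notation. $\rho_\pi^o(L):=\mathbb E[\pi(Z,L)\mid L]$; $\kappa_\pi^o(A,L):=\mathbb E[\pi(Z,L)\mid A,L]-\mathbb E[\pi(Z,L)\mid L]$; $\zeta_\pi^o(a,l):=p_{A\mid L}(a\mid l)\,\kappa_\pi^o(a,l)$; $K_{h_A}(x):=K(x/h_A)/h_A$; $\gamma_{h_A,a}^o(L):=\mathbb E[K_{h_A}(A-a)\mid L]$; $\|g\|_2^2:=\int|g(l)|^2\,\mathrm dP_L(l)$. Estimator. Randomly partition the sample into $K$ folds $\{I_k\}$ ($K$ fixed); using the samples outside $I_k$, fit estimators $\hat\gamma_{h_A,a}^{(n,-k)}$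 of $\gamma_{h_A,a}^o$ and $\hat\rho_\pi^{(n,-k)}$ of $\rho_\pi^o$. For $i\in I_k$ put $\hat S_{\pi,h_A}(a,O_i)=(K_{h_A}(A_i-a)-\hat\gamma_{h_A,a}^{(n,-k)}(L_i))(\pi(Z_i,L_i)-\hat\rho_\pi^{(n,-k)}(L_i))$. With $n_L=\sum_{i=1}^nI(L_i=l)$, $$\tilde\zeta_{\pi,h_A}^{(n)}(a,l)=\frac1{n_L}\sum_{i=1}^n\hat S_{\pi,h_A}(a,O_i)\,I(L_i=l).$$
   Formalization: Condition (iii) alone is insufficient; the formal theorem also assumes that the second-order Taylor remainder of p_{A|Z,L}(·|z,l) at a is O(t²) uniformly in (z,l), and that π is measurable with E[π(Z,L)²] finite. *)

(* Defs.v *)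
From HB Require Import structures.
From mathcomp Require Import all_boot all_order all_algebra.
From mathcomp Require Import all_classical all_reals all_analysis.

Set Implicit Arguments.
Unset Strict Implicit.
Unset Printing Implicit Defensive.

Import Order.TTheory GRing.Theory Num.Theory.
Import numFieldNormedType.Exports.

Local Open Scope classical_set_scope.
Local Open Scope ring_scope.

HB.instance Definition _ (m : nat) := @isPointed.Build 'I_m.+1 ord0.
HB.instance Definition _ (m : nat) := @isMeasurable.Build
  default_measure_display 'I_m.+1 discrete_measurable discrete_measurable0
  discrete_measurableC discrete_measurableU.

(* An observation O = [L, Z, A, Y]: the discrete confounder has m + 1 levels,
   the instrument takes values in R^d. *)
Notation obs R m d := ('I_m.+1 * d.-tuple R * R * R)%type.

Section Observation.
Context {R : realType} {m d : nat}.
Definition oL (o : obs R m d) : 'I_m.+1 := o.1.1.1.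
Definition oZ (o : obs R m d) : d.-tuple R := o.1.1.2.
Definition oA (o : obs R m d) : R := o.1.2.
Definition oY (o : obs R m d) : R := o.2.
End Observation.

Section Kernel.
Context {R : realType}.
Local Notation leb := (@lebesgue_measure R).

(* K cannot be strictly positive off [-1, 1]: positivity means K >= 0. *)
Definition is_smoothing_kernel (K : R -> R) : Prop :=
  [/\ continuous K,
      forall s, 0 <= K s,
      forall s, K (- s) = K s &
      closure [set s | K s != 0] = [set` `[-1, 1]] ] /\
  [/\ \int[leb]_s K s = 1,
      \int[leb]_s (K s * s) = 0 &
      0 < \int[leb]_s (K s * s ^+ 2)].

Definition scaled_kernel (K : R -> R) (h x : R) : R := K (x / h) / h.

End Kernel.

(* Q is the law of the generic observation O. *)
Section Population.
Context {R : realType} {m d : nat} (Q : probability (obs R m d) R).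
Local Notation leb := (@lebesgue_measure R).
Implicit Types (g pi : d.-tuple R -> 'I_m.+1 -> R).
Implicit Types (p : R -> d.-tuple R -> 'I_m.+1 -> R) (l : 'I_m.+1).

Definition pL l : R := fine (Q [set o | oL o = l]).

(* E[f(O) | L = l] *)
Definition condmeanL (f : obs R m d -> R) l : R :=
  (\int[Q]_(o in [set o | oL o = l]) f o) / pL l.

(* ||g||_2 in L^2(P_L) *)
Definition norm2L (g : 'I_m.+1 -> R) : R :=
  Num.sqrt (\sum_(l < m.+1) `|g l| ^+ 2 * pL l).

Definition supportA : set R :=
  [set x | forall e : R, 0 < e -> (0 < Q [set o | (`|oA o - x| < e)%R])%E].

(* p x z l is a version, jointly measurable in (x, z), of the conditional
   Lebesgue density at x of A given Z = z and L = l. *)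
Definition is_cond_densityA (Zs : set (d.-tuple R)) p : Prop :=
  [/\ forall l, measurable_fun [set: R * d.-tuple R]
                  (fun xz : R * d.-tuple R => p xz.1 xz.2 l),
      forall x z l, Zs z -> 0 <= p x z l,
      forall z l, Zs z -> (\int[leb]_x (p x z l)%:E = 1)%E &
      forall (B : set R) (C : set (d.-tuple R)) l,
        measurable B -> measurable C ->
        Q [set o | [/\ B (oA o), C (oZ o) & oL o = l]] =
        (\int[Q]_(o in [set o | C (oZ o) /\ oL o = l])
           \int[leb]_(x in B) (p x (oZ o) l)%:E)%E].

(* Conditional quantities at a point x are sensitive to the choice of versions.
   As usual, those given L and given (A, L) are derived from p_{A|Z,L}: the
   density of A given L is the mixture of the p_{A|Z,L}, and the law of Z given
   (A, L) = (x, l) has density p x z l / p_{A|L}(x | l) with respect to the law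
   of Z given L = l (Bayes' formula). *)
Definition pAL p (x : R) l : R := condmeanL (fun o => p x (oZ o) l) l.

(* E[g(Z, L) | A = x, L = l] *)
Definition condmeanAL p g (x : R) l : R :=
  condmeanL (fun o => g (oZ o) l * p x (oZ o) l) l / pAL p x l.

Definition rho pi l : R := condmeanL (fun o => pi (oZ o) (oL o)) l.

Definition kappa p pi (x : R) l : R := condmeanAL p pi x l - rho pi l.

Definition zeta p pi (x : R) l : R := pAL p x l * kappa p pi x l.

Definition gamma (K : R -> R) (h a : R) l : R :=
  condmeanL (fun o => scaled_kernel K h (oA o - a)) l.

Definition bias_zeta p pi (K : R -> R) (h a : R) l : R :=
  h ^+ 2 / 2 *
  condmeanL (fun o => ((fun x => p x (oZ o) (oL o))^`(2))%classic a *
                      (pi (oZ o) (oL o) - rho pi (oL o))) l *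
  \int[leb]_x (K x * x ^+ 2).

Definition sigma2_zeta p pi (K : R -> R) (a : R) l : R :=
  pAL p a l / pL l * (\int[leb]_x (K x ^+ 2)) *
  condmeanAL p (fun z l' => (pi z l' - rho pi l') ^+ 2) a l.

End Population.

Section Smoothness.
Context {R : realType} {m d : nat}.
Implicit Types (Zs : set (d.-tuple R)).
Implicit Types (p : R -> d.-tuple R -> 'I_m.+1 -> R).

Definition twice_differentiable_at (f : R -> R) (a : R) : Prop :=
  (\forall x \near a, derivable f x 1) /\ derivable (f^`())%classic a 1.

(* The second-order Taylor remainder of p_{A|Z,L}( . | z, l) at a is bounded
   uniformly in (z, l).  This holds in particular if the second derivative
   exists and is bounded on ]a - e, a + e[, uniformly in (z, l), or if Zs is
   finite and all second derivatives at a exist. *)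
Definition uniformly_second_order Zs p (a : R) : Prop :=
  exists C e : R, 0 < e /\
    forall z l t, Zs z -> `|t| <= e ->
      `|p (a + t) z l - p a z l - ((fun x => p x z l)^`())%classic a * t| <= C * t ^+ 2.

End Smoothness.

Section Asymptotics.
Context {dT : measure_display} {T : measurableType dT} {R : realType}.
Context (P : probability T R).
Implicit Types (X : nat -> T -> R) (r : nat -> R).

Definition bigOp X r : Prop :=
  forall eps : R, 0 < eps -> exists2 M : R, 0 < M &
    \forall n \near \oo, (P [set w | (M * r n < `|X n w|)%R] <= eps%:E)%E.

Definition littleop X r : Prop :=
  forall eps : R, 0 < eps ->
    P [set w | eps * r n < `|X n w|] @[n --> \oo] --> 0%E.

Definition cvg_in_law X (mu : probability (measurableTypeR R) R) : Prop :=
  forall f : R -> R, continuous f -> (exists M : R, forall x, `|f x| <= M) ->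
    (\int[P]_w f (X n w)) @[n --> \oo] --> \int[mu]_x f x.

End Asymptotics.

(* normal_prob 0 0 is a junk value; N(0, 0) is the Dirac mass at 0. *)
Definition centered_normal {R : realType} (sigma2 : R) :
    probability (measurableTypeR R) R :=
  if sigma2 == 0 then (\d_(0 : measurableTypeR R) : probability _ R)
  else normal_prob 0 (Num.sqrt sigma2).

Section Sample.
Context {dT : measure_display} {T : measurableType dT} {R : realType}.
Context (P : probability T R) {m d Kf : nat}.
Context (O : nat -> {RV P >-> obs R m d}).
Context (fold : forall n, T -> {ffun 'I_n -> 'I_Kf}).

Definition iid_copies (Q : probability (obs R m d) R) : Prop :=
  (forall i (B : set (obs R m d)), measurable B -> P (O i @^-1` B) = Q B) /\
  (forall n (B : 'I_n -> set (obs R m d)), (forall i, measurable (B i)) ->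
    P (\bigcap_(i in [set: 'I_n]) (O i @^-1` B i)) =
    (\prod_(i < n) P (O i @^-1` B i))%E).

(* fold n w i is the fold to which the i-th of the first n observations is
   assigned; the assignment is random and independent of the sample. *)
Definition random_folds : Prop :=
  (forall n f, measurable [set w | fold n w = f]) /\
  (forall n f (B : 'I_n -> set (obs R m d)), (forall i, measurable (B i)) ->
    P ([set w | fold n w = f] `&`
       \bigcap_(i in [set: 'I_n]) (O i @^-1` B i)) =
    (P [set w | fold n w = f] *
     P (\bigcap_(i in [set: 'I_n]) (O i @^-1` B i)))%E).

Definition sample (n : nat) (w : T) : n.-tuple (obs R m d) :=
  [tuple O i w | i < n].

End Sample.

Section CrossFitting.
Context {R : realType} {m d Kf : nat}.

(* The fitting procedures of a function of L: fit n k f o is the estimate for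
   fold k, fitted from the fold assignment f and the sample o. *)
Definition fit_procedure : Type :=
  forall n, 'I_Kf -> {ffun 'I_n -> 'I_Kf} -> n.-tuple (obs R m d) ->
    'I_m.+1 -> R.

Definition fitted_out_of_fold (fit : fit_procedure) : Prop :=
  (forall n k (f : {ffun 'I_n -> 'I_Kf}) l,
     measurable_fun [set: n.-tuple (obs R m d)]
                     (fun o => fit n k f o l)) /\
  (forall n k (f : {ffun 'I_n -> 'I_Kf}) (o o' : n.-tuple (obs R m d)),
     (forall i, f i != k -> tnth o i = tnth o' i) ->
     fit n k f o = fit n k f o').

Definition S_hat (pi : d.-tuple R -> 'I_m.+1 -> R) (K : R -> R) (h a : R)
    (gam rh : 'I_m.+1 -> R) (o : obs R m d) : R :=
  (scaled_kernel K h (oA o - a) - gam (oL o)) *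
  (pi (oZ o) (oL o) - rh (oL o)).

Definition zeta_tilde (pi : d.-tuple R -> 'I_m.+1 -> R) (K : R -> R) (h a : R)
    (gam_fit rho_fit : fit_procedure) n (f : {ffun 'I_n -> 'I_Kf})
    (o : n.-tuple (obs R m d)) (l : 'I_m.+1) : R :=
  (\sum_(i < n) (oL (tnth o i) == l)%:R)^-1 *
  \sum_(i < n)
    S_hat pi K h a (gam_fit n (f i) f o) (rho_fit n (f i) f o) (tnth o i) *
    (oL (tnth o i) == l)%:R.

End CrossFitting.
Arguments fit_procedure : clear implicits.

(* Main.v *)
(** Since L is discrete, on the level L = l the nuisance errors
    g_k = gam_fit - gamma and r_k = rho_fit - rho are numbers attached to the
    fold k.  Expanding the product defining S_hat, the sum over the level is the
    sum of the oracle scores (K_h(A - a) - gamma)(pi - rho), minus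
    \sum_k g_k \sum_(i in I_k) (pi - rho), minus
    \sum_k r_k \sum_(i in I_k) (K_h(A - a) - gamma), plus \sum_k g_k r_k |I_k|.
    The inner sums are centered given the partition, hence of order sqrt n and
    sqrt (n / h) by Chebyshev, so the rates assumed on g_k, r_k and g_k r_k make
    the three error terms negligible with respect to sqrt (n / h).

    What remains is the oracle sum.  Disintegrating the law of (A, Z) on the level
    along p(a | z, l), its mean and its variance are integrals over Z of p(. | z, l)
    smoothed by K_h and K_h^2; a second order Taylor expansion at a gives the bias
    and the limiting variance.  A triangular-array central limit theorem is proved
    by replacing the summands one at a time by Gaussian ones inside a smooth test
    function, with Lindeberg's condition in the form
    n E[u^2 min(1, |u|)] -> 0. *)

From HB Require Import structures.
Require Import Defs.
From mathcomp Require Import all_boot all_order all_algebra.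
From mathcomp Require Import all_classical all_reals all_analysis.
From mathcomp Require Import measurable_realfun.
From mathcomp Require Import ring lra.
Import Order.TTheory GRing.Theory Num.Theory.
Import numFieldNormedType.Exports.
Local Open Scope classical_set_scope.
Local Open Scope ring_scope.
Set Implicit Arguments.
Unset Strict Implicit.
Unset Printing Implicit Defensive.

(** * Measures and integrals *)

(** The second derivative of the density is given at [a] only, and the weight [pi] is only square
    integrable. The bias is therefore obtained in two layers: for fixed z a Peano expansion at [a]
    yields the limit, while the uniform bound C t^2 on the first order remainder supplies the
    dominating function. Since a conditional density has mass 1, that same bound also controls its
    value and slope at [a] uniformly in z, which makes every constant of the variance and bias
    estimates uniform.

    The density is meaningful for z in [Zs] only, a set that carries the law of Z but need not be
    measurable. Integrals over the level are moved to the level minus a measurable null set, through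
    an almost everywhere lemma valid for arbitrary integrands.

    The error terms, and the replacement of the random size of the level by n p_L(l), share one
    scheme: a factor tending to 0 in probability times a tight factor. *)

Section density.
Local Open Scope ereal_scope.
Context d (T : measurableType d) (R : realType).
Variables (mu : {measure set T -> \bar R}) (g : T -> R).
Hypothesis mg : measurable_fun [set: T] g.
Hypothesis g0 : forall x, (0 <= g x)%R.

(** Both proofs are arguments so that the term itself determines the measure structure attached to
    it below. *)
Definition mdensity (_ : measurable_fun [set: T] g) (_ : forall x, (0 <= g x)%R)
  (A : set T) : \bar R := \int[mu]_(x in A) (g x)%:E.

Local Notation nu := (mdensity mg g0).

Let nu0 : nu set0 = 0.
Proof. by rewrite /mdensity integral_set0. Qed.

Let nu_ge0 A : 0 <= nu A.
Proof. by apply: integral_ge0 => x _; rewrite lee_fin. Qed.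

Let nu_sigma_additive : semi_sigma_additive nu.
Proof.
move=> F mF tF mUF; rewrite /mdensity ge0_integral_bigcup//.
  apply: is_cvg_ereal_nneg_natsum_cond => n _ _.
  by apply: integral_ge0 => x _; rewrite lee_fin.
- exact/measurable_EFinP/measurable_funTS.
- by move=> x _; rewrite lee_fin.
Qed.

HB.instance Definition _ := isMeasure.Build _ _ _ nu nu0 nu_ge0 nu_sigma_additive.

Import HBNNSimple.

(** Monotone convergence along the simple functions approximating [f]. The measure [m] is only
    assumed to agree with the density on measurable sets, so that the lemma serves for Gaussian
    laws, for the restriction of a law to an event (density [\1_D]) and for [mdensity] itself. *)
Lemma ge0_integral_density (m : {measure set T -> \bar R}) (f : T -> \bar R) :
  (forall A, measurable A -> m A = \int[mu]_(x in A) (g x)%:E) ->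
  measurable_fun [set: T] f -> (forall x, 0 <= f x) ->
  \int[m]_x f x = \int[mu]_x (f x * (g x)%:E).
Proof.
move=> mE mf f0.
pose f_ := nnsfun_approx measurableT mf.
have f_f x : (f_ n x)%:E @[n --> \oo] --> f x by exact: cvg_nnsfun_approx.
transitivity (limn (fun n => \int[m]_x (f_ n x)%:E)).
  rewrite -monotone_convergence//=.
  - by apply: eq_integral => x _; apply/esym/cvg_lim.
  - by move=> n; apply/measurable_EFinP.
  - by move=> n x _; rewrite lee_fin.
  - by move=> x _ a b ab; rewrite lee_fin//; exact/lefP/nd_nnsfun_approx.
transitivity (limn (fun n => \int[mu]_x ((f_ n x)%:E * (g x)%:E))); last first.
  rewrite -monotone_convergence//=.
  - apply: eq_integral => x _; apply/cvg_lim => //.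
    by apply: cvgeZr.
  - by move=> n; apply: emeasurable_funM; apply/measurable_EFinP.
  - by move=> n x _; rewrite mule_ge0// lee_fin.
  - move=> x _ a b ab; rewrite lee_wpmul2r// lee_fin//; exact/lefP/nd_nnsfun_approx.
congr (limn _); apply/funext => n.
under eq_integral do rewrite fimfunE -fsumEFin//.
rewrite [LHS]ge0_integral_fsum//; last 2 first.
  - by move=> r; exact/measurable_EFinP/measurableT_comp.
  - by move=> r x _; rewrite EFinM nnfun_muleindic_ge0.
under [RHS]eq_integral.
  move=> x _; rewrite fimfunE -fsumEFin// ge0_mule_fsuml; last first.
    by move=> r; rewrite EFinM nnfun_muleindic_ge0.
  over.
rewrite [RHS]ge0_integral_fsum//; last 2 first.
  - move=> r; apply: emeasurable_funM; apply/measurable_EFinP => //; exact/measurableT_comp.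
  - move=> r x _; apply: mule_ge0; last by rewrite lee_fin.
    by rewrite EFinM nnfun_muleindic_ge0.
apply: eq_fsbigr => r _.
rewrite integralZl_indic_nnsfun// integral_indic// setIT mE//.
have [r0|r0] := leP 0%R r.
  under [RHS]eq_integral do rewrite EFinM -muleA.
  rewrite ge0_integralZl//.
  - congr (_ * _); rewrite integral_mkcond; apply: eq_integral => x _.
    by rewrite epatch_indic/= muleC.
  - by apply: emeasurable_funM; exact/measurable_EFinP.
  - by move=> x _; rewrite mule_ge0// lee_fin.
rewrite preimage_nnfun0// integral_set0 mule0.
by under eq_integral do rewrite indic0 mulr0 mul0e; rewrite integral0.
Qed.

End density.

(** Rectangles are stable under intersection and generate the product sigma-algebra; the finiteness
    of [m1] lets the whole space serve as the exhausting sequence. *)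
Lemma measure_prod_unique d1 d2 (T1 : measurableType d1) (T2 : measurableType d2)
    (R : realType) (m1 m2 : {measure set (T1 * T2) -> \bar R}) :
  (m1 setT < +oo)%E ->
  (forall A B, measurable A -> measurable B -> m1 (A `*` B) = m2 (A `*` B)) ->
  forall E, measurable E -> m1 E = m2 E.
Proof.
move=> m1oo m12.
apply: (measure_unique [set A `*` B | A in measurable & B in measurable]
                       (fun _ => setT)) => //.
- exact: measurable_prod_measurableType.
- move=> _ _ [A mA [B mB <-]] [C mC [D mD <-]].
  rewrite -setXI; exists (A `&` C); first exact: measurableI.
  by exists (B `&` D) => //; exact: measurableI.
- by move=> _; exists setT => //; exists setT => //; rewrite setXTT.
- by rewrite bigcup_const.
- by move=> _ [A mA [B mB <-]]; exact: m12.
Qed.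

Definition tuple_box (T : Type) n (B : 'I_n -> set T) : set (n.-tuple T) :=
  [set x | forall i, B i (tnth x i)].

Lemma measure_tuple_unique d (T : measurableType d) (R : realType) n
    (m1 m2 : {measure set (n.-tuple T) -> \bar R}) :
  (m1 setT < +oo)%E ->
  (forall B : 'I_n -> set T, (forall i, measurable (B i)) ->
     m1 (tuple_box B) = m2 (tuple_box B)) ->
  forall E, measurable E -> m1 E = m2 E.
Proof.
move=> m1oo m12.
pose G := [set tuple_box B | B in [set B : 'I_n -> set T | forall i, measurable (B i)]].
have mG (B : 'I_n -> set T) : (forall i, measurable (B i)) -> measurable (tuple_box B).
  move=> mB; have -> : tuple_box B = \bigcap_(i in [set: 'I_n]) ((fun x => tnth x i) @^-1` B i).
    by apply/seteqP; split => x /= xB i; [move=> _; exact: xB|exact: xB i I].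
  apply: fin_bigcap_measurable => // i _.
  by rewrite -[X in measurable X]setTI; exact: measurable_tnth.
apply: (measure_unique G (fun _ => setT)) => //.
- apply/seteqP; split => [E|].
    (* The sigma-algebra of tuples is generated by preimages under single coordinates; such a
       preimage is a box all of whose other sides are full. *)
    change (g_sigma_preimage (fun i (x : n.-tuple T) => tnth x i) E -> <<s G >> E).
    apply: sub_sigma_algebra2; elim/big_ind: _ => [//|A B AG BG F [/AG|/BG]//|].
    move=> i _ _ [B mB <-].
    exists (fun j => if j == i then B else setT).
      by move=> j; case: ifP.
    rewrite setTI; apply/seteqP; split => [x /(_ i)|x /= xB j]; first by rewrite eqxx.
    by case: eqP => [->|].
  apply: smallest_sub; first exact: sigma_algebra_measurable.
  by move=> _ [B mB <-]; exact: mG.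
- move=> _ _ [A mA <-] [B mB <-]; exists (fun i => A i `&` B i).
    by move=> i; exact: measurableI.
  by apply/seteqP; split => x /= => [AB|[xA xB] i] //; split => i; case: (AB i).
- by move=> _; exists (fun _ => setT) => //; apply/seteqP; split.
- by rewrite bigcup_const.
- by move=> _ [B mB <-]; exact: m12.
Qed.

Section integral_ae_eq_nonmeasurable.
Local Open Scope ereal_scope.
Context d (T : measurableType d) (R : realType).
Variable mu : {measure set T -> \bar R}.

Import HBNNSimple.

Let ge0_le_integral_ae (f g : T -> \bar R) :
  (forall x, 0 <= f x) -> (forall x, 0 <= g x) ->
  {ae mu, forall x, f x = g x} -> \int[mu]_x f x <= \int[mu]_x g x.
Proof.
move=> f0 g0 [N [mN N0 fgN]]; rewrite !ge0_integralTE//.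
apply: ge_ereal_sup => _ [h hf <-].
apply: ereal_sup_ubound; exists (proj_nnsfun h (measurableC mN)).
  move=> x /=; have [xN|xN] := pselect (N x).
    by rewrite /mindic indicE/= memNset ?mulr0//; apply/not_notP.
  rewrite /mindic indicE mem_set// mulr1 -(_ : f x = g x)//.
  by apply: contrapT => /fgN.
rewrite -!integralT_nnsfun; apply: ge0_ae_eq_integral => //.
- exact/measurable_EFinP.
- exact/measurable_EFinP.
- by move=> x _; rewrite lee_fin.
- by move=> x _; rewrite lee_fin.
exists N; split => // x /= /not_implyP[_ neq]; apply: contrapT => xN; apply: neq.
by rewrite /= /mindic indicE mem_set// mulr1.
Qed.

(* No measurability is assumed: changing a function on a null set changes none
   of the simple functions below it by more than a null set. *)
Lemma eq_integral_ae (D : set T) (f g : T -> \bar R) :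
  {ae mu, forall x, D x -> f x = g x} ->
  \int[mu]_(x in D) f x = \int[mu]_(x in D) g x.
Proof.
move=> fg; rewrite integral_mkcond [RHS]integral_mkcond integralE [RHS]integralE.
have fgD : {ae mu, forall x, (f \_ D) x = (g \_ D) x}.
  by apply: filterS fg => x fg; rewrite !patchE; case: ifP => // /set_mem/fg.
congr (_ - _); apply/eqP; rewrite eq_le; apply/andP; split;
  apply: ge0_le_integral_ae => //; apply: filterS fgD => x.
all: by rewrite ?funeposE ?funenegE => ->.
Qed.

End integral_ae_eq_nonmeasurable.

(** * Independence and sums of i.i.d. terms *)

Section independence.
Context d (T : measurableType d) (R : realType) (P : probability T R).

(** The hypothesis says that the pair (X, Y) has law [distribution P X \x Q]; what remains is
    Tonelli's theorem. *)
Lemma ge0_integral_indep d1 d2 (V : measurableType d1) (U : measurableType d2)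
    (Q : probability U R) (X : T -> V) (Y : T -> U) (f : V * U -> \bar R) :
  measurable_fun setT X -> measurable_fun setT Y ->
  (forall A B, measurable A -> measurable B ->
     P (X @^-1` A `&` Y @^-1` B) = (P (X @^-1` A) * Q B)%E) ->
  measurable_fun setT f -> (forall x, (0 <= f x)%E) ->
  (\int[P]_w f (X w, Y w) = \int[Q]_u \int[P]_w f (X w, u))%E.
Proof.
move=> mX mY XY mf f0.
pose X' : {RV P >-> V} := HB.pack X (isMeasurableFun.Build _ _ _ _ X mX).
have mXY : measurable_fun setT (fun w => (X w, Y w)) by exact: measurable_fun_pair.
transitivity (\int[pushforward P (fun w => (X w, Y w))]_z f z)%E.
  by rewrite (ge0_integral_pushforward mXY).
rewrite (eq_measure_integral (distribution P X' \x Q)%E); last first.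
  move=> A mA _; by apply/esym; apply: product_measure_unique.
rewrite fubini_tonelli2//; apply: eq_integral => u _.
rewrite /fubini_G ge0_integral_distribution//.
by apply: (measurableT_comp mf); exact: measurable_fun_pair.
Qed.

Context d' (U : measurableType d') (Q : probability U R).
Variable X : nat -> T -> U.
Hypothesis mX : forall i, measurable_fun setT (X i).

Definition tuple_of n (w : T) : n.-tuple U := [tuple X i w | i < n].

Lemma measurable_tuple_of n : measurable_fun setT (@tuple_of n).
Proof.
apply/measurable_fun_tnthP => i.
rewrite [X in measurable_fun _ X](_ : _ = X i); first exact: mX.
by apply/funext => w /=; rewrite tnth_mktuple.
Qed.

Hypothesis iid : forall n (B : 'I_n -> set U), (forall i, measurable (B i)) ->
  P (\bigcap_(i in [set: 'I_n]) (X i @^-1` B i)) = (\prod_(i < n) Q (B i))%E.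

(** Both sides are finite measures in [E] that agree on boxes. The event [F] is used in two ways:
    the next observation falls in a given set ([c] is then its probability under [Q]), or the random
    partition takes a given value. *)
Lemma event_indep_tuple (F : set T) (c : {nonneg R}) n : measurable F ->
  (forall B : 'I_n -> set U, (forall i, measurable (B i)) ->
     P (F `&` \bigcap_(i in [set: 'I_n]) (X i @^-1` B i)) =
     (c%:num%:E * P (\bigcap_(i in [set: 'I_n]) (X i @^-1` B i)))%E) ->
  forall E, measurable E ->
    P (F `&` @tuple_of n @^-1` E) = (c%:num%:E * P (@tuple_of n @^-1` E))%E.
Proof.
move=> mF FX E mE.
pose t : {RV P >-> n.-tuple U} :=
  HB.pack (@tuple_of n) (isMeasurableFun.Build _ _ _ _ _ (@measurable_tuple_of n)).
have box (B : 'I_n -> set U) :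
    @tuple_of n @^-1` tuple_box B = \bigcap_(i in [set: 'I_n]) (X i @^-1` B i).
  by apply/seteqP; split => w /= tB i; have := tB i; rewrite tnth_mktuple => //; apply.
transitivity (pushforward (mrestr P mF) (@tuple_of n) E).
  by rewrite /pushforward/= /mrestr/= setIC.
transitivity (mscale c (distribution P t) E); last by [].
apply: measure_tuple_unique mE => [|mt|mt].
- exact: measurable_tuple_of.
- by apply: (le_lt_trans (probability_le1 P _)); rewrite ?ltry// preimage_setT setTI.
- move=> B mB; transitivity (P (F `&` @tuple_of n @^-1` tuple_box B)).
    by rewrite setIC.
  by rewrite box FX// -box.
Qed.

Lemma tuple_indep_next n E B : measurable E -> measurable B ->
  P (@tuple_of n @^-1` E `&` X n @^-1` B) = (P (@tuple_of n @^-1` E) * Q B)%E.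
Proof.
move=> mE mB.
have mXB : measurable (X n @^-1` B) by rewrite -[X in measurable X]setTI; exact: mX.
have QB0 : (0 <= fine (Q B))%R by rewrite fine_ge0.
have QBE : Q B = (NngNum QB0)%:num%:E by rewrite /= fineK// fin_num_measure.
rewrite setIC muleC QBE; apply: event_indep_tuple => // C mC.
rewrite -QBE iid// muleC.
(* Adding [B] as last side turns the event into a box for n + 1 observations, where [iid]
   applies. *)
pose D (i : 'I_n.+1) := if unlift ord_max i is Some j then C j else B.
have mD i : measurable (D i) by rewrite /D; case: unlift.
have -> : X n @^-1` B `&` \bigcap_(i in [set: 'I_n]) (X i @^-1` C i) =
          \bigcap_(i in [set: 'I_n.+1]) (X i @^-1` D i).
  apply/seteqP; split => [w [Bw Cw] i _|w Dw].
    rewrite /D /=; case: unliftP => [j ->|-> //]; rewrite lift_max; exact: Cw.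
  split; first by have := Dw ord_max I; rewrite /D unlift_none.
  by move=> i _; have := Dw (lift ord_max i) I; rewrite /D liftK lift_max.
rewrite iid// big_ord_recr/= [D ord_max]/D unlift_none.
congr (_ * _)%E; apply: eq_bigr => i _; rewrite /D.
have -> : widen_ord (leqnSn n) i = lift ord_max i by apply/val_inj; rewrite /= /bump leqNgt ltn_ord.
by rewrite liftK.
Qed.

End independence.

Section Rintegral_extra.
Context d (T : measurableType d) (R : realType) (mu : {measure set T -> \bar R}).
Implicit Types (D : set T) (f g : T -> R).

Lemma EFin_Rintegral D f : measurable D -> mu.-integrable D (EFin \o f) ->
  (\int[mu]_(x in D) (f x)%:E)%E = (\int[mu]_(x in D) f x)%:E.
Proof. by move=> mD fi; rewrite fineK//; exact: integrable_fin_num fi. Qed.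

Lemma le_integrable_norm D f g : measurable D -> measurable_fun D f ->
  (forall x, D x -> `|f x| <= g x) ->
  mu.-integrable D (EFin \o g) -> mu.-integrable D (EFin \o f).
Proof.
move=> mD mf fg; apply: le_integrable => //; first exact/measurable_EFinP.
by move=> x Dx /=; rewrite lee_fin (le_trans (fg _ Dx))// ler_norm.
Qed.

Lemma integrableM_bounded D f g (M : R) : measurable D ->
  measurable_fun D f -> (forall x, D x -> `|f x| <= M) ->
  mu.-integrable D (EFin \o g) ->
  mu.-integrable D (EFin \o (fun x => f x * g x)).
Proof.
move=> mD mf fM gi; have mg := measurable_int _ gi.
apply: (@le_integrable_norm _ _ (fun x => M * `|g x|)) => //.
- by apply: measurable_funM => //; exact/measurable_EFinP.
- by move=> x Dx; rewrite normrM ler_wpM2r// fM.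
have := integrableZl mD M (integrable_norm gi).
by apply: eq_integrable.
Qed.

Lemma le_Rintegral_norm D f g : measurable D -> mu.-integrable D (EFin \o g) ->
  measurable_fun D f -> (forall x, D x -> `|f x| <= g x) ->
  `|\int[mu]_(x in D) f x| <= \int[mu]_(x in D) g x.
Proof.
move=> mD gi mf fg.
have fi : mu.-integrable D (EFin \o f) by exact: le_integrable_norm fg gi.
apply: (le_trans (le_normr_Rintegral mD fi)).
by apply: le_Rintegral => //; exact: integrable_norm.
Qed.

Lemma dominated_convergence_Rintegral D (f_ : nat -> T -> R) f g :
  measurable D ->
  (forall n, measurable_fun D (f_ n)) -> measurable_fun D f ->
  {ae mu, forall x, D x -> f_ n x @[n --> \oo] --> f x} ->
  mu.-integrable D (EFin \o g) ->
  {ae mu, forall x n, D x -> `|f_ n x| <= g x} ->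
  \int[mu]_(x in D) f_ n x @[n --> \oo] --> \int[mu]_(x in D) f x.
Proof.
move=> mD mf_ mf ff gi fg.
have mF n : measurable_fun D (EFin \o f_ n) by exact/measurable_EFinP.
have mG : measurable_fun D (EFin \o f) by exact/measurable_EFinP.
have cvF : {ae mu, forall x, D x -> (EFin \o f_ n) x @[n --> \oo] --> (EFin \o f) x}.
  by apply: filterS ff => x ff Dx; apply: cvg_EFin (ff Dx); exact: nearW.
have dom : {ae mu, forall x n, D x -> (`|(EFin \o f_ n) x| <= (EFin \o g) x)%E}.
  by apply: filterS fg => x fg n Dx; rewrite /= lee_fin fg.
have [fi _ cvg] := dominated_convergence mD mF mG cvF gi dom.
apply: fine_cvg; rewrite fineK; first exact: cvg.
exact: integrable_fin_num fi.
Qed.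

Lemma integrable_mulrl D f (k : R) : measurable D -> mu.-integrable D (EFin \o f) ->
  mu.-integrable D (EFin \o (fun x => k * f x)).
Proof. by move=> mD fi; have := integrableZl mD k fi; apply: eq_integrable. Qed.

Lemma integrable_addr D f g : measurable D -> mu.-integrable D (EFin \o f) ->
  mu.-integrable D (EFin \o g) -> mu.-integrable D (EFin \o (fun x => f x + g x)).
Proof. by move=> mD fi gi; have := integrableD mD fi gi; apply: eq_integrable. Qed.

Lemma integrable_subr D f g : measurable D -> mu.-integrable D (EFin \o f) ->
  mu.-integrable D (EFin \o g) -> mu.-integrable D (EFin \o (fun x => f x - g x)).
Proof. by move=> mD fi gi; have := integrableB mD fi gi; apply: eq_integrable. Qed.

End Rintegral_extra.

Section Rintegral_finite.
Context d (T : measurableType d) (R : realType).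
Variable mu : {finite_measure set T -> \bar R}.
Implicit Types (D : set T) (f g : T -> R).

Lemma bounded_integrable D f (M : R) : measurable D -> measurable_fun D f ->
  (forall x, D x -> `|f x| <= M) -> mu.-integrable D (EFin \o f).
Proof.
move=> mD mf fM; apply: (le_integrable_norm (g := cst M)) => //.
exact: finite_measure_integrable_cst.
Qed.

Lemma integrable_of_sqr D f : measurable D -> measurable_fun D f ->
  mu.-integrable D (EFin \o (fun x => f x ^+ 2)) -> mu.-integrable D (EFin \o f).
Proof.
move=> mD mf f2; apply: (le_integrable_norm (g := fun x => 1 + f x ^+ 2)) => //.
  move=> x _; rewrite -(real_normK (num_real (f x))).
  have := sqr_ge0 (`|f x| - 1); have := normr_ge0 (f x); nra.
have i1 : mu.-integrable D (EFin \o cst 1) by exact: finite_measure_integrable_cst.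
by have := integrableD mD i1 f2; apply: eq_integrable.
Qed.

End Rintegral_finite.

Lemma Rintegral_prob_cst d (T : measurableType d) (R : realType)
  (P : probability T R) (c : R) : \int[P]_x c = c.
Proof.
rewrite Rintegral_cst//.
rewrite (_ : fine _ = 1) ?mulr1//; rewrite -[RHS]/(fine 1%E); congr fine.
exact: probability_setT.
Qed.

Section iid_sums.
Context d (T : measurableType d) (R : realType) (P : probability T R).
Context d' (U : measurableType d') (Q : probability U R).
Variable X : nat -> T -> U.
Hypothesis mX : forall i, measurable_fun setT (X i).
Hypothesis iid : forall n (B : 'I_n -> set U), (forall i, measurable (B i)) ->
  P (\bigcap_(i in [set: 'I_n]) (X i @^-1` B i)) = (\prod_(i < n) Q (B i))%E.
Variables (u : U -> R) (c : nat -> R).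
Hypothesis mu : measurable_fun setT u.

(** Weights 0 and 1 select the observations of one fold; constant weights 1 give the full sum. *)
Definition weighted_sum n (w : T) : R := \sum_(i < n) c i * u (X i w).

Let tuple_sum n (t : n.-tuple U) : R := \sum_(i < n) c i * u (tnth t i).

Let measurable_tuple_sum n : measurable_fun setT (@tuple_sum n).
Proof.
apply: measurable_sum => i; apply: measurable_funM => //.
apply: measurableT_comp => //; exact: measurable_tnth.
Qed.

Let weighted_sumE n : weighted_sum n = @tuple_sum n \o tuple_of X n.
Proof.
by apply/funext => w; apply: eq_bigr => i _; rewrite tnth_mktuple.
Qed.

Lemma measurable_weighted_sum n : measurable_fun setT (weighted_sum n).
Proof.
apply: measurable_sum => i; apply: measurable_funM => //.
exact: measurableT_comp.
Qed.

Lemma ge0_integral_weighted_sum_next n (f : R * U -> \bar R) :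
  measurable_fun setT f -> (forall x, (0 <= f x)%E) ->
  (\int[P]_w f (weighted_sum n w, X n w) =
   \int[Q]_x \int[P]_w f (weighted_sum n w, x))%E.
Proof.
move=> mf f0; apply: ge0_integral_indep => //.
  exact: measurable_weighted_sum.
move=> A B mA mB; rewrite weighted_sumE comp_preimage.
apply: tuple_indep_next => //.
by rewrite -[X in measurable X]setTI; exact: measurable_tuple_sum.
Qed.

Lemma weighted_sumS n w : weighted_sum n.+1 w = weighted_sum n w + c n * u (X n w).
Proof. by rewrite /weighted_sum big_ord_recr. Qed.

Hypothesis c1 : forall i, `|c i| <= 1.
Hypothesis u2 : Q.-integrable setT (EFin \o (fun x => u x ^+ 2)).
Hypothesis u0 : \int[Q]_x u x = 0.

(** With the next observation frozen, the square expands into the previous second moment, a cross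
    term that integrates to 0 because [u] is centered, and a term that contributes at most one
    variance as [|c n| <= 1]. Integrability is carried through the induction because the expansion
    is integrated term by term. *)
Lemma weighted_sum_sqr n :
  P.-integrable setT (EFin \o (fun w => weighted_sum n w ^+ 2)) /\
  \int[P]_w (weighted_sum n w ^+ 2) <= n%:R * \int[Q]_x (u x ^+ 2).
Proof.
have u1 : Q.-integrable setT (EFin \o u) by exact: integrable_of_sqr.
elim: n => [|n [S2 IH]].
  have S0 w : weighted_sum 0 w ^+ 2 = 0 by rewrite /weighted_sum big_ord0 expr0n.
  split.
    rewrite (_ : _ \o _ = EFin \o cst 0); first exact: finite_measure_integrable_cst.
    by apply/funext => w; rewrite /= S0.
  by under eq_Rintegral do rewrite S0; rewrite Rintegral_cst// mul0r mul0r.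
have mS := measurable_weighted_sum n.
have S1 : P.-integrable setT (EFin \o weighted_sum n) by exact: integrable_of_sqr.
set V := \int[P]_w (weighted_sum n w ^+ 2) in IH.
pose m := \int[P]_w weighted_sum n w.
have inner x : (\int[P]_w ((weighted_sum n w + c n * u x) ^+ 2)%:E =
    (V + 2 * (c n * u x) * m + (c n * u x) ^+ 2)%:E)%E.
  set a := c n * u x.
  under eq_integral do rewrite sqrrD -mulr_natl mulrA (mulrAC 2).
  have i1 : P.-integrable setT (EFin \o (fun w => 2 * a * weighted_sum n w)).
    exact: integrable_mulrl.
  have i2 : P.-integrable setT (EFin \o cst (a ^+ 2)).
    exact: finite_measure_integrable_cst.
  rewrite EFin_Rintegral//; last first.
    by apply: integrable_addr => //; exact: integrable_addr.
  rewrite RintegralD//; last exact: integrable_addr.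
  rewrite RintegralD// RintegralZl// Rintegral_prob_cst.
  by rewrite -/V -/m; congr (_ + _ * _ + _)%:E.
have i1 : Q.-integrable setT (EFin \o cst V) by exact: finite_measure_integrable_cst.
have i2 : Q.-integrable setT (EFin \o (fun x => 2 * c n * m * u x)) by exact: integrable_mulrl.
have i3 : Q.-integrable setT (EFin \o (fun x => c n ^+ 2 * u x ^+ 2)) by exact: integrable_mulrl.
have E : (\int[P]_w (weighted_sum n.+1 w ^+ 2)%:E =
    (V + c n ^+ 2 * \int[Q]_x (u x ^+ 2))%:E)%E.
  under eq_integral do rewrite weighted_sumS.
  rewrite (ge0_integral_weighted_sum_next n (f := fun z => ((z.1 + c n * u z.2) ^+ 2)%:E)).
  - under eq_integral => x _.
      rewrite inner (_ : V + _ + _ = cst V x + 2 * c n * m * u x + c n ^+ 2 * u x ^+ 2); last first.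
        by rewrite /=; ring.
      over.
    rewrite EFin_Rintegral//; last by apply: integrable_addr => //; exact: integrable_addr.
    rewrite RintegralD//; last exact: integrable_addr.
    rewrite RintegralD// !RintegralZl// u0 mulr0 addr0.
    by rewrite Rintegral_prob_cst.
  - apply/measurable_EFinP; apply: measurable_funX; apply: measurable_funD => //.
    by apply: measurable_funM => //; exact: measurableT_comp.
  - by move=> z; rewrite lee_fin sqr_ge0.
have S2' : P.-integrable setT (EFin \o (fun w => weighted_sum n.+1 w ^+ 2)).
  apply/integrableP; split.
    apply/measurable_EFinP; apply: measurable_funX; exact: measurable_weighted_sum.
  under eq_integral do rewrite /= ger0_norm ?sqr_ge0//.
  by rewrite E ltry.
split => //; rewrite -lee_fin -EFin_Rintegral// E lee_fin -natr1 mulrDl mul1r.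
rewrite lerD// ler_piMl//; first by apply: Rintegral_ge0 => x _; exact: sqr_ge0.
by rewrite -real_normK ?num_real// expr_le1.
Qed.

End iid_sums.

(** * Convergence in probability and tightness *)

Lemma cvg_inv_sqrt {R : realType} (u : nat -> R) : u n @[n --> \oo] --> +oo ->
  (Num.sqrt (u n))^-1 @[n --> \oo] --> 0.
Proof.
move=> /cvgryPge uoo; apply/cvgrPdist_le => eps eps0.
have := uoo ((eps^-1) ^+ 2); apply: filterS => n un.
have s1 : eps^-1 <= Num.sqrt (u n).
  have e0' : 0 <= eps^-1 by rewrite invr_ge0 ltW.
  by rewrite -(ger0_norm e0') -sqrtr_sqr ler_wsqrtr.
have s0 : 0 < Num.sqrt (u n) by apply: lt_le_trans s1; rewrite invr_gt0.
by rewrite sub0r normrN normfV gtr0_norm// -(invrK eps) lef_pV2// posrE invr_gt0.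
Qed.

(** The inverse is continuous off 0 only and sends 0 to 0 by convention, so the point 0 is treated
    apart. *)
Lemma measurable_invr (R : realType) : measurable_fun setT (fun x : R => x^-1).
Proof.
have -> : [set: R] = [set 0] `|` [set x | x != 0].
  by apply/seteqP; split => x //= _; case: (eqVneq x 0) => [->|]; [left|right].
have o0 : open [set x : R | x != 0] by exact: open_neq.
apply/measurable_funU => //; first exact: open_measurable.
split; first exact: measurable_fun_set1.
apply: open_continuous_measurable_fun => // x; rewrite inE /= => x0.
exact: inv_continuous.
Qed.

Section stochastic_order.
Context d (T : measurableType d) (R : realType) (P : probability T R).
Implicit Types (X Y : nat -> T -> R) (A B C : set T).

Definition measurable_seq X := forall n, measurable_fun [set: T] (X n).

(** This is X = o_p(1), and [tight] below is X = O_p(1); both constrain large n only. *)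
Definition cvg_prob0 X := forall e del : R, 0 < e -> 0 < del ->
  \forall n \near \oo, (P [set w | (e < `|X n w|)%R] <= del%:E)%E.

Definition tight X := forall del : R, 0 < del -> exists2 M : R, 0 < M &
  \forall n \near \oo, (P [set w | (M < `|X n w|)%R] <= del%:E)%E.

Lemma measurable_gt_norm (f : T -> R) (e : R) : measurable_fun setT f ->
  measurable [set w | (e < `|f w|)%R].
Proof.
move=> mf; have mg : measurable_fun setT (fun w => `|f w|) by exact: measurableT_comp.
have := mg measurableT `]e, +oo[%classic (measurable_itv _).
rewrite setTI; congr measurable; apply/seteqP.
by split => w /=; rewrite in_itv/= andbT.
Qed.

Lemma le_prob A B : measurable A -> measurable B -> A `<=` B -> (P A <= P B)%E.
Proof. by move=> mA mB AB; apply: le_measure; rewrite ?inE. Qed.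

Lemma le_prob_setU A B C (a b : R) : measurable A -> measurable B -> measurable C ->
  A `<=` B `|` C -> (P B <= a%:E)%E -> (P C <= b%:E)%E -> (P A <= (a + b)%:E)%E.
Proof.
move=> mA mB mC ABC Ba Cb; apply: le_trans (le_prob mA (measurableU _ _ mB mC) ABC) _.
have : (P (B `|` C) <= P B + P C)%E by exact: measureU2.
by move/le_trans; apply; rewrite EFinD; exact: leeD.
Qed.

Lemma le_tight X Y : measurable_seq X -> measurable_seq Y ->
  (\forall n \near \oo, forall w, `|X n w| <= `|Y n w|) -> tight Y -> tight X.
Proof.
move=> mX mY XY Yt del del0; have [M M0 YM] := Yt _ del0; exists M => //.
apply: filterS2 XY YM => n XY.
apply: le_trans; apply: le_prob; try exact: measurable_gt_norm.
by move=> w /=; move/lt_le_trans; apply.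
Qed.

Lemma cvg_prob0D X Y : measurable_seq X -> measurable_seq Y ->
  cvg_prob0 X -> cvg_prob0 Y -> cvg_prob0 (fun n w => X n w + Y n w).
Proof.
move=> mX mY X0 Y0 e del e0 del0.
have [e2 del2] : 0 < e / 2 /\ 0 < del / 2 by split; apply: divr_gt0.
apply: filterS2 (X0 _ _ e2 del2) (Y0 _ _ e2 del2) => n Xn Yn.
rewrite (splitr del); apply: le_prob_setU Xn Yn; try exact: measurable_gt_norm.
  by apply: measurable_gt_norm; exact: measurable_funD.
move=> w /= h; case: (ltP (e / 2) `|X n w|) => Xw; [by left|right].
have := ler_normD (X n w) (Y n w); lra.
Qed.

Lemma tightD X Y : measurable_seq X -> measurable_seq Y ->
  tight X -> tight Y -> tight (fun n w => X n w + Y n w).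
Proof.
move=> mX mY Xt Yt del del0; have del2 : 0 < del / 2 by apply: divr_gt0.
have [M M0 XM] := Xt _ del2; have [N N0 YN] := Yt _ del2.
exists (M + N); first exact: addr_gt0.
apply: filterS2 XM YN => n Xn Yn.
rewrite (splitr del); apply: le_prob_setU Xn Yn; try exact: measurable_gt_norm.
  by apply: measurable_gt_norm; exact: measurable_funD.
move=> w /= h; case: (ltP M `|X n w|) => Xw; [by left|right].
have := ler_normD (X n w) (Y n w); lra.
Qed.

Lemma cvg_prob0_tight X : cvg_prob0 X -> tight X.
Proof. by move=> X0 del del0; exists 1 => //; exact: X0. Qed.

Lemma cvg_prob0M X Y : measurable_seq X -> measurable_seq Y ->
  cvg_prob0 X -> tight Y -> cvg_prob0 (fun n w => X n w * Y n w).
Proof.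
move=> mX mY X0 Yt e del e0 del0; have del2 : 0 < del / 2 by apply: divr_gt0.
have [M M0 YM] := Yt _ del2.
have eM : 0 < e / M by apply: divr_gt0.
apply: filterS2 (X0 _ _ eM del2) YM => n Xn Yn.
rewrite (splitr del); apply: le_prob_setU Xn Yn; try exact: measurable_gt_norm.
  by apply: measurable_gt_norm; exact: measurable_funM.
move=> w /= h; case: (ltP (e / M) `|X n w|) => Xw; [by left|right].
rewrite ltNge; apply/negP => Yw; move: h; apply/negP; rewrite -leNgt normrM.
have -> : e = e / M * M by rewrite divfK// gt_eqF.
exact: ler_pM.
Qed.

Lemma tightM X Y : measurable_seq X -> measurable_seq Y ->
  tight X -> tight Y -> tight (fun n w => X n w * Y n w).
Proof.
move=> mX mY Xt Yt del del0; have del2 : 0 < del / 2 by apply: divr_gt0.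
have [M M0 XM] := Xt _ del2; have [N N0 YN] := Yt _ del2.
exists (M * N); first exact: mulr_gt0.
apply: filterS2 XM YN => n Xn Yn.
rewrite (splitr del); apply: le_prob_setU Xn Yn; try exact: measurable_gt_norm.
  by apply: measurable_gt_norm; exact: measurable_funM.
move=> w /= h; case: (ltP M `|X n w|) => Xw; [by left|right].
rewrite ltNge; apply/negP => Yw; move: h; apply/negP; rewrite -leNgt normrM.
exact: ler_pM.
Qed.

Lemma tight_cst (r : nat -> R) (M : R) : (\forall n \near \oo, `|r n| <= M) ->
  tight (fun n _ => r n).
Proof.
move=> rM del del0; exists (`|M| + 1); first by rewrite ltr_wpDl.
apply: filterS rM => n rn; rewrite (_ : [set w | _] = set0) ?measure0 ?lee_fin ?ltW//.
apply/seteqP; split => // w /=; rewrite ltNge; apply/negP; rewrite negbK.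
by rewrite (le_trans rn)// (le_trans (ler_norm M))// lerDl.
Qed.

Lemma cvg_prob0_cst (r : nat -> R) : r n @[n --> \oo] --> 0 -> cvg_prob0 (fun n _ => r n).
Proof.
move=> r0 e del e0 del0; move/cvgr0Pnorm_le : r0 => /(_ _ e0).
apply: filterS => n rn; rewrite (_ : [set w | _] = set0) ?measure0 ?lee_fin ?ltW//.
by apply/seteqP; split => // w /=; rewrite ltNge rn.
Qed.

Lemma cvg_prob0_sum (I : finType) (X : I -> nat -> T -> R) :
  (forall i, measurable_seq (X i)) -> (forall i, cvg_prob0 (X i)) ->
  cvg_prob0 (fun n w => \sum_(i : I) X i n w).
Proof.
move=> mX X0; rewrite -[X in cvg_prob0 X]/(fun n w => _).
elim: (index_enum I) => [|i s IH].
  under eq_fun do under eq_fun do rewrite big_nil.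
  by apply: cvg_prob0_cst; exact: cvg_cst.
under eq_fun do under eq_fun do rewrite big_cons.
apply: cvg_prob0D => //.
by move=> n; apply: measurable_sum => j; exact: mX.
Qed.

Lemma near_prob_le (A : nat -> set T) (del : R) : (forall n, measurable (A n)) ->
  P (A n) @[n --> \oo] --> 0%E -> 0 < del -> \forall n \near \oo, (P (A n) <= del%:E)%E.
Proof.
move=> mA /fine_cvgP[_ /cvgr0Pnorm_lt A0] del0; have := A0 _ del0; apply: filterS => n /= An.
rewrite -(fineK (fin_num_measure P _ (mA n))) lee_fin ltW//.
exact: le_lt_trans (ler_norm _) An.
Qed.

(** Meant for a term that is identically 0 off a rare event, whatever its size there. *)
Lemma cvg_prob0_event X (A : nat -> set T) : measurable_seq X ->
  (forall n, measurable (A n)) ->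
  (forall del : R, 0 < del -> \forall n \near \oo, (P (A n) <= del%:E)%E) ->
  (\forall n \near \oo, forall w, ~ A n w -> X n w = 0) -> cvg_prob0 X.
Proof.
move=> mX mA A0 XA e del e0 del0.
apply: filterS2 (A0 _ del0) XA => n + XA; apply: le_trans; apply: le_prob => //.
  exact: measurable_gt_norm.
by move=> w /=; apply: contraPP => /XA ->; rewrite normr0; apply/negP; rewrite -leNgt ltW.
Qed.

Lemma markov_sqr (f : T -> R) (e C : R) : 0 < e -> measurable_fun setT f ->
  (\int[P]_w (f w ^+ 2)%:E <= C%:E)%E ->
  (P [set w | (e < `|f w|)%R] <= (C / e ^+ 2)%:E)%E.
Proof.
move=> e0 mf fC; have mA := measurable_gt_norm e mf.
have e20 : 0 < e ^+ 2 by rewrite exprn_gt0.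
rewrite mulrC EFinM lee_pdivlMl//; apply: le_trans fC.
have <- : (\int[P]_(w in [set w | (e < `|f w|)%R]) (e ^+ 2)%:E)%E =
    ((e ^+ 2)%:E * P [set w | (e < `|f w|)%R])%E by rewrite integral_cst.
apply: (@le_trans _ _ (\int[P]_(w in [set w | (e < `|f w|)%R]) (f w ^+ 2)%:E)%E).
  apply: ge0_le_integral => //.
  - by move=> x _; rewrite lee_fin ltW.
  - by apply/measurable_EFinP/measurable_funTS/measurable_funX.
  - move=> w /= ew; rewrite lee_fin -[leRHS]real_normK ?num_real// lerXn2r ?nnegrE//; last exact: ltW.
    exact: ltW.
apply: ge0_subset_integral => //.
  by apply/measurable_EFinP/measurable_funX.
by move=> w _; rewrite lee_fin sqr_ge0.
Qed.

Lemma tight_sqr X (C : R) : measurable_seq X ->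
  (\forall n \near \oo, (\int[P]_w (X n w ^+ 2)%:E <= C%:E)%E) -> tight X.
Proof.
move=> mX XC del del0.
have C1 : 0 < `|C| + 1 by rewrite ltr_wpDl.
(* With this threshold Chebyshev's bound is exactly [del]; the added 1 keeps it positive when C =
   0. *)
have M0 : 0 < Num.sqrt ((`|C| + 1) / del) by rewrite sqrtr_gt0 divr_gt0.
exists (Num.sqrt ((`|C| + 1) / del)) => //.
apply: filterS XC => n XC.
have := @markov_sqr (X n) _ (`|C| + 1) M0 (mX n); rewrite sqr_sqrtr ?(ltW (divr_gt0 _ _))//.
rewrite invf_div mulrCA divff ?gt_eqF// mulr1; apply.
by apply: (le_trans XC); rewrite lee_fin (le_trans (ler_norm C))// lerDl.
Qed.

Lemma cvg_prob0_sqr X (r : nat -> R) : measurable_seq X -> r n @[n --> \oo] --> 0 ->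
  (\forall n \near \oo, (\int[P]_w (X n w ^+ 2)%:E <= (r n)%:E)%E) -> cvg_prob0 X.
Proof.
move=> mX /cvgr0Pnorm_le r0 Xr e del e0 del0.
have ed0 : 0 < del * e ^+ 2 by rewrite mulr_gt0// exprn_gt0.
apply: filterS2 (r0 _ ed0) Xr => n rn Xr.
apply: le_trans (markov_sqr e0 (mX n) Xr) _.
by rewrite lee_fin ler_pdivrMr ?exprn_gt0// (le_trans (ler_norm _)).
Qed.

Lemma cvg_prob0_inv X (c : R) : measurable_seq X -> 0 < c ->
  cvg_prob0 (fun n w => X n w - c) -> cvg_prob0 (fun n w => (X n w)^-1 - c^-1).
Proof.
move=> mX c0 Xc e del e0 del0.
(* The first bound keeps [X n w] above c / 2; the second then gives |1/X - 1/c| = |X - c| / (X c) <=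
   e. *)
pose del' := Num.min (c / 2) (e * c ^+ 2 / 2).
have d0 : 0 < del' by rewrite lt_min !divr_gt0// mulr_gt0// exprn_gt0.
have := Xc _ _ d0 del0; apply: filterS => n; apply: le_trans; apply: le_prob.
- apply: measurable_gt_norm; apply: measurable_funB => //.
  by apply: (measurableT_comp (@measurable_invr R)); exact: mX.
- by apply: measurable_gt_norm; exact: measurable_funB.
move=> w /=; apply: contraTT; rewrite -!leNgt /del' le_min => /andP[h1 h2].
have Xc2 : c / 2 <= X n w by have := ler_norm (- (X n w - c)); rewrite normrN; lra.
have X0 : 0 < X n w by apply: lt_le_trans Xc2; exact: divr_gt0.
have -> : (X n w)^-1 - c^-1 = - (X n w - c) / (X n w * c).
  by field; rewrite !gt_eqF.
rewrite normrM normrN normfV (gtr0_norm (mulr_gt0 X0 c0)) ler_pdivrMr ?mulr_gt0//.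
apply: (le_trans h2); rewrite expr2 -mulrA ler_pM2l// mulrAC ler_pM2r//.
Qed.

End stochastic_order.

(** * Gaussian laws and the Lindeberg theorem *)

Section normal.
Context {R : realType}.
Local Notation leb := (@lebesgue_measure R).
Implicit Types (f G : R -> R) (s t c h x y : R).

Lemma ge0_integral_affine G c h : continuous G -> (forall x, 0 <= G x) -> 0 < h ->
  (\int[leb]_x (G x)%:E = \int[leb]_x (G (c + h * x) * h)%:E)%E.
Proof.
move=> cG G0 h0; pose F x := c + h * x.
have dF x : is_derive x 1 F h.
  have H1 : is_derive x 1 ( *%R h) (h * 1) by exact: is_deriveZ.
  have := is_deriveD (is_derive_cst c x 1) H1.
  by rewrite add0r mulr1.
have F'E : F^`()%classic = cst h by apply/funext => x; rewrite derive1E; apply: derive_val.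
rewrite (@increasing_ge0_integration_by_substitutionT _ F G)//.
- by under eq_integral do rewrite F'E.
- by move=> x y xy; rewrite /F ltrD2l ltr_pM2l.
- by rewrite F'E; move=> x; exact: cvg_cst.
- by rewrite F'E; exact: is_cvg_cst.
- by rewrite F'E; exact: is_cvg_cst.
- apply/cvgrNyPle => A; exists ((A - c) / h); split; first exact: num_real.
  move=> x xA; rewrite /F -lerBrDl mulrC -ler_pdivlMr//; exact: ltW.
- apply/cvgryPge => A; exists ((A - c) / h); split; first exact: num_real.
  move=> x xA; rewrite /F -lerBlDl mulrC -ler_pdivrMr//; exact: ltW.
Qed.

Lemma ge0_integral_normale s (f : R -> \bar R) :
  measurable_fun setT f -> (forall x, (0 <= f x)%E) ->
  (\int[normal_prob 0 s]_x f x = \int[leb]_x (f x * (normal_pdf 0 s x)%:E))%E.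
Proof.
move=> mf f0.
have := @ge0_integral_density _ _ _ leb (normal_pdf 0 s) (measurable_normal_pdf 0 s)
  (normal_pdf_ge0 0 s) (normal_prob 0 s) f _ mf f0.
by apply.
Qed.

Lemma ge0_integral_normal s f : measurable_fun setT f -> (forall x, 0 <= f x) ->
  (\int[normal_prob 0 s]_x (f x)%:E = \int[leb]_x (f x * normal_pdf 0 s x)%:E)%E.
Proof.
move=> mf f0; have mEf : measurable_fun setT (EFin \o f) by exact/measurable_EFinP.
by rewrite (ge0_integral_normale s mEf)// => x; rewrite lee_fin.
Qed.

Lemma normal_pdf0E s x : 0 < s ->
  normal_pdf 0 s x = s^-1 * normal_peak 1 * expR (- (x ^+ 2 / s ^+ 2 / 2)).
Proof.
move=> s0; rewrite normal_pdfE ?gt_eqF// /normal_fun subr0; congr (_ * expR _).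
  rewrite /normal_peak -!mulrnAr sqrtrM ?sqr_ge0// sqrtr_sqr gtr0_norm//.
  by rewrite expr1n mul1r invfM.
by rewrite mulNr -(mulr_natr (s ^+ 2)) invfM mulrA.
Qed.

Lemma normal_pdf_scale s x : 0 < s -> normal_pdf 0 s (s * x) * s = normal_pdf 0 1 x.
Proof.
move=> s0; have s1 : s != 0 by rewrite gt_eqF.
rewrite !normal_pdf0E// invr1 mul1r mulrAC (mulrC s^-1) mulfVK// expr1n divr1.
by rewrite exprMn (mulrAC (s ^+ 2)) divff ?mul1r// expf_neq0.
Qed.

Lemma ge0_integral_normal_scale s f : 0 < s -> continuous f -> (forall x, 0 <= f x) ->
  (\int[normal_prob 0 s]_x (f x)%:E = \int[normal_prob 0 1]_x (f (s * x))%:E)%E.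
Proof.
move=> s0 cf f0.
have mf : measurable_fun setT f by exact: continuous_measurable_fun.
have mfs : measurable_fun setT (fun x => f (s * x)).
  by apply: measurableT_comp => //; exact: measurable_funM.
rewrite (ge0_integral_normal s mf f0) (ge0_integral_normal 1 mfs (fun x => f0 (s * x))).
rewrite (@ge0_integral_affine (fun x => f x * normal_pdf 0 s x) 0 s)//.
- by apply: eq_integral => x _; rewrite add0r -mulrA normal_pdf_scale.
- by move=> x; apply: cvgM; [exact: cf|apply: continuous_normal_pdf; rewrite gt_eqF].
- by move=> x; rewrite mulr_ge0// normal_pdf_ge0.
Qed.

(** Completing the square in [y]. For independent centered Gaussians X and Y of standard deviations
    s and t, the second factor is the conditional density of Y given X + Y = x, so that integrating
    out [y] leaves the first. *)
Lemma normal_pdf_mul s t x y : 0 < s -> 0 < t ->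
  normal_pdf 0 s (x - y) * normal_pdf 0 t y =
  normal_pdf 0 (Num.sqrt (s ^+ 2 + t ^+ 2)) x *
  normal_pdf 0 (s * t / Num.sqrt (s ^+ 2 + t ^+ 2))
    (y - x * t ^+ 2 / (s ^+ 2 + t ^+ 2)).
Proof.
move=> s0 t0; set r := Num.sqrt _; have st0 : 0 < s ^+ 2 + t ^+ 2.
  by rewrite addr_gt0// exprn_gt0.
have r0 : 0 < r by rewrite sqrtr_gt0.
have r2 : r ^+ 2 = s ^+ 2 + t ^+ 2 by rewrite sqr_sqrtr// ltW.
have q0 : 0 < s * t / r by rewrite divr_gt0// mulr_gt0.
have -> : normal_pdf 0 (s * t / r) (y - x * t ^+ 2 / (s ^+ 2 + t ^+ 2)) =
  r / (s * t) * normal_peak 1 *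
    expR (- ((y - x * t ^+ 2 / (s ^+ 2 + t ^+ 2)) ^+ 2 * (s ^+ 2 + t ^+ 2) / (s ^+ 2 * t ^+ 2) / 2)).
  rewrite normal_pdf0E// invf_div; congr (_ * expR (- (_ / 2))).
  by rewrite expr_div_n exprMn r2 invf_div mulrA.
rewrite !normal_pdf0E// r2 -/r.
set k := normal_peak 1; clearbody k.
have E (a b c d : R) : a * expR b * (c * expR d) = (a * c) * expR (b + d).
  by rewrite mulrACA expRD.
rewrite !E; congr (_ * expR _).
  by field; rewrite !gt_eqF.
by field; rewrite !gt_eqF//.
Qed.

End normal.

Section normal_convolution.
Context {R : realType}.
Local Notation leb := (@lebesgue_measure R).
Implicit Types (f : R -> R) (s t x y : R).

Lemma ge0_normal_convolution s t f : 0 < s -> 0 < t ->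
  continuous f -> (forall x, 0 <= f x) ->
  (\int[normal_prob 0 t]_y \int[normal_prob 0 s]_x (f (x + y))%:E =
   \int[normal_prob 0 (Num.sqrt (s ^+ 2 + t ^+ 2))]_x (f x)%:E)%E.
Proof.
move=> s0 t0 cf f0.
have mf : measurable_fun setT f by exact: continuous_measurable_fun.
set r := Num.sqrt _.
have r0 : 0 < r by rewrite sqrtr_gt0 addr_gt0// exprn_gt0.
have q0 : 0 < s * t / r by rewrite divr_gt0// mulr_gt0.
pose g (z : R * R) := (f z.1 * (normal_pdf 0 s (z.1 - z.2) * normal_pdf 0 t z.2))%:E.
have mg : measurable_fun setT g.
  apply/measurable_EFinP; apply: measurable_funM; first exact: measurableT_comp.
  apply: measurable_funM.
    apply: (measurableT_comp (measurable_normal_pdf 0 s)).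
    exact: measurable_funB.
  exact: measurableT_comp (measurable_normal_pdf 0 t) _.
have g0 z : (0 <= g z)%E by rewrite lee_fin !mulr_ge0// normal_pdf_ge0.
transitivity (\int[leb]_y \int[leb]_x g (x, y))%E.
  have shift y : (\int[normal_prob 0 s]_x (f (x + y))%:E =
      \int[leb]_x (f x * normal_pdf 0 s (x - y))%:E)%E.
    have mfy : measurable_fun setT (fun x => f (x + y)).
      by apply: measurableT_comp => //; exact: measurable_funD.
    rewrite (ge0_integral_normal s mfy (fun x => f0 (x + y))).
    rewrite (@ge0_integral_affine _ (fun x => f x * normal_pdf 0 s (x - y)) y 1)//.
    - apply: eq_integral => x _; by rewrite mul1r mulr1 (addrC y) addrK.
    - move=> x; apply: cvgM; first exact: cf.
      apply: (@continuous_comp _ _ _ (fun x => x - y) (normal_pdf 0 s)).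
        by apply: cvgB; [exact: cvg_id|exact: cvg_cst].
      by apply: continuous_normal_pdf; rewrite gt_eqF.
    - by move=> x; rewrite mulr_ge0// normal_pdf_ge0.
  under eq_integral do rewrite shift.
  have mh : measurable_fun setT (fun y => \int[leb]_x (f x * normal_pdf 0 s (x - y))%:E)%E.
    pose hh (z : R * R) := (f z.1 * normal_pdf 0 s (z.1 - z.2))%:E.
    have mhh : measurable_fun setT hh.
      apply/measurable_EFinP; apply: measurable_funM; first exact: measurableT_comp.
      apply: (measurableT_comp (measurable_normal_pdf 0 s)); exact: measurable_funB.
    have hh0 z : (0 <= hh z)%E by rewrite lee_fin mulr_ge0// normal_pdf_ge0.
    have H := @measurable_fun_fubini_tonelli_G _ _ _ _ _ leb hh mhh hh0.
    exact: H.
  rewrite (ge0_integral_normale t mh); last first.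
    by move=> y; apply: integral_ge0 => x _; rewrite lee_fin mulr_ge0// normal_pdf_ge0.
  apply: eq_integral => y _; rewrite -ge0_integralZr//.
  - by apply: eq_integral => x _; rewrite /g/= mulrA.
  - apply/measurable_EFinP; apply: measurable_funM => //.
    apply: (measurableT_comp (measurable_normal_pdf 0 s)); exact: measurable_funB.
  - by move=> x _; rewrite lee_fin mulr_ge0// normal_pdf_ge0.
  - by rewrite lee_fin normal_pdf_ge0.
rewrite -(@fubini_tonelli _ _ _ _ _ leb leb g mg g0) (ge0_integral_normal r mf f0).
apply: eq_integral => x _; rewrite /g/=.
under eq_integral do rewrite normal_pdf_mul// -/r mulrA EFinM.
rewrite ge0_integralZl//.
- rewrite -[RHS]mule1 EFinM; congr (_ * _)%E.
  rewrite -[RHS](@integral_normal_pdf R 0 (s * t / r)).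
  rewrite (@ge0_integral_affine _ (normal_pdf 0 (s * t / r)) (- (x * t ^+ 2 / (s ^+ 2 + t ^+ 2))) 1)//.
  + by apply: eq_integral => y _; rewrite mul1r mulr1 addrC.
  + by apply: continuous_normal_pdf; rewrite gt_eqF.
  + by move=> y; exact: normal_pdf_ge0.
- apply/measurable_EFinP; apply: (measurableT_comp (measurable_normal_pdf 0 _)).
  exact: measurable_funB.
- by move=> y _; rewrite lee_fin normal_pdf_ge0.
- by rewrite lee_fin mulr_ge0// normal_pdf_ge0.
Qed.

Let phi := @normal_pdf R 0 1.

Let is_derive_phi x : is_derive x 1 phi (- (x * phi x)).
Proof.
have phiE : phi = fun x => normal_peak 1 * expR (- (x ^+ 2 / 2)).
  by apply/funext => y; rewrite /phi normal_pdf0E// invr1 mul1r expr1n divr1.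
have d1 : is_derive x 1 (fun x : R => - (x ^+ 2 / 2)) (- x).
  by apply: is_derive_eq; rewrite /GRing.scale/=; field.
have d2 : is_derive x 1 (fun x : R => expR (- (x ^+ 2 / 2))) (- (x * expR (- (x ^+ 2 / 2)))).
  have := @is_derive1_comp _ expR (fun x : R => - (x ^+ 2 / 2)) x _ _ (is_derive_expR _) d1.
  by rewrite mulrN mulrC.
rewrite phiE; by apply: is_derive_eq; rewrite /GRing.scale/=; ring.
Qed.

(** The derivative of x phi(x) is phi(x) - x^2 phi(x). Integrated over [-(n+1), n+1] it leaves a
    boundary term that vanishes in the limit, hence the integral of x^2 phi equals that of phi. *)
Lemma normal_second_moment : (\int[normal_prob 0 1]_x ((x : R) ^+ 2)%:E = 1)%E.
Proof.
have m2 : measurable_fun setT (fun x : R => x ^+ 2) by exact: measurable_funX.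
rewrite (ge0_integral_normal 1 m2 (@sqr_ge0 _)).
pose F x := x * phi x.
pose f x := phi x - x ^+ 2 * phi x.
have cphi : continuous phi by apply: continuous_normal_pdf; exact: oner_neq0.
have cf : continuous f.
  move=> x; apply: cvgB; first exact: cphi.
  by apply: cvgM; [exact: sqr_continuous|exact: cphi].
have dF x : is_derive x 1 F (f x).
  have dp := is_derive_phi x.
  rewrite /F; by apply: is_derive_eq; rewrite /GRing.scale/= /f; ring.
have ftc n : (\int[leb]_(x in `[(- n.+1%:R)%R, n.+1%:R%R]) (f x)%:E =
    (n.+1%:R * phi n.+1%:R *+ 2)%:E)%E.
  rewrite (@continuous_FTC2 _ f F)//.
  - rewrite /F -EFinB; congr EFin; rewrite /phi !normal_pdf0E// sqrrN; ring.
  - by rewrite -subr_gt0 opprK addr_gt0.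
  - exact: continuous_subspaceT.
  - have dc x : {for x, continuous F}.
      by apply: differentiable_continuous; apply/derivable1_diffP; exact: ex_derive.
    split; first by move=> x _; exact: ex_derive.
    + by apply: cvg_at_right_filter; exact: dc.
    + by apply: cvg_at_left_filter; exact: dc.
  - by move=> x _; rewrite derive1E; apply: derive_val.
have tail : (n.+1%:R * phi n.+1%:R *+ 2)%:E @[n --> \oo] --> 0%E.
  apply: cvg_EFin; first exact: nearW.
  pose k := @normal_peak R 1.
  have k0 : 0 <= k by exact: normal_peak_ge0.
  apply: (@squeeze_cvgr _ _ _ _ (cst 0) (fun n => 4 * k * n.+1%:R^-1)); last 2 first.
  - exact: cvg_cst.
  - by rewrite -[X in _ --> X](mulr0 (4 * k)); apply: cvgZl_tmp; exact: cvg_harmonic.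
  apply: nearW => n /=; rewrite mulrn_wge0 ?mulr_ge0 ?normal_pdf_ge0//=.
  set a : R := n.+1%:R; have a0 : 0 < a by rewrite ltr0n.
  rewrite /phi normal_pdf0E// invr1 mul1r expr1n divr1 -/k -mulr_natr.
  (* From exp(x) >= 1 + x; this makes the boundary term O(1/n). *)
  have ea : expR (- (a ^+ 2 / 2)) <= (1 + a ^+ 2 / 2)^-1.
    rewrite expRN lef_pV2 ?posrE ?expR_gt0//; last by rewrite addr_gt0// divr_gt0// exprn_gt0.
    exact: expR_ge1Dx.
  apply: (@le_trans _ _ (a * (k * (1 + a ^+ 2 / 2)^-1) * 2)).
    by rewrite ler_pM2r// ler_pM2l// ler_wpM2l.
  have -> : a * (k * (1 + a ^+ 2 / 2)^-1) * 2 = 4 * k * a^-1 * (a ^+ 2 / (2 + a ^+ 2)).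
    have a2 : 0 < a ^+ 2 by rewrite exprn_gt0.
    by field; rewrite !gt_eqF//; lra.
  rewrite ler_piMr//; first by rewrite !mulr_ge0// invr_ge0 ltW.
  have a2 : 0 < a ^+ 2 by rewrite exprn_gt0.
  by rewrite ler_pdivrMr ?mul1r; lra.
have mphi : measurable_fun setT phi by exact: measurable_normal_pdf.
have m2p : measurable_fun setT (fun x => x ^+ 2 * phi x) by exact: measurable_funM.
have cvg_itv (g : R -> R) : measurable_fun setT g -> (forall x, 0 <= g x) ->
  (\int[leb]_(x in `[(- n.+1%:R)%R, n.+1%:R%R]) (g x)%:E)%E @[n --> \oo] -->
  (\int[leb]_x (g x)%:E)%E.
  move=> mg g0.
  have U : \bigcup_n `[(- n.+1%:R)%R, n.+1%:R%R]%classic = [set: R].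
    apply/seteqP; split => // x _; exists (Num.truncn `|x|) => //=.
    rewrite in_itv/= -ler_norml; apply: ltW.
    by have /andP[] := truncn_itv (normr_ge0 x).
  rewrite -U; apply: ge0_nondecreasing_set_cvg_integral => //.
  - move=> i j ij; rewrite subsetEset; apply: subset_itv; rewrite bnd_simp ?lerN2 ler_nat//.
  - by move=> i; apply/measurable_EFinP; exact: measurable_funTS.
  - by move=> i x _; rewrite lee_fin.
have := cvg_itv _ m2p (fun x => mulr_ge0 (sqr_ge0 x) (normal_pdf_ge0 0 1 x)).
have := cvg_itv _ mphi (fun x => normal_pdf_ge0 0 1 x).
rewrite integral_normal_pdf => c1 c2.
have ad : ((\int[leb]_x (x ^+ 2 * phi x)%:E) +? 0)%E by exact: fin_num_adde_defl.
have c3 := cvgeD ad c2 tail.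
have itg (g : R -> R) (n : nat) : continuous g ->
    leb.-integrable `[(- n.+1%:R)%R, n.+1%:R%R] (EFin \o g).
  move=> cg; apply: continuous_compact_integrable; first exact: segment_compact.
  exact: continuous_subspaceT.
have cx2 : continuous (fun x => x ^+ 2 * phi x).
  by move=> x; apply: cvgM; [exact: sqr_continuous|exact: cphi].
rewrite adde0 in c3.
have AE n : ((\int[leb]_(x in `[(- n.+1%:R)%R, n.+1%:R%R]) (x ^+ 2 * phi x)%:E) +
    (n.+1%:R * phi n.+1%:R *+ 2)%:E = \int[leb]_(x in `[(- n.+1%:R)%R, n.+1%:R%R]) (phi x)%:E)%E.
  rewrite -ftc -integralD_EFin//; [|exact: itg..].
  by apply: eq_integral => x _; rewrite /= -EFinD /f addrC subrK.
rewrite (funext AE) in c3.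
exact: (cvg_unique _ (c3 _) c1).
Qed.

End normal_convolution.

Lemma integral_prob_cst d (T : measurableType d) (R : realType)
  (P : probability T R) (c : R) : (\int[P]_x c%:E = c%:E)%E.
Proof.
rewrite integral_cst// -[RHS]mule1; congr (_ * _)%E; exact: probability_setT.
Qed.

Section bounded_Fubini.
Context d1 d2 (T1 : measurableType d1) (T2 : measurableType d2) (R : realType).
Variables (m1 : probability T1 R) (m2 : probability T2 R).
Variables (f : T1 * T2 -> R) (M : R).
Hypotheses (mf : measurable_fun setT f) (fM : forall z, `|f z| <= M).

Lemma Rintegral_prob_norm_le d (T : measurableType d) (P : probability T R) (g : T -> R) :
  measurable_fun setT g -> (forall x, `|g x| <= M) -> `|\int[P]_x g x| <= M.
Proof.
move=> mg gM; rewrite -[leRHS](Rintegral_prob_cst P); apply: le_Rintegral_norm => //.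
exact: finite_measure_integrable_cst.
Qed.

Let mf1 y : measurable_fun setT (fun x => f (x, y)).
Proof. by apply: (measurableT_comp mf); exact: measurable_fun_pair. Qed.

Let mf2 x : measurable_fun setT (fun y => f (x, y)).
Proof. by apply: (measurableT_comp mf); exact: measurable_fun_pair. Qed.

Let if1 y : m1.-integrable setT (EFin \o (fun x => f (x, y))).
Proof. by apply: (@bounded_integrable _ _ _ m1 setT _ M). Qed.

Let if2 x : m2.-integrable setT (EFin \o (fun y => f (x, y))).
Proof. by apply: (@bounded_integrable _ _ _ m2 setT _ M). Qed.

Let fi : (m1 \x m2)%E.-integrable setT (EFin \o f).
Proof.
apply/integrable21ltyP; first exact/measurable_EFinP.
apply: (@le_lt_trans _ _ (\int[m2]_y M%:E)%E).
  apply: ge0_le_integral => //.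
  - by move=> y _; apply: integral_ge0.
  - have mg : measurable_fun setT (fun z : T1 * T2 => `|(f z)%:E|%E).
      by apply/measurable_EFinP; exact: measurableT_comp.
    exact: (@measurable_fun_fubini_tonelli_G _ _ _ _ _ m1 _ mg (fun=> abse_ge0 _)).
  - move=> y _; rewrite -(integral_prob_cst m1 M); apply: ge0_le_integral => //.
    + by apply/measurable_EFinP; exact: measurableT_comp.
    + by move=> x _; rewrite lee_fin.
by rewrite integral_prob_cst ltry.
Qed.

Lemma measurable_Rintegral_param : measurable_fun setT (fun y => \int[m1]_x f (x, y)).
Proof.
apply: (@measurableT_comp _ _ _ _ _ _ fine); first exact: fine_measurable.
exact: measurable_fubini_G fi.
Qed.

Lemma measurable_Rintegral_param2 : measurable_fun setT (fun x => \int[m2]_y f (x, y)).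
Proof.
apply: (@measurableT_comp _ _ _ _ _ _ fine); first exact: fine_measurable.
exact: measurable_fubini_F fi.
Qed.

Lemma bounded_Fubini :
  \int[m1]_x \int[m2]_y f (x, y) = \int[m2]_y \int[m1]_x f (x, y).
Proof.
have i1 : m1.-integrable setT (EFin \o (fun x => \int[m2]_y f (x, y))).
  apply: (@bounded_integrable _ _ _ m1 setT _ M) => //.
    exact: measurable_Rintegral_param2.
  by move=> x _; exact: Rintegral_prob_norm_le.
have i2 : m2.-integrable setT (EFin \o (fun y => \int[m1]_x f (x, y))).
  apply: (@bounded_integrable _ _ _ m2 setT _ M) => //.
    exact: measurable_Rintegral_param.
  by move=> x _; exact: Rintegral_prob_norm_le.
apply: EFin_inj; rewrite -!EFin_Rintegral//.
under eq_integral do rewrite -EFin_Rintegral//.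
rewrite (Fubini fi); apply: eq_integral => y _.
by rewrite -EFin_Rintegral.
Qed.

End bounded_Fubini.

Section centered_normal.
Context {R : realType}.
Implicit Types (f : R -> R) (v w t x y : R).

Definition bounded_by (M : R) f := forall x, `|f x| <= M.

Lemma centered_normalE v : 0 < v -> centered_normal v = normal_prob 0 (Num.sqrt v).
Proof. by move=> v0; rewrite /centered_normal gt_eqF. Qed.

Lemma Rintegral_dirac f x : measurable_fun setT f ->
  \int[\d_(x : measurableTypeR R)]_y f y = f x.
Proof.
move=> mf; rewrite /Rintegral integral_dirac//; last exact/measurable_EFinP.
by rewrite diracT mul1e.
Qed.

Lemma continuous_shiftr f y : continuous f -> continuous (fun x => f (x + y)).
Proof.
move=> cf x; apply: (@continuous_comp _ _ _ (fun x => x + y) f); last exact: cf.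
by apply: cvgD; [exact: cvg_id|exact: cvg_cst].
Qed.

Lemma continuous_shiftl f y : continuous f -> continuous (fun x => f (y + x)).
Proof. by move=> cf; under eq_fun do rewrite addrC; exact: continuous_shiftr. Qed.

Lemma measurable_Rintegral_shift (mu : probability (measurableTypeR R) R) f (M : R) :
  continuous f -> bounded_by M f ->
  measurable_fun setT (fun y => \int[mu]_x f (x + y)).
Proof.
move=> cf fM; have mf : measurable_fun setT f by exact: continuous_measurable_fun.
have mfD : measurable_fun setT (fun z : R * R => f (z.1 + z.2)).
  by apply: measurableT_comp => //; exact: measurable_funD.
exact: (@measurable_Rintegral_param _ _ _ _ _ mu mu _ M mfD (fun z => fM _)).
Qed.

(** The identity is known for nonnegative integrands; adding the bound [M] makes [f] nonnegative,
    and the constant integrates to [M] on both sides. *)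
Lemma Rintegral_convolution (N1 N2 N3 : probability (measurableTypeR R) R) f (M : R) :
  continuous f -> bounded_by M f ->
  (forall g : R -> R, continuous g -> (forall x, 0 <= g x) ->
    (\int[N2]_y \int[N1]_x (g (x + y))%:E = \int[N3]_x (g x)%:E)%E) ->
  \int[N2]_y \int[N1]_x f (x + y) = \int[N3]_x f x.
Proof.
move=> cf fM N123; pose g x := f x + M.
have mf : measurable_fun setT f by exact: continuous_measurable_fun.
have cg : continuous g by move=> x; apply: cvgD; [exact: cf|exact: cvg_cst].
have g0 x : 0 <= g x by have := fM x; rewrite ler_norml /g => /andP[+ _]; lra.
have shift (mu : probability (measurableTypeR R) R) (h : R -> R) :
    measurable_fun setT h -> bounded_by M h ->
    (\int[mu]_x (h x + M)%:E)%E = (\int[mu]_x h x + M)%:E.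
  move=> mh hM.
  have ih : mu.-integrable setT (EFin \o h).
    exact: (@bounded_integrable _ _ _ mu setT h M).
  have iM : mu.-integrable setT (EFin \o cst M) by exact: finite_measure_integrable_cst.
  rewrite EFin_Rintegral//; last exact: integrable_addr.
  by rewrite RintegralD// Rintegral_prob_cst.
have mfy y : measurable_fun setT (fun x => f (x + y)).
  by apply: measurableT_comp => //; exact: measurable_funD.
have := N123 g cg g0; rewrite (shift _ _ mf fM).
under eq_integral do rewrite (shift _ _ (mfy _) (fun=> fM _)).
rewrite (shift N2).
- by move=> [] /addIr.
- exact: measurable_Rintegral_shift fM.
- by move=> y; apply: (Rintegral_prob_norm_le N1 (mfy y)) => x; exact: fM.
Qed.

Lemma centered_normal_convolution v w f (M : R) : 0 <= v -> 0 <= w ->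
  continuous f -> bounded_by M f ->
  \int[centered_normal w]_y \int[centered_normal v]_x f (x + y) =
  \int[centered_normal (v + w)]_x f x.
Proof.
move=> v0 w0 cf fM.
have mf : measurable_fun setT f by exact: continuous_measurable_fun.
have [->|vn0] := eqVneq v 0.
  rewrite add0r; apply: eq_Rintegral => y _.
  rewrite {1}/centered_normal eqxx Rintegral_dirac ?add0r//.
  by apply: measurableT_comp => //; exact: measurable_funD.
have [->|wn0] := eqVneq w 0.
  rewrite addr0 {1}/centered_normal eqxx Rintegral_dirac ?add0r//; last exact: measurable_Rintegral_shift fM.
  by apply: eq_Rintegral => y _; rewrite addr0.
have {}v0 : 0 < v by rewrite lt_neqAle eq_sym vn0.
have {}w0 : 0 < w by rewrite lt_neqAle eq_sym wn0.
rewrite (centered_normalE v0) (centered_normalE w0) (centered_normalE (addr_gt0 v0 w0)).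
have sv : 0 < Num.sqrt v by rewrite sqrtr_gt0.
have sw : 0 < Num.sqrt w by rewrite sqrtr_gt0.
apply: (Rintegral_convolution cf fM) => g cg g0.
have -> : Num.sqrt (v + w) = Num.sqrt (Num.sqrt v ^+ 2 + Num.sqrt w ^+ 2).
  by rewrite (sqr_sqrtr (ltW v0)) (sqr_sqrtr (ltW w0)).
exact: ge0_normal_convolution sv sw cg g0.
Qed.

(** Since [Num.sqrt 0 = 0], the formula covers the Dirac mass as well, and facts on the standard
    Gaussian transfer to every variance at once. *)
Lemma ge0_integral_centered_normal_scale v f : 0 <= v ->
  continuous f -> (forall x, 0 <= f x) ->
  (\int[centered_normal v]_x (f x)%:E = \int[normal_prob 0 1]_x (f (Num.sqrt v * x))%:E)%E.
Proof.
move=> v0 cf f0; have [->|vn0] := eqVneq v 0.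
  rewrite /centered_normal eqxx sqrtr0 integral_dirac//; last first.
    by apply/measurable_EFinP; exact: continuous_measurable_fun.
  under eq_integral do rewrite mul0r.
  rewrite integral_cst// diracT mul1e.
  by rewrite -[LHS]mule1; congr (_ * _)%E; apply/esym; exact: probability_setT.
have {}v0 : 0 < v by rewrite lt_neqAle eq_sym vn0.
rewrite (centered_normalE v0); apply: ge0_integral_normal_scale cf f0.
by rewrite sqrtr_gt0.
Qed.

Lemma centered_normal_sqr v : 0 <= v ->
  (\int[centered_normal v]_x ((x : R) ^+ 2)%:E = v%:E)%E.
Proof.
move=> v0; rewrite ge0_integral_centered_normal_scale//; last 2 first.
- exact: sqr_continuous.
- by move=> x; exact: sqr_ge0.
under eq_integral do rewrite exprMn sqr_sqrtr// EFinM.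
rewrite ge0_integralZl//.
- by rewrite normal_second_moment mule1.
- by apply/measurable_EFinP; exact: measurable_funX.
- by move=> x _; rewrite lee_fin sqr_ge0.
Qed.

Lemma centered_normal_integrable_sqr v : 0 <= v ->
  (centered_normal v).-integrable setT (EFin \o (fun x : R => x ^+ 2)).
Proof.
move=> v0; apply/integrableP; split.
  by apply/measurable_EFinP; exact: measurable_funX.
under eq_integral do rewrite /= ger0_norm ?sqr_ge0//.
by rewrite centered_normal_sqr// ltry.
Qed.

Lemma ge0_integral_standard_normalN f : continuous f -> (forall x, 0 <= f x) ->
  (\int[normal_prob 0 1]_x (f (- x))%:E = \int[normal_prob 0 1]_x (f x)%:E)%E.
Proof.
move=> cf f0; have mf : measurable_fun setT f by exact: continuous_measurable_fun.
have mN : measurable_fun setT (fun x : R => - x) by exact: measurable_funN.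
have mfN : measurable_fun setT (fun x => f (- x)) by exact: measurableT_comp.
rewrite (ge0_integral_normal 1 mf f0) (ge0_integral_normal 1 mfN (fun x => f0 (- x))).
pose g x := (f x * normal_pdf 0 1 x)%:E.
have mg : measurable_fun setT g.
  by apply/measurable_EFinP; apply: measurable_funM => //; exact: measurable_normal_pdf.
have g0 x : (0 <= g x)%E by rewrite lee_fin mulr_ge0// normal_pdf_ge0.
transitivity (\int[@lebesgue_measure R]_x g (- (x : R))%R)%E.
  by apply: eq_integral => x _; rewrite /g !normal_pdf0E// sqrrN.
have := @ge0_integral_pushforward _ _ _ _ R (-%R : measurableTypeR R -> measurableTypeR R)
  mN (@lebesgue_measure R) setT g measurableT mg (fun x _ => g0 x).
rewrite preimage_setT => <-; apply: eq_measure_integral => A mA _.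
exact: lebesgue_measureN.
Qed.

(** Symmetry is available for nonnegative integrands, so it is applied to (1 + x)^2 and (1 - x)^2:
    with m the mean, their integrals 1 + 2 m + v and 1 - 2 m + v agree, hence m = 0. *)
Lemma centered_normal_mean v : 0 <= v -> \int[centered_normal v]_x (x : R) = 0.
Proof.
move=> v0; have mid : measurable_fun setT (@id R) by exact: measurable_id.
have i2 := centered_normal_integrable_sqr v0.
have i1 : (centered_normal v).-integrable setT (EFin \o (fun x : R => x)).
  exact: integrable_of_sqr i2.
set mm := \int[_]_x _.
have E c : (\int[centered_normal v]_x ((1 + c * x) ^+ 2)%:E =
    (1 + 2 * c * mm + c ^+ 2 * v)%:E)%E.
  have ix : (centered_normal v).-integrable setT (EFin \o (fun x : R => 2 * c * x)).
    exact: integrable_mulrl.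
  have ixx : (centered_normal v).-integrable setT (EFin \o (fun x : R => c ^+ 2 * x ^+ 2)).
    exact: integrable_mulrl.
  have ic : (centered_normal v).-integrable setT (EFin \o cst 1).
    exact: finite_measure_integrable_cst.
  transitivity (\int[centered_normal v]_x (cst 1 x + 2 * c * x + c ^+ 2 * x ^+ 2)%:E)%E.
    by apply: eq_integral => x _; congr EFin; rewrite /=; ring.
  rewrite EFin_Rintegral//; last by do 2 apply: integrable_addr => //.
  rewrite RintegralD//; last exact: integrable_addr.
  rewrite RintegralD// !RintegralZl// Rintegral_prob_cst -/mm; congr (_ + _ + _ * _)%:E.
  by rewrite /Rintegral centered_normal_sqr.
have cc c : continuous (fun x : R => (1 + c * x) ^+ 2).
  move=> x; apply: (@continuous_comp _ _ _ (fun x => 1 + c * x) (fun x => x ^+ 2)).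
    by apply: cvgD; [exact: cvg_cst|exact: mulrl_continuous].
  exact: sqr_continuous.
have := E 1; rewrite ge0_integral_centered_normal_scale//; last by move=> x; exact: sqr_ge0.
rewrite -ge0_integral_standard_normalN; last 2 first.
- have -> : (fun x : R => (1 + 1 * (Num.sqrt v * x)) ^+ 2) = (fun x => (1 + Num.sqrt v * x) ^+ 2).
    by apply/funext => x; rewrite mul1r.
  exact: cc.
- by move=> x; exact: sqr_ge0.
have := E (-1); rewrite ge0_integral_centered_normal_scale//; last by move=> x; exact: sqr_ge0.
under eq_integral do rewrite mulN1r -mulrN.
under [X in _ -> X = _ -> _]eq_integral do rewrite mul1r.
by move=> -> [] ; lra.
Qed.

End centered_normal.

(** * Replacement of the summands by Gaussian ones *)

Section Trotter.
Context {R : realType}.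
Implicit Types (f : R -> R) (v x y : R).

(** The size of a second order Taylor remainder when the second and third derivatives are bounded:
    cubic for small increments, quadratic for large ones, so that second moments suffice to
    integrate it. *)
Definition lindeberg_fun (y : R) : R := y ^+ 2 * Num.min 1 `|y|.

Lemma lindeberg_fun_ge0 y : 0 <= lindeberg_fun y.
Proof. by rewrite mulr_ge0 ?sqr_ge0// le_min ler01/=. Qed.

Lemma lindeberg_fun_le y : lindeberg_fun y <= y ^+ 2.
Proof. by rewrite ler_piMr ?sqr_ge0// ge_min lexx. Qed.

Lemma continuous_lindeberg_fun : continuous lindeberg_fun.
Proof.
move=> x; apply: cvgM; first exact: sqr_continuous.
apply: (@continuous_min R R (cst 1) (fun y => `|y|) x); first exact: cvg_cst.
exact: norm_continuous.
Qed.

Lemma measurable_lindeberg_fun : measurable_fun setT lindeberg_fun.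
Proof. exact: continuous_measurable_fun continuous_lindeberg_fun. Qed.

(** [f1] and [f2] stand for the first two derivatives of a test function. The replacement argument
    uses nothing but these bounds, with one constant for all. *)
Definition second_order_expansion (C : R) f (f1 f2 : R -> R) : Prop :=
  [/\ continuous f, bounded_by C f, bounded_by C f1, bounded_by C f2 &
    forall x y, `|f (x + y) - f x - f1 x * y - f2 x * y ^+ 2 / 2| <= C * lindeberg_fun y].

Lemma expectation_expansion d (U : measurableType d) (Q : probability U R)
    (u : U -> R) C f f1 f2 x :
  second_order_expansion C f f1 f2 -> measurable_fun setT u ->
  Q.-integrable setT (EFin \o (fun z => u z ^+ 2)) -> \int[Q]_z u z = 0 ->
  `|\int[Q]_z f (x + u z) - f x - f2 x / 2 * \int[Q]_z (u z ^+ 2)| <=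
  C * \int[Q]_z lindeberg_fun (u z).
Proof.
move=> [cf fC _ _ fE] mu u2 u0.
have u1 : Q.-integrable setT (EFin \o u) by exact: integrable_of_sqr.
have mf : measurable_fun setT f by exact: continuous_measurable_fun.
have mfu : measurable_fun setT (fun z => f (x + u z)).
  by apply: measurableT_comp => //; exact: measurable_funD.
have ifu : Q.-integrable setT (EFin \o (fun z => f (x + u z))).
  by apply: (@bounded_integrable _ _ _ Q setT _ C).
have ic : Q.-integrable setT (EFin \o cst (f x)) by exact: finite_measure_integrable_cst.
have i1 : Q.-integrable setT (EFin \o (fun z => f1 x * u z)) by exact: integrable_mulrl.
have i2 : Q.-integrable setT (EFin \o (fun z => f2 x / 2 * u z ^+ 2)) by exact: integrable_mulrl.
have ml : measurable_fun setT (fun z => lindeberg_fun (u z)).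
  exact: measurableT_comp measurable_lindeberg_fun mu.
have il : Q.-integrable setT (EFin \o (fun z => lindeberg_fun (u z))).
  apply: le_integrable_norm u2 => // z _.
  by rewrite ger0_norm ?lindeberg_fun_ge0// lindeberg_fun_le.
have := @le_Rintegral_norm _ _ _ Q setT
  (fun z => f (x + u z) - cst (f x) z - f1 x * u z - f2 x / 2 * u z ^+ 2)
  (fun z => C * lindeberg_fun (u z)) measurableT (integrable_mulrl C measurableT il).
rewrite RintegralB//; last by do 2 apply: integrable_subr => //.
rewrite RintegralB//; last exact: integrable_subr.
rewrite RintegralB// !RintegralZl// u0 mulr0 subr0 Rintegral_prob_cst; apply.
  apply: measurable_funB; last by apply: measurable_funM => //; exact: measurable_funX.
  by apply: measurable_funB; [exact: measurable_funB|exact: measurable_funM].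
by move=> z _; rewrite /cst mulrAC; exact: fE.
Qed.

(** After scaling to the standard Gaussian, the integrand is at most v x^2 min(1, sqrt(v/n) |x|),
    which tends to 0 and is dominated by v x^2. *)
Lemma lindeberg_centered_normal v : 0 <= v ->
  n%:R * \int[centered_normal (v / n%:R)]_x lindeberg_fun x @[n --> \oo] --> 0.
Proof.
move=> v0.
have [N [NE N2]] : exists N : probability (measurableTypeR R) R,
    (forall w f, 0 <= w -> continuous f -> (forall x, 0 <= f x) ->
      (\int[centered_normal w]_x (f x)%:E = \int[N]_x (f (Num.sqrt w * x))%:E)%E) /\
    N.-integrable setT (EFin \o (fun x : R => x ^+ 2)).
  exists (centered_normal 1); split; last exact: centered_normal_integrable_sqr ler01.
  move=> w f w0 cf f0; apply: (etrans (ge0_integral_centered_normal_scale w0 cf f0)).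
  have cfw : continuous (fun x => f (Num.sqrt w * x)).
    move=> x; apply: (@continuous_comp _ _ _ ( *%R (Num.sqrt w)) f); last exact: cf.
    exact: mulrl_continuous.
  apply/esym; apply: (etrans (ge0_integral_centered_normal_scale ler01 cfw (fun x => f0 _))).
  have s1 : Num.sqrt 1 = 1 :> R by exact: sqrtr1.
  by apply: eq_integral => x _; rewrite s1 mul1r.
have vx0 x : 0 <= v * x ^+ 2 by rewrite mulr_ge0 ?sqr_ge0.
pose g (n : nat) x := n%:R * lindeberg_fun (Num.sqrt (v / n%:R) * x).
have mls s : measurable_fun setT (fun x => lindeberg_fun (s * x)).
  by apply: (measurableT_comp measurable_lindeberg_fun); exact: measurable_funM.
have gE (n : nat) : n%:R * \int[centered_normal (v / n%:R)]_x lindeberg_fun x = \int[N]_x g n x.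
  rewrite RintegralZl//.
    congr (_ * _); rewrite /Rintegral NE//; last exact: lindeberg_fun_ge0.
      by rewrite divr_ge0.
    exact: continuous_lindeberg_fun.
  have ii : N.-integrable setT (EFin \o (fun x : R => Num.sqrt (v / n%:R) ^+ 2 * x ^+ 2)).
    exact: integrable_mulrl.
  apply: (@le_integrable_norm _ _ _ N setT _ _ measurableT (mls _) _ ii) => x _.
  by rewrite ger0_norm ?lindeberg_fun_ge0// -exprMn lindeberg_fun_le.
under eq_fun do rewrite gE.
rewrite -(Rintegral_prob_cst N 0).
have gB n x : 0 <= g n x <= v * x ^+ 2 * Num.min 1 (Num.sqrt (v / n%:R) * `|x|).
  case: n => [|n].
    rewrite /g mul0r lexx/=; apply: mulr_ge0; first by rewrite mulr_ge0 ?sqr_ge0.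
    by rewrite le_min ler01 mulr_ge0 ?sqrtr_ge0.
  rewrite /g mulr_ge0 ?lindeberg_fun_ge0//= /lindeberg_fun exprMn sqr_sqrtr ?divr_ge0//.
  rewrite normrM (ger0_norm (sqrtr_ge0 _)); set mn := Num.min _ _.
  have -> : n.+1%:R * (v / n.+1%:R * x ^+ 2 * mn) = v * x ^+ 2 * mn by field.
  exact: lexx.
have mg n : measurable_fun setT (g n) by exact: measurable_funM.
have iv : N.-integrable setT (EFin \o (fun x : R => v * x ^+ 2)) by exact: integrable_mulrl.
apply: (@dominated_convergence_Rintegral _ _ _ N setT g (cst 0) (fun x => v * x ^+ 2)) => //.
- apply: aeW => x _.
  have c0 : v * x ^+ 2 * (Num.sqrt (v / n%:R) * `|x|) @[n --> \oo] --> 0.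
    rewrite -[X in _ --> X](mulr0 (v * x ^+ 2)); apply: cvgZl_tmp.
    rewrite -[X in _ --> X](mul0r `|x|); apply: cvgZr_tmp.
    rewrite -[X in _ --> X]sqrtr0.
    apply: (continuous_cvg _ (@sqrt_continuous R 0)).
    rewrite -[X in _ --> X](mulr0 v); apply: cvgZl_tmp.
    by apply/gtr0_cvgV0; [near=> n; rewrite ltr0n; near: n; exact: nbhs_infty_gt|exact: cvgr_idn].
  apply: squeeze_cvgr c0; last exact: cvg_cst.
  apply: nearW => n; have /andP[-> /= h] := gB n x; apply: (le_trans h).
  by apply: ler_wpM2l; [exact: vx0|rewrite ge_min lexx orbT].
- apply: aeW => x n _; have /andP[g0 h] := gB n x; rewrite ger0_norm//; apply: (le_trans h).
  by apply: ler_piMr; [exact: vx0|rewrite ge_min lexx].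
Unshelve. all: by end_near. Qed.

Variables (d : measure_display) (T : measurableType d) (P : probability T R).
Variables (d' : measure_display) (U : measurableType d') (Q : probability U R).
Variable X : nat -> T -> U.
Hypothesis mX : forall i, measurable_fun setT (X i).
Hypothesis iid : forall n (B : 'I_n -> set U), (forall i, measurable (B i)) ->
  P (\bigcap_(i in [set: 'I_n]) (X i @^-1` B i)) = (\prod_(i < n) Q (B i))%E.

Lemma Rintegral_weighted_sum_next (u : U -> R) (c : nat -> R) f C n :
  measurable_fun setT u -> continuous f -> bounded_by C f ->
  \int[P]_w f (weighted_sum X u c n.+1 w) =
  \int[Q]_z \int[P]_w f (weighted_sum X u c n w + c n * u z).
Proof.
move=> mu cf fC.
have mf : measurable_fun setT f by exact: continuous_measurable_fun.
have mS k : measurable_fun setT (weighted_sum X u c k) by exact: measurable_weighted_sum.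
pose g (z : R * U) := f (z.1 + c n * u z.2).
have mg : measurable_fun setT g.
  apply: measurableT_comp => //; apply: measurable_funD => //.
  by apply: measurable_funM => //; exact: measurableT_comp.
have mgz z : measurable_fun setT (fun w => g (weighted_sum X u c n w, z)).
  by apply: (measurableT_comp mg); exact: measurable_fun_pair.
have mgP : measurable_fun setT (fun z => \int[P]_w g (weighted_sum X u c n w, z)).
  have mg2 : measurable_fun setT (fun y : T * U => g (weighted_sum X u c n y.1, y.2)).
    apply: (measurableT_comp mg); apply: measurable_fun_pair => //.
    exact: measurableT_comp.
  exact: (@measurable_Rintegral_param _ _ _ _ _ P Q _ C mg2 (fun=> fC _)).
have h0 z : (0 <= (g z + C)%:E)%E.
  by have := fC (z.1 + c n * u z.2); rewrite lee_fin ler_norml /g => /andP[+ _]; lra.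
have mh : measurable_fun setT (fun z => (g z + C)%:E).
  by apply/measurable_EFinP; exact: measurable_funD.
have := @ge0_integral_weighted_sum_next _ _ _ _ _ _ _ _ mX iid u c mu n _ mh h0.
have shift d0 (V : measurableType d0) (mu0 : probability V R) (h : V -> R) :
    measurable_fun setT h -> (forall z, `|h z| <= C) ->
    (\int[mu0]_z (h z + C)%:E)%E = (\int[mu0]_z h z + C)%:E.
  move=> mh' hM.
  have ih : mu0.-integrable setT (EFin \o h) by exact: (@bounded_integrable _ _ _ mu0 setT h C).
  have iM : mu0.-integrable setT (EFin \o cst C) by exact: finite_measure_integrable_cst.
  rewrite EFin_Rintegral//; last exact: integrable_addr.
  by rewrite RintegralD// Rintegral_prob_cst.
rewrite (_ : (fun w => (g (weighted_sum X u c n w, X n w) + C)%:E) =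
             (fun w => (f (weighted_sum X u c n.+1 w) + C)%:E)); last first.
  by apply/funext => w; rewrite /g/= weighted_sumS.
rewrite shift//; last exact: measurableT_comp.
have sh2 z := shift _ _ P _ (mgz z) (fun w => fC _).
under eq_integral do rewrite sh2.
rewrite (shift _ _ Q _ mgP); last by move=> z; exact: Rintegral_prob_norm_le (mgz z) (fun w => fC _).
by move=> [] /addIr.
Qed.

(** One summand is exchanged per induction step, at cost [delta]. The shift [x] is arbitrary because
    it absorbs the variable held fixed: the last summand while the first n are exchanged by
    induction, the Gaussian of variance n t while the last one is. *)
Lemma sum_vs_normal (u : U -> R) f (C delta t : R) n x :
  measurable_fun setT u -> continuous f -> bounded_by C f -> 0 <= t ->
  (forall x, `|\int[Q]_z f (x + u z) - \int[centered_normal t]_y f (x + y)| <= delta) ->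
  `|\int[P]_w f (x + weighted_sum X u (fun=> 1) n w) -
    \int[centered_normal (n%:R * t)]_y f (x + y)| <= n%:R * delta.
Proof.
move=> mu cf fC t0 fd; elim: n x => [|n IH] x.
  rewrite mul0r mul0r /centered_normal eqxx Rintegral_dirac; last first.
    by apply: continuous_measurable_fun; exact: continuous_shiftl.
  under eq_Rintegral do rewrite /weighted_sum big_ord0.
  by rewrite Rintegral_prob_cst subrr normr0.
have mf : measurable_fun setT f by exact: continuous_measurable_fun.
have mS k : measurable_fun setT (weighted_sum X u (fun=> 1) k) by exact: measurable_weighted_sum.
have nt0 : 0 <= n%:R * t by rewrite mulr_ge0.
set N := centered_normal (n%:R * t) in IH *.
pose A z := \int[P]_w f (z + weighted_sum X u (fun=> 1) n w).
pose H z := \int[N]_y f (z + y).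
have mA : measurable_fun setT A.
  have mg : measurable_fun setT (fun y : R * T => f (y.1 + weighted_sum X u (fun=> 1) n y.2)).
    apply: measurableT_comp => //; apply: measurable_funD => //; exact: measurableT_comp.
  exact: (@measurable_Rintegral_param2 _ _ _ _ _ N P _ C mg (fun=> fC _)).
have mfD : measurable_fun setT (fun y : R * R => f (y.1 + y.2)).
  by apply: measurableT_comp => //; exact: measurable_funD.
have mH : measurable_fun setT H.
  exact: (@measurable_Rintegral_param2 _ _ _ _ _ N N _ C mfD (fun=> fC _)).
have A1 : \int[P]_w f (x + weighted_sum X u (fun=> 1) n.+1 w) = \int[Q]_z A (x + u z).
  have := @Rintegral_weighted_sum_next u (fun=> 1) (fun y => f (x + y)) C n mu (@continuous_shiftl _ f x cf) (fun=> fC _).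
  move=> ->; apply: eq_Rintegral => z _; apply: eq_Rintegral => w _.
  by rewrite mul1r addrA addrAC.
have H1 : \int[centered_normal (n.+1%:R * t)]_y f (x + y) =
          \int[N]_y \int[centered_normal t]_z f (x + y + z).
  rewrite -natr1 mulrDl mul1r addrC.
  apply: etrans (esym (centered_normal_convolution t0 nt0 (@continuous_shiftl _ f x cf) (fun=> fC _))) _.
  apply: eq_Rintegral => y _; apply: eq_Rintegral => z _.
  by rewrite addrA addrAC.
set Nt := centered_normal t in fd H1 *; clearbody Nt N.
(* The two halves of the comparison meet here: n Gaussian terms and one summand, integrated in
   either order. *)
have H2 : \int[Q]_z H (x + u z) = \int[N]_y \int[Q]_z f (x + y + u z).
  have mg : measurable_fun setT (fun p : U * R => f (x + u p.1 + p.2)).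
    apply: (measurableT_comp mf); apply: measurable_funD => //.
    by apply: measurable_funD => //; exact: measurableT_comp.
  rewrite (@bounded_Fubini _ _ _ _ _ Q N _ C mg (fun=> fC _)).
  by apply: eq_Rintegral => y _; apply: eq_Rintegral => z _; rewrite /= addrAC.
have mxu : measurable_fun setT (fun z => x + u z) by exact: measurable_funD.
have AH z : `|A z| <= C /\ `|H z| <= C.
  split; apply: Rintegral_prob_norm_le => //.
    by apply: (measurableT_comp mf); exact: measurable_funD.
  by apply: (measurableT_comp mf); exact: measurable_funD.
have mAu : measurable_fun setT (fun z => A (x + u z)) by exact: measurableT_comp mA mxu.
have mHu : measurable_fun setT (fun z => H (x + u z)) by exact: measurableT_comp mH mxu.
have first : `|\int[Q]_z A (x + u z) - \int[Q]_z H (x + u z)| <= n%:R * delta.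
  rewrite -RintegralB//; last 2 first.
  - by apply: (@bounded_integrable _ _ _ Q setT _ C) => // z _; have [] := AH (x + u z).
  - by apply: (@bounded_integrable _ _ _ Q setT _ C) => // z _; have [] := AH (x + u z).
  apply: Rintegral_prob_norm_le => [|z]; [exact: measurable_funB|exact: IH].
pose B y := \int[Q]_z f (x + y + u z).
pose G y := \int[Nt]_z f (x + y + z).
have mB : measurable_fun setT B.
  have mg : measurable_fun setT (fun p : U * R => f (x + p.2 + u p.1)).
    apply: (measurableT_comp mf); apply: measurable_funD => //.
      exact: measurable_funD.
    exact: measurableT_comp.
  exact: (@measurable_Rintegral_param _ _ _ _ _ Q N _ C mg (fun=> fC _)).
have mG : measurable_fun setT G.
  have mg : measurable_fun setT (fun p : R * R => f (x + p.2 + p.1)).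
    by apply: (measurableT_comp mf); apply: measurable_funD => //; exact: measurable_funD.
  exact: (@measurable_Rintegral_param _ _ _ _ _ Nt N _ C mg (fun=> fC _)).
have second : `|\int[N]_y B y - \int[N]_y G y| <= delta.
  rewrite -RintegralB//; last 2 first.
  - apply: (@bounded_integrable _ _ _ N setT _ C) => // y _; apply: Rintegral_prob_norm_le => //.
    by apply: (measurableT_comp mf); exact: measurable_funD.
  - apply: (@bounded_integrable _ _ _ N setT _ C) => // y _; apply: Rintegral_prob_norm_le => //.
    by apply: (measurableT_comp mf); exact: measurable_funD.
  apply: Rintegral_prob_norm_le => [|y]; [exact: measurable_funB|exact: fd].
rewrite A1 H1 -natr1 mulrDl mul1r.
have -> : \int[Q]_z A (x + u z) - \int[N]_y G y =
  (\int[Q]_z A (x + u z) - \int[Q]_z H (x + u z)) + (\int[N]_y B y - \int[N]_y G y).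
  by rewrite H2 addrA subrK.
exact: (le_trans (ler_normD _ _) (lerD first second)).
Qed.

End Trotter.

Section clt.
Context {R : realType}.
Variables (d : measure_display) (T : measurableType d) (P : probability T R).
Variables (d' : measure_display) (U : measurableType d') (Q : probability U R).
Variable X : nat -> T -> U.
Hypothesis mX : forall i, measurable_fun setT (X i).
Hypothesis iid : forall n (B : 'I_n -> set U), (forall i, measurable (B i)) ->
  P (\bigcap_(i in [set: 'I_n]) (X i @^-1` B i)) = (\prod_(i < n) Q (B i))%E.

Lemma clt_smooth (u : nat -> U -> R) (v : R) C f f1 f2 :
  second_order_expansion C f f1 f2 ->
  (forall n, measurable_fun setT (u n)) ->
  (forall n, Q.-integrable setT (EFin \o (fun z => u n z ^+ 2))) ->
  (forall n, \int[Q]_z u n z = 0) -> 0 <= v ->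
  n%:R * \int[Q]_z (u n z ^+ 2) @[n --> \oo] --> v ->
  n%:R * \int[Q]_z lindeberg_fun (u n z) @[n --> \oo] --> 0 ->
  \int[P]_w f (weighted_sum X (u n) (fun=> 1) n w) @[n --> \oo] -->
    \int[centered_normal v]_y f y.
Proof.
move=> fE mu iu2 u0 v0 uv ul.
have [cf fC _ f2C _] := fE.
have C0 : 0 <= C by apply: le_trans (fC 0).
pose s n := \int[Q]_z (u n z ^+ 2).
pose t (n : nat) := v / n%:R.
have t0 n : 0 <= t n by rewrite divr_ge0.
(* Cost of one exchange: remainder of the summand, mismatch of the variances, remainder of the
   Gaussian. Each Gaussian has variance exactly v / n, so that n of them add up to v, and the
   mismatch is charged here. *)
pose delta n := C * \int[Q]_z lindeberg_fun (u n z) + C * `|s n - t n| +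
  C * \int[centered_normal (t n)]_y lindeberg_fun y.
have lN n x := @expectation_expansion R _ _ (centered_normal (t n)) (fun y : R => y) C f f1 f2 x
  fE (@measurable_id _ _ setT) (centered_normal_integrable_sqr (t0 n)) (centered_normal_mean (t0 n)).
have sN n : \int[centered_normal (t n)]_y ((y : R) ^+ 2) = t n.
  by rewrite /Rintegral (centered_normal_sqr (t0 n)).
have step n x : `|\int[Q]_z f (x + u n z) - \int[centered_normal (t n)]_y f (x + y)| <= delta n.
  have h1 := expectation_expansion x fE (mu n) (iu2 n) (u0 n).
  have h2 := lN n x; rewrite (sN n) in h2.
  have h3 : `|f2 x / 2 * (s n - t n)| <= C * `|s n - t n|.
    rewrite normrM ler_wpM2r// normrM [`|2^-1|]ger0_norm ?invr_ge0//.
    by apply: le_trans (f2C x); rewrite ler_piMr// invf_le1// ler1n.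
  have E (a b : R) : `|a - f x - f2 x / 2 * s n| <= C * \int[Q]_z lindeberg_fun (u n z) ->
      `|b - f x - f2 x / 2 * t n| <= C * \int[centered_normal (t n)]_y lindeberg_fun y ->
      `|a - b| <= delta n.
    move=> ha hb; have -> : a - b = (a - f x - f2 x / 2 * s n) + f2 x / 2 * (s n - t n) -
      (b - f x - f2 x / 2 * t n) by ring.
    apply: (le_trans (ler_normB _ _)); apply: lerD; last exact: hb.
    by apply: (le_trans (ler_normD _ _)); apply: lerD; [exact: ha|exact: h3].
  exact: E h1 h2.
have nd : n%:R * delta n @[n --> \oo] --> 0.
  have -> : (fun n => n%:R * delta n) = (fun n => C * (n%:R * \int[Q]_z lindeberg_fun (u n z)) +
      C * `|n%:R * s n - n%:R * t n| + C * (n%:R * \int[centered_normal (t n)]_y lindeberg_fun y)).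
    apply/funext => n; rewrite -mulrBr normrM ger0_norm// /delta; ring.
  have c1 : C * (n%:R * \int[Q]_z lindeberg_fun (u n z)) @[n --> \oo] --> 0.
    by rewrite -[X in _ --> X](mulr0 C); exact: cvgZl_tmp.
  have c3 : C * (n%:R * \int[centered_normal (t n)]_y lindeberg_fun y) @[n --> \oo] --> 0.
    rewrite -[X in _ --> X](mulr0 C); apply: cvgZl_tmp.
    exact: lindeberg_centered_normal.
  have c2 : C * `|n%:R * s n - n%:R * t n| @[n --> \oo] --> 0.
    rewrite -[X in _ --> X](mulr0 C); apply: cvgZl_tmp.
    rewrite -(@normr0 _ R); apply: cvg_norm.
    rewrite -[X in _ --> X](subrr v); apply: cvgB; first exact: uv.
    apply: cvg_near_cst; near=> n; rewrite /t mulrC divfK//.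
    by rewrite pnatr_eq0 -lt0n; near: n; exact: nbhs_infty_gt.
  have := cvgD (cvgD c1 c2) c3; rewrite !addr0; exact.
have main n : (0 < n)%N ->
    `|\int[P]_w f (weighted_sum X (u n) (fun=> 1) n w) - \int[centered_normal v]_y f y| <=
    n%:R * delta n.
  move=> n0.
  have := @sum_vs_normal _ _ _ P _ _ Q X mX iid (u n) f C (delta n) (t n) n 0 (mu n) cf fC (t0 n) (step n).
  have -> : n%:R * t n = v by rewrite /t mulrC divfK// pnatr_eq0 -lt0n.
  under eq_Rintegral do rewrite add0r.
  by under [X in _ - X]eq_Rintegral do rewrite add0r.
apply/cvgrPdist_le => e e0; move/cvgr0Pnorm_le : nd => /(_ _ e0) nd.
near=> n; rewrite distrC; apply: le_trans (main n _) _.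
  by near: n; exact: nbhs_infty_gt.
apply: le_trans (ler_norm _) _; near: n; exact: nd.
Unshelve. all: by end_near. Qed.

End clt.

(** * Mean value estimates and smoothing of test functions *)

Lemma between0_norm {R : realDomainType} (y z : R) : Num.min 0 y <= z <= Num.max 0 y -> `|z| <= `|y|.
Proof.
by rewrite minEle maxEle; case: (leP 0 y) => y0 /andP[z1 z2];
  [rewrite !ger0_norm//|rewrite !ler0_norm// ?(ltW y0)// lerN2].
Qed.

Lemma is_derive_increment_itv {R : realType} (f df : R -> R) (x y : R) :
  (forall z, Num.min x y <= z <= Num.max x y -> is_derive z 1 f (df z)) ->
  exists2 z, Num.min x y <= z <= Num.max x y & f y - f x = df z * (y - x).
Proof.
have H (u v : R) : u <= v -> (forall z, u <= z <= v -> is_derive z 1 f (df z)) ->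
    exists2 z, u <= z <= v & f v - f u = df z * (v - u).
  move=> uv fd.
  have cf : {within `[u, v], continuous f}.
    apply: derivable_within_continuous => z; rewrite in_itv/= => zuv.
    by have [] := fd z zuv.
  have fd' z : z \in `]u, v[%R -> is_derive z 1 f (df z).
    by rewrite in_itv/= => /andP[uz zv]; apply: fd; rewrite !ltW.
  by have [z] := MVT_segment uv fd' cf; rewrite in_itv/= => zuv ->; exists z.
have [xy|yx] := leP x y; first exact: H.
by move=> /(H _ _ (ltW yx))[z zxy E]; exists z => //; rewrite -[LHS]opprB E -mulrN opprB.
Qed.

Section smoothing.
Context {R : realType}.
Implicit Types (f g : R -> R) (A C x y : R).
Local Notation leb := (@lebesgue_measure R).

Lemma is_derive_increment f df x y : (forall x, is_derive x 1 f (df x)) ->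
  exists2 z, Num.min x y <= z <= Num.max x y & f y - f x = df z * (y - x).
Proof. by move=> fd; apply: is_derive_increment_itv. Qed.

(** The remainder [phi] vanishes at 0 and has derivative [psi], which vanishes at 0 and has
    derivative [f2 (x + z) - f2 x]; the mean value theorem is applied to each. *)
Lemma taylor2_bound f f1 f2 (M : R) : (forall x, is_derive x 1 f (f1 x)) ->
  (forall x, is_derive x 1 f1 (f2 x)) ->
  (forall x y, `|f2 (x + y) - f2 x| <= M * Num.min 1 `|y|) ->
  forall x y, `|f (x + y) - f x - f1 x * y - f2 x * y ^+ 2 / 2| <= M * lindeberg_fun y.
Proof.
move=> df df1 f2M x y.
have M0 : 0 <= M by have := f2M 0 1; rewrite normr1 minxx mulr1; exact: le_trans.
pose psi z := f1 (x + z) - f1 x - f2 x * z.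
pose phi z := f (x + z) - f x - f1 x * z - f2 x * z ^+ 2 / 2.
have shift (g dg : R -> R) (z : R) : (forall x, is_derive x 1 g (dg x)) ->
    is_derive z 1 (fun z => g (x + z)) (dg (x + z)).
  move=> dgg; have d1 : is_derive z 1 (fun z => x + z) 1.
    by have := is_deriveD (is_derive_cst x z 1) (is_derive_id z 1); rewrite add0r.
  have := @is_derive1_comp _ g (fun z => x + z) z _ _ (dgg (x + z)) d1.
  by rewrite mulr1.
have dphi (z : R) : is_derive z 1 phi (psi z).
  have := shift _ _ z df => dz.
  by rewrite /phi /psi; apply: is_derive_eq; rewrite /GRing.scale/=; field.
have dpsi (z : R) : is_derive z 1 psi (f2 (x + z) - f2 x).
  have := shift _ _ z df1 => dz.
  by rewrite /psi; apply: is_derive_eq; rewrite /GRing.scale/=; ring.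
have psiB z : Num.min 0 y <= z <= Num.max 0 y -> `|psi z| <= M * Num.min 1 `|y| * `|y|.
  move=> /between0_norm zy; have [s] := is_derive_increment 0 z dpsi.
  rewrite {2}/psi addr0 mulr0 subr0 subrr !subr0 => sz ->.
  have sz' : `|s| <= `|y|.
    exact: le_trans (between0_norm sz) zy.
  rewrite normrM; apply: ler_pM => //; apply: (le_trans (f2M _ _)).
  by rewrite ler_wpM2l// le_min !ge_min lexx sz' orbT.
have [s sy] := is_derive_increment 0 y dphi.
rewrite {2}/phi addr0 mulr0 expr0n/= mulr0 mul0r !subr0 subrr subr0 -/(phi y) => ->.
rewrite normrM; apply: (@le_trans _ _ (M * Num.min 1 `|y| * `|y| * `|y|)).
  by apply: ler_wpM2r => //; exact: psiB.
by rewrite /lindeberg_fun -mulrA -expr2 real_normK ?num_real// -mulrA (mulrC (Num.min _ _)).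
Qed.

(** Vanishing on a left half-line makes the integral of a bounded continuous function from -oo to x
    finite, and moving averages keep the property up to a shift of [A]. *)
Definition vanishes_left A f := forall x, x < A -> f x = 0.

Lemma antiderivative_exists f A C : continuous f -> bounded_by C f -> vanishes_left A f ->
  exists F, (forall x, is_derive x 1 F (f x)) /\ vanishes_left A F.
Proof.
move=> cf fC fA; have mf : measurable_fun setT f by exact: continuous_measurable_fun.
exists (fun x => \int[leb]_(t in `]-oo, x]) f t); split => x.
  have i1 : leb.-integrable `]-oo, (x + 1)] (EFin \o f).
    have ib : leb.-integrable setT (EFin \o (fun t => C * \1_(`[A, (x + 1)]%classic) t)).
      by apply: integrable_mulrl => //; exact: integrable_indic_itv.
    apply: le_integrable_norm; last exact: integrableS ib.
    - exact: measurable_itv.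
    - exact: measurable_funTS.
    - move=> t; rewrite /= in_itv/= => tx; have [tA|At] := ltP t A.
        rewrite fA// normr0 mulr_ge0//.
        exact: le_trans (fC 0).
      by rewrite indicE mem_set ?mulr1 ?fC//= in_itv/= At.
  have x1 : x < x + 1 by rewrite ltrDl.
  have [|dF FE] := @continuous_FTC1 R f -oo%O x (x + 1) x1 i1 _ (cf x).
    by rewrite ltNyr.
  by apply: DeriveDef; [exact: dF|rewrite -derive1E].
move=> xA; rewrite /Rintegral (eq_integral (cst 0%E)) ?integral0// => t.
by rewrite inE/= in_itv/= => tx; rewrite fA// (le_lt_trans tx).
Qed.

(** The average of [f] over [x, x + delta] is the increment of an antiderivative divided by delta.
    The mean value theorem exhibits it as a value of [f] in that window, so bounds and closeness to
    [f] are inherited without estimating integrals. *)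
Lemma moving_average_exists f A C delta : 0 < delta ->
  continuous f -> bounded_by C f -> vanishes_left A f ->
  exists g, [/\ continuous g, bounded_by C g, vanishes_left (A - delta) g,
    forall x, is_derive x 1 g ((f (x + delta) - f x) / delta) &
    forall x, exists2 z, x <= z <= x + delta & g x = f z].
Proof.
move=> d0 cf fC fA; have [F [dF FA]] := antiderivative_exists cf fC fA.
pose g x := (F (x + delta) - F x) / delta.
have dg x : is_derive x 1 g ((f (x + delta) - f x) / delta).
  have d1 : is_derive x 1 (fun z => z + delta) 1.
    by apply: is_derive_eq; rewrite addr0.
  have := @is_derive1_comp _ F (fun z => z + delta) x _ _ (dF (x + delta)) d1.
  rewrite mulr1 => d2; have d3 := dF x.
  by rewrite /g; apply: is_derive_eq; rewrite /GRing.scale/=; field; rewrite gt_eqF.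
have gz x : exists2 z, x <= z <= x + delta & g x = f z.
  have [z + zE] := is_derive_increment x (x + delta) dF.
  rewrite minEle maxEle lerDl (ltW d0) => zx; exists z => //.
  by rewrite /g zE addrC addKr mulfK// gt_eqF.
exists g; split => //.
- by move=> z; apply: differentiable_continuous; apply/derivable1_diffP; exact: ex_derive.
- by move=> x; have [z _ ->] := gz x.
- move=> x xA; rewrite /g !FA ?subrr ?mul0r//; lra.
Qed.

(* Each moving average gains one derivative; a bounded third derivative is what
   controls the remainder of the second order expansion. *)
Lemma smooth_approximation f A C delta : 0 < delta ->
  continuous f -> bounded_by C f -> vanishes_left A f ->
  exists g g1 g2 C', [/\ second_order_expansion C' g g1 g2, bounded_by C g &
    forall x, exists2 z, x <= z <= x + 3 * delta & g x = f z].
Proof.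
move=> d0 cf fC fA.
have [h1 [ch1 h1C h1A dh1 h1E]] := moving_average_exists d0 cf fC fA.
have [h2 [ch2 h2C h2A dh2 h2E]] := moving_average_exists d0 ch1 h1C h1A.
have [h3 [ch3 h3C h3A dh3 h3E]] := moving_average_exists d0 ch2 h2C h2A.
have C0 : 0 <= C by apply: le_trans (fC 0).
pose D (g : R -> R) x := (g (x + delta) - g x) / delta.
have DB g K : bounded_by K g -> bounded_by (2 * K / delta) (D g).
  move=> gK x; rewrite /D normrM [`|delta^-1|]gtr0_norm ?invr_gt0//.
  rewrite ler_pM2r ?invr_gt0// (le_trans (ler_normB _ _))//.
  by have := gK x; have := gK (x + delta); lra.
have dD g dg x : (forall x, is_derive x 1 g (dg x)) -> is_derive x 1 (D g) (D dg x).
  move=> dgg; have d1 : is_derive x 1 (fun z => z + delta) 1.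
    by apply: is_derive_eq; rewrite addr0.
  have := @is_derive1_comp _ g (fun z => z + delta) x _ _ (dgg (x + delta)) d1.
  rewrite mulr1 => d2; have d3 := dgg x.
  by rewrite /D; apply: is_derive_eq; rewrite /GRing.scale/=; field; rewrite gt_eqF.
(* The derivative of each average is [D] of the preceding one, and [D] commutes with
   differentiation: the successive derivatives of [h3] are [D h2], [D (D h1)] and [D (D (D f))], all
   bounded. *)
pose g1 := D h2; pose g2 := D (D h1); pose g3 := D (D (D f)).
have dg1 x : is_derive x 1 g1 (g2 x) by exact: dD.
have dg2 x : is_derive x 1 g2 (g3 x) by apply: dD => y; exact: dD.
have g1C := DB _ _ h2C; have g2C := DB _ _ (DB _ _ h1C).
have g3C := DB _ _ (DB _ _ (DB _ _ fC)).
set C1 := 2 * C / delta in g1C.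
set C2 := 2 * (2 * C / delta) / delta in g2C.
set C3 := 2 * _ / delta in g3C.
have [p1 p2 p3] : [/\ 0 <= C1, 0 <= C2 & 0 <= C3].
  by split; [apply: le_trans (g1C 0)|apply: le_trans (g2C 0)|apply: le_trans (g3C 0)].
pose C' := C + C1 + 2 * C2 + C3.
exists h3, g1, g2, C'; split => //.
  split => //.
  - by move=> x; apply: (le_trans (h3C x)); rewrite /C'; lra.
  - by move=> x; apply: (le_trans (g1C x)); rewrite /C'; lra.
  - by move=> x; apply: (le_trans (g2C x)); rewrite /C'; lra.
  (* Increments of [g2] are at most 2 C2 in all cases, and at most C3 |y| by the mean value theorem;
     the cases follow the minimum. *)
  apply: (taylor2_bound dh3 dg1) => x y; rewrite minEle; case: (leP 1 `|y|) => y1.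
    rewrite mulr1 (le_trans (ler_normB _ _))//.
    by have := g2C x; have := g2C (x + y); rewrite /C'; lra.
  have [z _ ->] := is_derive_increment x (x + y) dg2.
  rewrite addrC addKr normrM ler_wpM2r// (le_trans (g3C z))// /C'; lra.
move=> x; have [z3 z3x ->] := h3E x; have [z2 z2x ->] := h2E z3; have [z1 z1x ->] := h1E z2.
by exists z1 => //; lra.
Qed.

End smoothing.

(** * From smooth test functions to convergence in law *)

Section convergence_in_law.
Context {R : realType}.
Implicit Types (f g : R -> R) (B : R).

(** A one-sided modulus with window 3 delta, the window in which [smooth_approximation] finds its
    values; only [x] is confined to [-B, B]. *)
Lemma uniformly_continuous_compact f B (e : R) : continuous f -> 0 < e ->
  exists2 delta : R, 0 < delta & forall x y, `|x| <= B -> x <= y <= x + 3 * delta ->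
    `|f y - f x| <= e.
Proof.
move=> cf e0; pose bad (delta x : R) := forall y, x <= y <= x + 3 * delta -> `|f y - f x| <= e.
have := @segment_compact R (- B) B => /compact_near_coveringP/(_ _ (0 : R)^'+ bad _) [x _|].
  have /cvgrPdist_lt/(_ (e / 2)) : f z @[z --> x] --> f x by exact: cf.
  rewrite divr_gt0// => /(_ isT) /nbhs_ballP[r /= r0 fr].
  have r2 : 0 < r / 2 by rewrite divr_gt0.
  have r6 : 0 < r / 6 by rewrite divr_gt0.
  exists (ball x (r / 2), [set delta | 0 < delta < r / 6]).
    split => /=; first exact: nbhsx_ballx.
    near=> delta => /=; apply/andP; split; near: delta; [exact: nbhs_right_gt|exact: nbhs_right_lt].
  move=> [x' delta] /= [xx' /andP[d0 dr]] y /andP[xy yx].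
  move: xx'; rewrite -ball_normE/= => xx'.
  have h1 : `|f x - f x'| < e / 2.
    by apply: fr; rewrite -ball_normE/= (lt_trans xx')// ltr_pdivrMr// mulr_natr; lra.
  have h2 : `|f x - f y| < e / 2.
    apply: fr; rewrite -ball_normE/= (_ : x - y = (x - x') - (y - x')); last by ring.
    rewrite (le_lt_trans (ler_normB _ _))// [`|y - x'|]ger0_norm ?subr_ge0//; lra.
  rewrite (_ : f y - f x' = (f x - f x') - (f x - f y)); last by ring.
  by rewrite (le_trans (ler_normB _ _))//; lra.
move=> i /= i0 H; exists (i / 2); first by rewrite divr_gt0.
move=> x y xB; apply: (H (i / 2)); rewrite /= ?divr_gt0//.
- rewrite sub0r normrN gtr0_norm ?divr_gt0//; lra.
- by rewrite in_itv/= -ler_norml.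
Unshelve. all: by end_near. Qed.

Lemma Rintegral_close d (T : measurableType d) (P : probability T R) (G H : T -> R)
    (A : set T) (M e del : R) :
  measurable_fun setT G -> measurable_fun setT H -> measurable A ->
  (forall w, `|G w| <= M) -> (forall w, `|H w| <= M) ->
  (forall w, ~ A w -> `|G w - H w| <= e) -> 0 <= e -> 0 <= M -> (P A <= del%:E)%E ->
  `|\int[P]_w G w - \int[P]_w H w| <= e + 2 * M * del.
Proof.
move=> mG mH mA GM HM GH e0 M0 Pdel.
have iA : P.-integrable setT (EFin \o (\1_A : T -> R)) by exact: integrable_indic.
have ie : P.-integrable setT (EFin \o cst e) by exact: finite_measure_integrable_cst.
have iMA : P.-integrable setT (EFin \o (fun w => 2 * M * \1_A w)) by exact: integrable_mulrl.
rewrite -RintegralB//; last 2 first.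
- exact: (@bounded_integrable _ _ _ P setT _ M).
- exact: (@bounded_integrable _ _ _ P setT _ M).
apply: (@le_trans _ _ (\int[P]_w (cst e w + 2 * M * \1_A w))).
  apply: le_Rintegral_norm => //; [exact: integrable_addr|exact: measurable_funB|].
  move=> w _; rewrite indicE /cst; have [Aw|Aw] := pselect (A w).
    rewrite mem_set// mulr1 (le_trans (ler_normB _ _))//.
    by have := GM w; have := HM w; lra.
  by rewrite memNset// mulr0 addr0 GH.
rewrite RintegralD// Rintegral_prob_cst lerD2l RintegralZl// ler_wpM2l ?mulr_ge0//.
rewrite /Rintegral integral_indic// setIT -lee_fin fineK//.
exact: fin_num_measure.
Qed.

(** Tightness confines the mass, up to [del], to [-B, B], where [f] is uniformly close to a smooth
    function; outside, both functions are bounded by [M]. *)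
Lemma cvg_in_law_smooth d (T : measurableType d) (P : probability T R) (X : nat -> T -> R)
    (mu : probability (measurableTypeR R) R) :
  measurable_seq X -> tight P X ->
  (forall C f f1 f2, second_order_expansion C f f1 f2 ->
    \int[P]_w f (X n w) @[n --> \oo] --> \int[mu]_x f x) ->
  cvg_in_law P X mu.
Proof.
move=> mX tX smooth f cf [M0 fM0].
pose M := Num.max 1 M0.
have M1 : 1 <= M by rewrite le_max lexx.
have fM : bounded_by M f by move=> x; rewrite (le_trans (fM0 x))// le_max lexx orbT.
apply/cvgrPdist_le => e e0.
pose del := e / (12 * M).
have del0 : 0 < del by rewrite divr_gt0// mulr_gt0//; lra.
have [B1 B10 XB] := tX _ del0.
have [B2 muB2] : exists B2 : R, (mu [set x : R | (B2 < `|x|)%R] <= del%:E)%E.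
  pose F (k : nat) := [set x : measurableTypeR R | k%:R < `|x : R|].
  have mF k : measurable (F k) by exact: (@measurable_gt_norm _ R R id _ (@measurable_id _ R setT)).
  have F0 : \bigcap_k F k = set0.
    apply/seteqP; split => // x /(_ (Num.truncn `|x : R|).+1 I); rewrite /F/=.
    have /andP[_] := truncn_itv (normr_ge0 (x : R)).
    by move=> h1 h2; have := lt_trans h1 h2; rewrite ltxx.
  have := @nonincreasing_cvg_mu _ _ _ mu F.
  rewrite F0 measure0 => /(_ _ mF measurable0 _) H.
  have cF : mu (F k) @[k --> \oo] --> 0%E.
    apply: H.
      by rewrite (le_lt_trans (probability_le1 mu (mF _)))// ltry.
    move=> n m nm; rewrite subsetEset => x; rewrite /F/=; apply: le_lt_trans.
    by rewrite ler_nat.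
  have [N _ HN] := near_prob_le mF cF del0.
  by exists N%:R; exact: (HN N (leqnn N)).
pose B := Num.max B1 B2.
have BB (B' : R) : B' <= B -> [set x : R | B < `|x|] `<=` [set x : R | B' < `|x|].
  by move=> h x /=; exact: le_lt_trans.
have [delta delta0 fu] := @uniformly_continuous_compact f B (e / 6) cf (divr_gt0 e0 (ltr0n _ 6)).
(* The factor is 1 on [-B, +oo[ and 0 left of -B - 1: [f] is cut on the left only, which is what
   antiderivatives from -oo require. *)
pose f0 x := f x * Num.max 0 (Num.min 1 (x + B + 1)).
have cf0 : continuous f0.
  move=> x; apply: cvgM; first exact: cf.
  apply: (@continuous_max R R (cst 0) (fun x => Num.min 1 (x + B + 1)) x); first exact: cvg_cst.
  apply: (@continuous_min R R (cst 1) (fun x => x + B + 1) x); first exact: cvg_cst.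
  apply: cvgD; last exact: cvg_cst.
  by apply: cvgD; [exact: cvg_id|exact: cvg_cst].
have f0E x : - B <= x -> f0 x = f x.
  move=> xB; rewrite /f0 min_l; last by lra.
  by rewrite max_r ?mulr1.
have f0M : bounded_by M f0.
  move=> x; rewrite /f0 normrM -[leRHS]mulr1; apply: ler_pM => //.
  rewrite ger0_norm; last by rewrite le_max lexx.
  by rewrite ge_max ler01/= ge_min lexx.
have f0A : vanishes_left (- B - 1) f0.
  move=> x xB; rewrite /f0 max_l ?mulr0// ge_min; apply/orP; right; lra.
have [g [g1 [g2 [C [gE gM gz]]]]] := smooth_approximation delta0 cf0 f0M f0A.
have [cg _ _ _ _] := gE.
have gf x : `|x| <= B -> `|g x - f x| <= e / 6.
  move=> xB; have [z zx ->] := gz x.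
  have /andP[xB1 _] : - B <= x <= B by rewrite -ler_norml.
  rewrite f0E; last by apply: le_trans xB1 _; case/andP: zx.
  exact: fu.
have e6 : 0 <= e / 6 by rewrite ltW// divr_gt0.
have tail : e / 6 + 2 * M * del = e / 3.
  by rewrite /del; field; lra.
have muB : (mu [set x : R | (B < `|x|)%R] <= del%:E)%E.
  apply: le_trans muB2; apply: le_prob; last by apply: BB; rewrite le_max lexx orbT.
  - exact: (@measurable_gt_norm _ R R id _ (@measurable_id _ R setT)).
  - exact: (@measurable_gt_norm _ R R id _ (@measurable_id _ R setT)).
have hmu : `|\int[mu]_x g x - \int[mu]_x f x| <= e / 3.
  have mf : measurable_fun setT f by exact: continuous_measurable_fun.
  have mg : measurable_fun setT g by exact: continuous_measurable_fun.
  rewrite -tail; apply: (@Rintegral_close _ _ mu g f [set x : R | B < `|x|] M) => //.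
  - exact: (@measurable_gt_norm _ R R id _ (@measurable_id _ R setT)).
  - by move=> x /negP; rewrite -leNgt; exact: gf.
  - by apply: le_trans M1.
have e3 : 0 < e / 3 by rewrite divr_gt0.
have /cvgrPdist_le/(_ _ e3) hg := smooth _ _ _ _ gE.
near=> n.
have hX : `|\int[P]_w g (X n w) - \int[P]_w f (X n w)| <= e / 3.
  have mf : measurable_fun setT f by exact: continuous_measurable_fun.
  have mg : measurable_fun setT g by exact: continuous_measurable_fun.
  rewrite -tail; apply: (@Rintegral_close _ _ P _ _ [set w | B < `|X n w|] M) => //.
  - exact: measurableT_comp.
  - exact: measurableT_comp.
  - exact: measurable_gt_norm.
  - by move=> w /negP; rewrite -leNgt; exact: gf.
  - by apply: le_trans M1.
  apply: (@le_trans _ _ (P [set w | (B1 < `|X n w|)%R])); last by near: n.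
  apply: le_prob; [exact: measurable_gt_norm..|].
  by move=> w /=; apply: BB; rewrite le_max lexx.
have hgn : `|\int[mu]_x g x - \int[P]_w g (X n w)| <= e / 3 by near: n.
set a := \int[mu]_x f x in hmu *; set b := \int[mu]_x g x in hmu hgn.
set b' := \int[P]_w g (X n w) in hX hgn; set a' := \int[P]_w f (X n w) in hX *.
rewrite (_ : a - a' = - (b - a) + (b - b') + (b' - a')); last by ring.
apply: (le_trans (ler_normD _ _)); apply: (@le_trans _ _ (e / 3 + e / 3 + e / 3)); last lra.
apply: lerD => //; apply: (le_trans (ler_normD _ _)); rewrite normrN; exact: lerD.
Unshelve. all: by end_near. Qed.

(** Slutsky's lemma for the smooth test functions: they are Lipschitz and bounded, so [X] and [Y]
    may be exchanged inside them. *)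
Lemma Rintegral_cvg_prob0 d (T : measurableType d) (P : probability T R)
    (X Y : nat -> T -> R) C f f1 f2 (l : R) :
  second_order_expansion C f f1 f2 -> measurable_seq X -> measurable_seq Y ->
  cvg_prob0 P (fun n w => X n w - Y n w) ->
  \int[P]_w f (Y n w) @[n --> \oo] --> l -> \int[P]_w f (X n w) @[n --> \oo] --> l.
Proof.
move=> [cf fC f1C f2C fE] mX mY XY fY.
have C0 : 0 <= C by apply: le_trans (fC 0).
have mf : measurable_fun setT f by exact: continuous_measurable_fun.
(* For increments of size at most 1, each of the three parts of the expansion is at most C |t|; for
   larger ones the difference is at most 2 C. *)
have fl x y : `|f y - f x| <= 3 * C * `|y - x|.
  have h := fE x (y - x); rewrite (addrC x) subrK in h.
  set t := y - x in h *.
  have [t1|t1] := leP `|t| 1.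
    have t2 : t ^+ 2 <= `|t|.
      by rewrite -real_normK ?num_real// expr2 ler_piMr.
    have h1 : `|f1 x * t| <= C * `|t| by rewrite normrM ler_wpM2r.
    have h2 : `|f2 x * t ^+ 2 / 2| <= C * `|t|.
      rewrite normrM [`|2^-1|]ger0_norm ?invr_ge0// normrM [`|t ^+ 2|]ger0_norm ?sqr_ge0//.
      have : `|f2 x| * t ^+ 2 <= C * `|t| by rewrite ler_pM ?sqr_ge0.
      have : 0 <= `|f2 x| * t ^+ 2 by rewrite mulr_ge0 ?sqr_ge0.
      lra.
    have h3 : C * lindeberg_fun t <= C * `|t|.
      by rewrite ler_wpM2l// (le_trans (lindeberg_fun_le t)).
    rewrite (_ : f y - f x = (f y - f x - f1 x * t - f2 x * t ^+ 2 / 2) + f1 x * t + f2 x * t ^+ 2 / 2);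
      last by ring.
    apply: (le_trans (ler_normD _ _)); apply: (@le_trans _ _ (2 * C * `|t| + C * `|t|)); last lra.
    apply: lerD => //; apply: (le_trans (ler_normD _ _)).
    by have := le_trans h h3; lra.
  have := fC x; have := fC y; have := ler_normB (f y) (f x); nra.
apply/cvgrPdist_le => e e0.
(* Both 3 C e' and 2 C del become e / 4 times C / (C + 1); the added 1 covers C = 0. *)
pose e' := e / (12 * (C + 1)); pose del := e / (8 * (C + 1)).
have e'0 : 0 < e' by rewrite divr_gt0// mulr_gt0//; lra.
have del0 : 0 < del by rewrite divr_gt0// mulr_gt0//; lra.
have e2 : 0 < e / 2 by rewrite divr_gt0.
move/cvgrPdist_le : fY => /(_ _ e2) fY.
near=> n.
have XYn : (P [set w | (e' < `|X n w - Y n w|)%R] <= del%:E)%E.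
  by near: n; exact: XY.
have hXY : `|\int[P]_w f (X n w) - \int[P]_w f (Y n w)| <= 3 * C * e' + 2 * C * del.
  apply: (@Rintegral_close _ _ P _ _ [set w | e' < `|X n w - Y n w|] C) => //.
  - exact: measurableT_comp.
  - exact: measurableT_comp.
  - by apply: measurable_gt_norm; exact: measurable_funB.
  - move=> w /negP; rewrite -leNgt => h; apply: (le_trans (fl _ _)).
    by rewrite ler_wpM2l ?mulr_ge0.
  - exact: mulr_ge0 (mulr_ge0 (ler0n _ _) C0) (ltW e'0).
have hY : `|l - \int[P]_w f (Y n w)| <= e / 2 by near: n.
set b := \int[P]_w f (Y n w) in hXY hY; set a := \int[P]_w f (X n w) in hXY *.
rewrite (_ : l - a = (l - b) - (a - b)); last by ring.
apply: (le_trans (ler_normB _ _)).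
have : 3 * C * e' + 2 * C * del <= e / 2.
  have -> : 3 * C * e' + 2 * C * del = (e / 2) * (C / (C + 1)).
    by rewrite /e' /del; field; lra.
  by rewrite ler_piMr ?(ltW e2)// ler_pdivrMr ?mul1r; lra.
by lra.
Unshelve. all: by end_near. Qed.

(** Convergent variances make the sums tight, and the o_p(1) difference passes tightness to [Y]; it
    then suffices to test against smooth functions. *)
Lemma lindeberg_clt d (T : measurableType d) (P : probability T R)
    d' (U : measurableType d') (Q : probability U R) (X : nat -> T -> U)
    (u : nat -> U -> R) (v : R) (Y : nat -> T -> R) :
  (forall i, measurable_fun setT (X i)) ->
  (forall n (B : 'I_n -> set U), (forall i, measurable (B i)) ->
    P (\bigcap_(i in [set: 'I_n]) (X i @^-1` B i)) = (\prod_(i < n) Q (B i))%E) ->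
  (forall n, measurable_fun setT (u n)) ->
  (forall n, Q.-integrable setT (EFin \o (fun z => u n z ^+ 2))) ->
  (forall n, \int[Q]_z u n z = 0) -> 0 <= v ->
  n%:R * \int[Q]_z (u n z ^+ 2) @[n --> \oo] --> v ->
  n%:R * \int[Q]_z lindeberg_fun (u n z) @[n --> \oo] --> 0 ->
  measurable_seq Y ->
  cvg_prob0 P (fun n w => Y n w - weighted_sum X (u n) (fun=> 1) n w) ->
  cvg_in_law P Y (centered_normal v).
Proof.
move=> mX iid mu iu2 u0 v0 uv ul mY YS.
pose S n := weighted_sum X (u n) (fun=> 1) n.
have mS : measurable_seq S by move=> n; exact: measurable_weighted_sum.
have tS : tight P S.
  apply: (@tight_sqr _ _ _ P S (v + 1) mS).
  have : \forall n \near \oo, n%:R * \int[Q]_z (u n z ^+ 2) <= v + 1.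
    by apply: (cvgr_le v uv); rewrite ltrDl.
  apply: filterS => n h.
  have [i2 le2] := @weighted_sum_sqr _ _ _ P _ _ Q X mX iid (u n) (fun=> 1) (mu n)
    (fun=> ltac:(by rewrite normr1)) (iu2 n) (u0 n) n.
  by rewrite EFin_Rintegral// lee_fin (le_trans le2).
have tY : tight P Y.
  have -> : Y = (fun n w => (Y n w - S n w) + S n w).
    by apply/funext => n; apply/funext => w; rewrite subrK.
  apply: tightD => //; first by move=> n; exact: measurable_funB.
  exact: cvg_prob0_tight.
apply: cvg_in_law_smooth => // C f f1 f2 fE.
apply: (Rintegral_cvg_prob0 fE mY mS YS).
exact: clt_smooth mX iid _ _ _ _ _ _ fE mu iu2 u0 v0 uv ul.
Qed.

End convergence_in_law.

(** * Kernel smoothing of a conditional density *)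

Section conditional_density.
Context d0 d1 d2 (W : measurableType d0) (T1 : measurableType d1) (T2 : measurableType d2).
Context (R : realType) (Q : probability W R) (lam : {sigma_finite_measure set T1 -> \bar R}).
Variables (X : W -> T1) (Z : W -> T2) (D : set W) (q : T1 -> T2 -> R).
Hypothesis mX : measurable_fun setT X.
Hypothesis mZ : measurable_fun setT Z.
Hypothesis mD : measurable D.
Hypothesis mq : measurable_fun setT (fun xz : T1 * T2 => q xz.1 xz.2).
Hypothesis q0 : forall x z, 0 <= q x z.
Hypothesis hq : forall B C, measurable B -> measurable C ->
  Q [set o | [/\ B (X o), C (Z o) & D o]] =
  (\int[Q]_(o in [set o | C (Z o) /\ D o]) \int[lam]_(x in B) (q x (Z o))%:E)%E.

Let g (xo : T1 * W) : R := q xo.1 (Z xo.2) * \1_D xo.2.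

Let XZ o := (X o, Z o).
Let xZ (xo : T1 * W) := (xo.1, Z xo.2).

Let mXZ : measurable_fun setT XZ.
Proof. exact: measurable_fun_pair mX mZ. Qed.

Let mxZ : measurable_fun setT xZ.
Proof.
exact: measurable_fun_pair measurable_fst (measurableT_comp mZ measurable_snd).
Qed.

Let mI : measurable_fun setT (\1_D : W -> R).
Proof. exact: measurable_indic mD. Qed.

Let mg : measurable_fun setT g.
Proof.
apply: measurable_funM; first exact: measurableT_comp mq mxZ.
exact: measurableT_comp mI measurable_snd.
Qed.

Let g0 xo : 0 <= g xo.
Proof. by rewrite mulr_ge0. Qed.

Let mqz (z : T2) : measurable_fun setT (q ^~ z).
Proof.
have h : measurable_fun setT (fun x : T1 => (x, z)).
  by apply: measurable_fun_pair.
exact: (measurableT_comp mq h).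
Qed.

Let QD : {measure set W -> \bar R} := mrestr Q mD.

Let integral_QD (f : W -> \bar R) : measurable_fun setT f -> (forall o, (0 <= f o)%E) ->
  (\int[QD]_o f o = \int[Q]_(o in D) f o)%E.
Proof.
move=> mf f0; rewrite [RHS]integral_mkcond.
have e : (forall A, measurable A -> QD A = \int[Q]_(x in A) (\1_D x)%:E)%E.
  by move=> A mA; rewrite integral_indic// /QD/= /mrestr setIC.
rewrite (@ge0_integral_density _ _ _ Q (\1_D) mI (fun=> ler0n _ _) QD f e mf f0).
by apply: eq_integral => o _; rewrite patchE indicE; case: ifP => _; rewrite ?mule1 ?mule0.
Qed.

Let ge0_fubini_density (f : T1 * T2 -> \bar R) :
  measurable_fun setT f -> (forall z, (0 <= f z)%E) ->
  (\int[(lam \x Q)%E]_xo (f (xZ xo) * (g xo)%:E) =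
   \int[Q]_(o in D) \int[lam]_x (f (x, Z o) * (q x (Z o))%:E))%E.
Proof.
move=> mf f0; rewrite fubini_tonelli2; last 2 first.
- by apply: emeasurable_funM; [exact: measurableT_comp mf mxZ|exact/measurable_EFinP].
- by move=> xo; rewrite mule_ge0// lee_fin.
rewrite [RHS]integral_mkcond; apply: eq_integral => o _.
rewrite /fubini_G patchE /g/= indicE; case: ifP => oD.
  by apply: eq_integral => x _; rewrite mulr1.
by apply: integral0_eq => x _; rewrite mulr0 mule0.
Qed.

Let nu : {measure set (T1 * W) -> \bar R} := mdensity (lam \x Q)%E mg g0.

(** The hypothesis [hq] speaks of rectangles. On them it identifies the law of (X, Z) on [D] with
    the image, under (x, o) -> (x, Z o), of [lam \x Q] weighted by q(x, Z o) on D; rectangles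
    determine both measures. *)
Let same_law E : measurable E -> pushforward QD XZ E = pushforward nu xZ E.
Proof.
apply: measure_prod_unique => [|B C mB mC].
  apply: (@le_lt_trans _ _ (Q setT)).
    by apply: le_measure; rewrite ?inE//; exact: measurableI measurableT mD.
  by rewrite (_ : Q setT = 1%E) ?ltry//; exact: probability_setT.
transitivity (Q [set o | [/\ B (X o), C (Z o) & D o]]).
  by congr (Q _); apply/seteqP; split=> o /= => [[[]]|[]].
rewrite hq//.
pose f (xz : T1 * T2) : \bar R := (\1_(B `*` C) xz)%:E.
have mf : measurable_fun setT f by apply/measurable_EFinP; exact: measurable_indic (measurableX mB mC).
have f0 xz : (0 <= f xz)%E by rewrite lee_fin.
transitivity (\int[(lam \x Q)%E]_xo (f (xZ xo) * (g xo)%:E))%E; last first.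
  rewrite /pushforward/= /mdensity [RHS]integral_mkcond.
  apply: eq_integral => xo _; rewrite patchE /f indicE/=.
  rewrite (_ : (xo \in xZ @^-1` (B `*` C)) = (xZ xo \in B `*` C)).
    by case: ifP => _; rewrite ?mul1e ?mul0e.
  by apply/idP/idP; rewrite !inE.
rewrite (ge0_fubini_density mf f0) integral_mkcond [RHS]integral_mkcond.
apply: eq_integral => o _.
rewrite !patchE; have [/= oC|oC] := pselect (C (Z o)); last first.
  rewrite memNset; last by case.
  case: ifP => // _; apply/esym/integral0_eq => x _.
  by rewrite /f indicE memNset ?mul0e//; case.
have [ol|ol] := pselect (D o); last by rewrite !memNset//; case.
rewrite !mem_set// integral_mkcond; apply: eq_integral => x _.
rewrite patchE /f indicE.
have [xB|xB] := pselect (B x); first by rewrite !mem_set// mul1e.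
by rewrite !memNset ?mul0e//; case.
Qed.

Lemma ge0_disintegration (f : T1 * T2 -> \bar R) :
  measurable_fun setT f -> (forall z, (0 <= f z)%E) ->
  (\int[Q]_(o in D) f (X o, Z o) =
   \int[Q]_(o in D) \int[lam]_x (f (x, Z o) * (q x (Z o))%:E))%E.
Proof.
move=> mf f0; rewrite -ge0_fubini_density//.
have mfX : measurable_fun setT (fun o => f (XZ o)) by exact: measurableT_comp mf mXZ.
have mfx : measurable_fun setT (fun xo => f (xZ xo)) by exact: measurableT_comp mf mxZ.
rewrite -(integral_QD mfX)//.
transitivity (\int[pushforward QD XZ]_z f z)%E.
  by rewrite (ge0_integral_pushforward mXZ).
transitivity (\int[pushforward nu xZ]_z f z)%E.
  by apply: eq_measure_integral => A mA _; exact: same_law.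
rewrite (ge0_integral_pushforward mxZ)// preimage_setT.
exact: (@ge0_integral_density _ _ _ (lam \x Q)%E g mg g0 nu (f \o xZ) (fun A mA => erefl) mfx (fun z => f0 _)).
Qed.

Hypothesis q1 : forall o, D o -> (\int[lam]_x (q x (Z o))%:E = 1)%E.
Variables (F : T1 -> R) (M : R).
Hypothesis mF : measurable_fun setT F.
Hypothesis F0 : forall x, 0 <= F x.
Hypothesis FM : forall x, F x <= M.

Let M0 (o : W) : 0 <= M.
Proof. exact: le_trans (F0 (X o)) (FM _). Qed.

Lemma le_cond_expectation o : D o -> (\int[lam]_x (F x * q x (Z o))%:E <= M%:E)%E.
Proof.
move=> oD.
rewrite -[leRHS]mule1 -(q1 oD) -ge0_integralZl_EFin//; last first.
- exact: M0 o.
- exact/measurable_EFinP/mqz.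
- by move=> x _; rewrite lee_fin.
apply: ge0_le_integral => //.
- by move=> x _; rewrite lee_fin mulr_ge0.
- by apply/measurable_EFinP/measurable_funM; [exact: mF|exact: mqz].
- by apply/measurable_EFinP/measurable_funM; [exact: measurable_cst|exact: mqz].
- by move=> x _; rewrite lee_fin ler_wpM2r.
Qed.

Lemma EFin_cond_expectation o : D o ->
  (\int[lam]_x (F x * q x (Z o))%:E)%E = (\int[lam]_x (F x * q x (Z o)))%:E.
Proof.
move=> oD; rewrite /Rintegral fineK// ge0_fin_numE.
  exact: le_lt_trans (le_cond_expectation oD) (ltry _).
by apply: integral_ge0 => x _; rewrite lee_fin mulr_ge0.
Qed.

Lemma measurable_cond_expectation :
  measurable_fun setT (fun o => \int[lam]_x (F x * q x (Z o))).
Proof.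
have mfq : measurable_fun setT (fun z : T2 => \int[lam]_x (F x * q x z)%:E)%E.
  apply: (@measurable_fun_fubini_tonelli_G _ _ T1 T2 R lam (fun xz => (F xz.1 * q xz.1 xz.2)%:E)%E).
    apply/measurable_EFinP/measurable_funM => //.
    exact: measurableT_comp mF measurable_fst.
  by move=> xz; rewrite lee_fin mulr_ge0.
apply: (@measurableT_comp _ _ _ _ _ _ fine); first exact: fine_measurable.
exact: (measurableT_comp mfq mZ).
Qed.

Lemma cond_expectation_ge0 o : 0 <= \int[lam]_x (F x * q x (Z o)).
Proof. by apply: Rintegral_ge0 => x _; rewrite mulr_ge0. Qed.

Lemma cond_expectation_le o : D o -> \int[lam]_x (F x * q x (Z o)) <= M.
Proof. by move=> oD; rewrite -lee_fin -EFin_cond_expectation//; exact: le_cond_expectation. Qed.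

Let disintegration_ge0 (G : T2 -> R) : measurable_fun setT G -> (forall z, 0 <= G z) ->
  \int[Q]_(o in D) (F (X o) * G (Z o)) =
  \int[Q]_(o in D) ((\int[lam]_x (F x * q x (Z o))) * G (Z o)).
Proof.
move=> mG G0; rewrite /Rintegral; congr fine.
pose f (xz : T1 * T2) := (F xz.1 * G xz.2)%:E.
have mf : measurable_fun setT f.
  apply/measurable_EFinP; apply: measurable_funM.
    exact: measurableT_comp mF measurable_fst.
  exact: measurableT_comp mG measurable_snd.
have f0 xz : (0 <= f xz)%E by rewrite lee_fin mulr_ge0.
rewrite (ge0_disintegration mf f0); apply: eq_integral => o /set_mem oD.
rewrite EFinM -EFin_cond_expectation// muleC -ge0_integralZl_EFin//.
- by apply: eq_integral => x _; rewrite /f/= -!EFinM; congr EFin; ring.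
- by move=> x _; rewrite lee_fin mulr_ge0.
- by apply/measurable_EFinP/measurable_funM; [exact: mF|exact: mqz].
Qed.

(** As [F] and its conditional mean are bounded, both sides split along the positive and negative
    parts of [G], to which the nonnegative case applies. *)
Lemma disintegration (G : T2 -> R) : measurable_fun setT G ->
  Q.-integrable D (EFin \o (fun o => G (Z o))) ->
  \int[Q]_(o in D) (F (X o) * G (Z o)) =
  \int[Q]_(o in D) ((\int[lam]_x (F x * q x (Z o))) * G (Z o)).
Proof.
move=> mG iG.
pose Gp z := Num.max (G z) 0; pose Gn z := Num.max (- G z) 0.
have mGp : measurable_fun setT Gp by exact: measurable_maxr mG (measurable_cst _).
have mGn : measurable_fun setT Gn by apply: measurable_maxr => //; exact: measurableT_comp.
have GE z : G z = Gp z - Gn z.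
  by rewrite /Gp /Gn; case: (leP (G z) 0); case: (leP (- G z) 0) => ? ?; lra.
have iGp : Q.-integrable D (EFin \o (fun o => Gp (Z o))).
  apply: (le_integrable_norm (g := fun o => `|G (Z o)|)) => //.
  - exact/measurable_funTS/(measurableT_comp mGp).
  - by move=> o _; rewrite /Gp maxEle; case: ifP => _; rewrite ?normr0 ?normr_ge0 ?lexx.
  - exact: integrable_norm iG.
have iGn : Q.-integrable D (EFin \o (fun o => Gn (Z o))).
  apply: (le_integrable_norm (g := fun o => `|G (Z o)|)) => //.
  - exact/measurable_funTS/(measurableT_comp mGn).
  - by move=> o _; rewrite /Gn maxEle; case: ifP => _; rewrite ?normr0 ?normrN ?normr_ge0 ?lexx.
  - exact: integrable_norm iG.
have mFX : measurable_fun D (fun o => F (X o)) by exact/measurable_funTS/(measurableT_comp mF).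
have mEF : measurable_fun D (fun o => \int[lam]_x (F x * q x (Z o))).
  exact/measurable_funTS/measurable_cond_expectation.
have FM' o : D o -> `|F (X o)| <= M by rewrite ger0_norm.
have EM o : D o -> `|\int[lam]_x (F x * q x (Z o))| <= M.
  by move=> oD; rewrite ger0_norm ?cond_expectation_ge0 ?cond_expectation_le.
under eq_Rintegral do rewrite GE mulrBr.
under [RHS]eq_Rintegral do rewrite GE mulrBr.
rewrite RintegralB//; last 2 first.
- exact: (integrableM_bounded mD mFX FM' iGp).
- exact: (integrableM_bounded mD mFX FM' iGn).
rewrite RintegralB//; last 2 first.
- exact: (integrableM_bounded mD mEF EM iGp).
- exact: (integrableM_bounded mD mEF EM iGn).
by rewrite !disintegration_ge0// => z; rewrite le_max lexx orbT.
Qed.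

End conditional_density.

(** * Kernel moments and local Taylor bounds *)

Section kernel.
Context {R : realType}.
Local Notation leb := (@lebesgue_measure R).
Implicit Types (f G F : R -> R) (c h x t : R).

Lemma Rintegral_affine G c h : continuous G -> 0 < h -> leb.-integrable setT (EFin \o G) ->
  leb.-integrable setT (EFin \o (fun x => G (c + h * x) * h)) /\
  \int[leb]_x (G (c + h * x) * h) = \int[leb]_x G x.
Proof.
move=> cG h0 iG.
have mG : measurable_fun setT G by exact: continuous_measurable_fun.
have mGa : measurable_fun setT (fun x => G (c + h * x) * h).
  apply: measurable_funM => //; apply: (measurableT_comp mG).
  by apply: measurable_funD => //; exact: measurable_funM.
have cM (g : R -> R) : continuous g -> continuous (fun x => Num.max (g x) 0).
  by move=> cg x; apply: continuous_max; [exact: cg|exact: cvg_cst].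
have cN : continuous (fun x => - G x) by move=> x; apply: cvgN; exact: cG.
have ia : leb.-integrable setT (EFin \o (fun x => G (c + h * x) * h)).
  apply/integrableP; split; first exact/measurable_EFinP.
  under eq_integral => x _ do rewrite /= normrM (gtr0_norm h0).
  rewrite -(@ge0_integral_affine _ (fun x => `|G x|) c h) //.
    by case/integrableP: iG.
  by move=> x; apply: cvg_norm; exact: cG.
split => //; rewrite /Rintegral; congr fine.
rewrite integralE [RHS]integralE; congr (_ - _)%E.
  transitivity (\int[leb]_x (Num.max (G (c + h * x)) 0 * h)%:E)%E.
    by apply: eq_integral => x _; rewrite funeposE/= -EFin_max maxr_pMl ?mul0r// ltW.
  rewrite -(@ge0_integral_affine _ (fun x => Num.max (G x) 0))//; last 2 first.
  - exact: cM.
  - by move=> x; rewrite le_max lexx orbT.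
  by apply: eq_integral => x _; rewrite funeposE/= -EFin_max.
transitivity (\int[leb]_x (Num.max (- G (c + h * x)) 0 * h)%:E)%E.
  by apply: eq_integral => x _; rewrite funenegE/= -EFin_max -mulNr maxr_pMl ?mul0r// ltW.
rewrite -(@ge0_integral_affine _ (fun x => Num.max (- G x) 0))//; last 2 first.
- exact: cM.
- by move=> x; rewrite le_max lexx orbT.
by apply: eq_integral => x _; rewrite funenegE/= -EFin_max.
Qed.

Variables (K : R -> R) (hK : is_smoothing_kernel K).

Let cK : continuous K. Proof. by case: hK => -[]. Qed.

Let K_ge0 x : 0 <= K x. Proof. by case: hK => -[]. Qed.

Lemma measurable_kernel : measurable_fun setT K.
Proof. exact: continuous_measurable_fun. Qed.

Lemma kernel0 x : 1 < `|x| -> K x = 0.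
Proof.
case: hK => -[_ _ _ suppK] _ x1; apply: contrapT => /eqP Kx.
have : closure [set s | K s != 0] x by apply: subset_closure.
rewrite suppK /= in_itv/= -ler_norml; lra.
Qed.

Lemma kernel_bounded : exists2 M, 0 < M & forall x, K x <= M.
Proof.
have [] := @EVT_max R K (-1) 1 _ (continuous_subspaceT cK); first by lra.
move=> c _ cM; exists (K c + 1); first exact: ltr_wpDl (K_ge0 c) ltr01.
move=> x; have [x1|x1] := leP `|x| 1; last by rewrite kernel0// addr_ge0.
by apply: (le_trans (cM x _)); [rewrite in_itv/= -ler_norml|rewrite lerDl].
Qed.

Lemma integrable_kernel_mul phi : continuous phi ->
  leb.-integrable setT (EFin \o (fun x => K x * phi x)).
Proof.
move=> cphi.
have cKp : continuous (fun x => K x * phi x).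
  by move=> x; apply: cvgM; [exact: cK|exact: cphi].
have := @continuous_compact_integrable R (fun x => K x * phi x) `[-1, 1]
  (@segment_compact _ _ _) (continuous_subspaceT cKp).
rewrite integrable_mkcond//; apply: eq_integrable => // x _.
rewrite patchE; case: ifPn => // /negP xI; rewrite /= kernel0 ?mul0r//.
rewrite ltNge; apply/negP => x1; apply: xI.
by rewrite inE/= in_itv/= -ler_norml.
Qed.

Variables (a h : R).
Hypothesis h0 : 0 < h.
Local Notation Kh := (scaled_kernel K h).

Lemma scaled_kernel_ge0 x : 0 <= Kh x.
Proof. by rewrite /scaled_kernel divr_ge0// ltW. Qed.

Lemma scaled_kernel0 x : h < `|x| -> Kh x = 0.
Proof.
move=> hx; rewrite /scaled_kernel kernel0 ?mul0r// normrM normfV (gtr0_norm h0).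
by rewrite ltr_pdivlMr ?mul1r.
Qed.

Lemma measurable_scaled_kernel : measurable_fun setT (fun x => Kh (x - a)).
Proof.
apply: measurable_funM => //; apply: (measurableT_comp measurable_kernel).
by apply: measurable_funM => //; exact: measurable_funB.
Qed.

Lemma kernel_substitution phi : continuous phi ->
  leb.-integrable setT (EFin \o (fun x => Kh (x - a) * phi ((x - a) / h))) /\
  \int[leb]_x (Kh (x - a) * phi ((x - a) / h)) = \int[leb]_x (K x * phi x).
Proof.
move=> cphi.
have cKp : continuous (fun x => K x * phi x).
  by move=> x; apply: cvgM; [exact: cK|exact: cphi].
have h0' : 0 < h^-1 by rewrite invr_gt0.
have e : (fun x => Kh (x - a) * phi ((x - a) / h)) =
    (fun x => (fun y => K y * phi y) (- (a / h) + h^-1 * x) * h^-1).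
  apply/funext => x /=; rewrite (_ : - (a / h) + h^-1 * x = (x - a) / h); last by ring.
  by rewrite /scaled_kernel mulrAC.
have := Rintegral_affine (- (a / h)) cKp h0' (integrable_kernel_mul cphi).
by rewrite e.
Qed.

Lemma scaled_kernel_moment (k : nat) :
  leb.-integrable setT (EFin \o (fun x => Kh (x - a) * (x - a) ^+ k)) /\
  \int[leb]_x (Kh (x - a) * (x - a) ^+ k) = h ^+ k * \int[leb]_x (K x * x ^+ k).
Proof.
have ck : continuous (fun x => x ^+ k : R) by exact: exprn_continuous.
have [ik Ik] := kernel_substitution ck.
have e : (fun x => Kh (x - a) * (x - a) ^+ k) =
    (fun x => h ^+ k * (Kh (x - a) * ((x - a) / h) ^+ k)).
  apply/funext => x; rewrite expr_div_n mulrCA [h ^+ k * _]mulrC divfK// expf_neq0// gt_eqF//.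
rewrite e; split; first exact: integrable_mulrl ik.
by rewrite RintegralZl// Ik.
Qed.

Lemma scaled_kernel_sqr :
  leb.-integrable setT (EFin \o (fun x => Kh (x - a) ^+ 2)) /\
  \int[leb]_x (Kh (x - a) ^+ 2) = (\int[leb]_x (K x ^+ 2)) / h.
Proof.
(* Taking [phi := K] in the substitution produces the square of the kernel. *)
have [ik Ik] := kernel_substitution cK.
have e : (fun x => Kh (x - a) ^+ 2) = (fun x => h^-1 * (Kh (x - a) * K ((x - a) / h))).
  by apply/funext => x; rewrite /scaled_kernel expr2; ring.
rewrite e; split; first exact: integrable_mulrl ik.
by rewrite RintegralZl// Ik mulrC; under [X in _ = X / _]eq_Rintegral do rewrite expr2.
Qed.

Lemma Rintegral_local_compare F f (g r : R -> R) : measurable_fun setT F -> measurable_fun setT f -> measurable_fun setT g ->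
  (forall x, 0 <= F x) -> (forall x, h < `|x - a| -> F x = 0) ->
  (forall x, `|x - a| <= h -> `|f x - g x| <= r x) ->
  leb.-integrable setT (EFin \o (fun x => F x * f x)) ->
  leb.-integrable setT (EFin \o (fun x => F x * g x)) ->
  leb.-integrable setT (EFin \o (fun x => F x * r x)) ->
  `|\int[leb]_x (F x * f x) - \int[leb]_x (F x * g x)| <= \int[leb]_x (F x * r x).
Proof.
move=> mF mf mg F0 Fh fgr iF iG iR; rewrite -RintegralB//.
apply: le_Rintegral_norm => //.
  by apply: measurable_funB; exact: measurable_funM.
move=> x _; rewrite -mulrBr normrM (ger0_norm (F0 x)).
have [xh|xh] := leP `|x - a| h; last by rewrite Fh// !mul0r.
by rewrite ler_wpM2l// fgr.
Qed.

End kernel.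

Section local_density.
Context {R : realType}.
Local Notation leb := (@lebesgue_measure R).
Variables (f : R -> R) (a d C e : R).
Hypothesis mf : measurable_fun setT f.
Hypothesis f0 : forall x, 0 <= f x.
Hypothesis f1 : (\int[leb]_x (f x)%:E = 1)%E.
Hypothesis e0 : 0 < e.
Hypothesis f_taylor : forall t, `|t| <= e -> `|f (a + t) - f a - d * t| <= C * t ^+ 2.

Let C0 : 0 <= C.
Proof.
have := @f_taylor e; rewrite (gtr0_norm e0) lexx => /(_ isT) /(le_trans (normr_ge0 _)).
by rewrite pmulr_lge0// exprn_gt0.
Qed.

(* A density that is almost affine on [a - e, a + e] cannot be large there, as
   it has mass at most 1 on the half where the slope adds to it. *)
Lemma local_density_bound : f a + `|d| * (e / 2) <= 2 / e + C * e ^+ 2.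
Proof.
suff [u uf] : exists u : R, forall x : R, u <= x <= u + e / 2 ->
    f a + `|d| * (e / 2) - C * e ^+ 2 <= f x.
  set c := f a + _; rewrite -lerBlDr -/c.
  have [|cpos] := leP (c - C * e ^+ 2) 0; first by move/le_trans; apply; rewrite divr_ge0// ltW.
  rewrite ler_pdivlMr//.
  suff : (c - C * e ^+ 2) * (e / 2) <= 1 by lra.
  have IE : (\int[leb]_(x in `[u, (u + e / 2)%R]) (c - C * e ^+ 2)%:E = ((c - C * e ^+ 2) * (e / 2))%:E)%E.
    rewrite integral_cst//= lebesgue_measure_itv/= lte_fin ifT; last by rewrite ltrDl divr_gt0.
    by rewrite -EFinD -EFinM; congr EFin; ring.
  rewrite -lee_fin -f1 -IE.
  apply: (@le_trans _ _ (\int[leb]_(x in `[u, (u + e / 2)%R]) (f x)%:E)%E).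
    apply: ge0_le_integral => //.
    - by move=> x _; rewrite lee_fin ltW.
    - exact/measurable_EFinP/measurable_funTS.
  apply: ge0_subset_integral => //; first exact/measurable_EFinP.
  by move=> x _; rewrite lee_fin.
have key t : `|t| <= e -> `|d| * (e / 2) <= d * t -> f a + `|d| * (e / 2) - C * e ^+ 2 <= f (a + t).
  move=> te dt; have := f_taylor te; rewrite ler_norml => /andP[+ _].
  have : C * t ^+ 2 <= C * e ^+ 2.
    by rewrite ler_wpM2l// -(real_normK (num_real t)) lerXn2r// ?nnegrE// ltW.
  lra.
(* The part of [-e, e] where d t >= |d| e / 2: it contains [e/2, e] for a nonnegative slope and
   [-e, -e/2] otherwise. *)
have [d0|d0] := leP 0 d.
  exists (a + e / 2) => x xe; rewrite -(subrKC a x); apply: key; first by rewrite ler_norml; lra.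
  by rewrite ger0_norm// ler_wpM2l//; lra.
exists (a - e) => x xe; rewrite -(subrKC a x); apply: key; first by rewrite ler_norml; lra.
by rewrite ltr0_norm// mulNr -mulrN; rewrite ler_wnM2l//; [exact: ltW|lra].
Qed.

Variables (K : R -> R) (hK : is_smoothing_kernel K) (h : R).
Hypothesis h0 : 0 < h.
Hypothesis he : h <= e.
Local Notation Kh := (scaled_kernel K h).

Let iKh f' : leb.-integrable setT (EFin \o f') -> measurable_fun setT f' ->
  leb.-integrable setT (EFin \o (fun x => Kh (x - a) * f' x)).
Proof.
move=> if' mf'; have [M M0 KM] := kernel_bounded hK.
apply: (integrableM_bounded (M := M / h)) => //; first exact: measurable_scaled_kernel.
by move=> x _; rewrite ger0_norm ?scaled_kernel_ge0// /scaled_kernel ler_pM2r ?invr_gt0.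
Qed.

Let if_ : leb.-integrable setT (EFin \o f).
Proof.
apply/integrableP; split; first exact/measurable_EFinP.
by under eq_integral do rewrite /= ger0_norm//; rewrite f1 ltry.
Qed.

Let moment k := scaled_kernel_moment hK a h0 k.

Let affine_moments : 
  leb.-integrable setT (EFin \o (fun x => Kh (x - a) * (f a + d * (x - a)))) /\
  \int[leb]_x (Kh (x - a) * (f a + d * (x - a))) = f a.
Proof.
have [i0 I0] := moment 0; have [i1 I1] := moment 1.
have E : (fun x => Kh (x - a) * (f a + d * (x - a))) =
   (fun x => f a * (Kh (x - a) * (x - a) ^+ 0) + d * (Kh (x - a) * (x - a) ^+ 1)).
  by apply/funext => x; ring.
have i0' := integrable_mulrl (f a) measurableT i0.
have i1' := integrable_mulrl d measurableT i1.
rewrite E; split; first exact: integrable_addr.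
rewrite RintegralD// !RintegralZl// I0 I1.
have [_ [K1 Ks _]] := hK.
rewrite !expr0 expr1; under eq_Rintegral do rewrite expr0 mulr1.
by under [X in _ + d * (h * X)]eq_Rintegral do rewrite expr1; rewrite K1 Ks; ring.
Qed.

(** A kernel of mass 1 with vanishing first moment integrates the affine part of [f] to [f a]
    exactly; only the remainder is left, against the second moment. *)
Lemma kernel_density_bias : `|\int[leb]_x (Kh (x - a) * f x) - f a| <=
  C * h ^+ 2 * \int[leb]_x (K x * x ^+ 2).
Proof.
have [i2 I2] := moment 2.
have [ia Ia] := affine_moments.
rewrite -{1}Ia -mulrA -I2 -RintegralZl//.
have -> : \int[leb]_x (C * (Kh (x - a) * (x - a) ^+ 2)) = \int[leb]_x (Kh (x - a) * (C * (x - a) ^+ 2)).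
  by apply: eq_Rintegral => x _; ring.
apply: (@Rintegral_local_compare _ a h (fun x => Kh (x - a))) => //.
- exact: measurable_scaled_kernel.
- by apply: measurable_funD => //; apply: measurable_funM => //; exact: measurable_funB.
- by move=> x; exact: scaled_kernel_ge0.
- by move=> x; exact: scaled_kernel0.
- move=> x xh; have /f_taylor : `|x - a| <= e by exact: le_trans he.
  by rewrite subrKC opprD addrA.
- exact: iKh.
- have := integrable_mulrl C measurableT i2; apply: eq_integrable => // x _ /=.
  by congr EFin; ring.
Qed.

(** The mass of K_h^2 has order 1 / h, so the bound |d| h + C h^2 on |f x - f a| over the window
    already gives an error of order 1, without cancelling the linear term. *)
Lemma kernel_density_sqr :
  `|\int[leb]_x (Kh (x - a) ^+ 2 * f x) - f a * (\int[leb]_x (K x ^+ 2)) / h| <=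
  (`|d| + C * h) * \int[leb]_x (K x ^+ 2).
Proof.
have [i2 I2] := scaled_kernel_sqr hK a h0.
rewrite -mulrA -I2 -RintegralZl//.
have -> : (`|d| + C * h) * \int[leb]_x (K x ^+ 2) = (`|d| * h + C * h ^+ 2) * \int[leb]_x (Kh (x - a) ^+ 2).
  by rewrite I2; field; rewrite gt_eqF.
rewrite -RintegralZl//.
have -> : \int[leb]_x (f a * Kh (x - a) ^+ 2) = \int[leb]_x (Kh (x - a) ^+ 2 * f a).
  by apply: eq_Rintegral => x _; ring.
have -> : \int[leb]_x ((`|d| * h + C * h ^+ 2) * Kh (x - a) ^+ 2) =
    \int[leb]_x (Kh (x - a) ^+ 2 * (`|d| * h + C * h ^+ 2)).
  by apply: eq_Rintegral => x _; ring.
apply: (@Rintegral_local_compare _ a h (fun x => Kh (x - a) ^+ 2) f (fun=> f a) (fun=> `|d| * h + C * h ^+ 2)) => //.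
- by apply: measurable_funX; exact: measurable_scaled_kernel.
- by move=> x; exact: sqr_ge0.
- by move=> x xh; rewrite (scaled_kernel0 hK h0)// expr0n.
- move=> x xh; have /f_taylor : `|x - a| <= e by exact: le_trans he.
  rewrite subrKC => H; rewrite -(subrK (d * (x - a)) (f x - f a)).
  apply: (le_trans (ler_normD _ _)); rewrite addrC normrM; apply: lerD; first by rewrite ler_wpM2l.
  apply: (le_trans H); rewrite ler_wpM2l// -(real_normK (num_real (x - a))).
  by rewrite lerXn2r// nnegrE// ltW.
- have [M M0 KM] := kernel_bounded hK.
  apply: (integrableM_bounded (M := (M / h) ^+ 2)) => //.
    by apply: measurable_funX; exact: measurable_scaled_kernel.
  move=> x _; rewrite normrX lerXn2r// ?nnegrE ?divr_ge0 ?(ltW M0) ?(ltW h0)//.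
  by rewrite ger0_norm ?scaled_kernel_ge0// /scaled_kernel ler_pM2r ?invr_gt0.
- have := integrable_mulrl (f a) measurableT i2; apply: eq_integrable => // x _ /=.
  by congr EFin; ring.
- have := integrable_mulrl (`|d| * h + C * h ^+ 2) measurableT i2; apply: eq_integrable => // x _ /=.
  by congr EFin; ring.
Qed.

Variables (d2 eps : R).
Hypothesis f_peano : forall t, `|t| <= h -> `|f (a + t) - f a - d * t - d2 / 2 * t ^+ 2| <= eps * t ^+ 2.

(** [f_peano] concerns the window |t| <= h only, so [eps] can be made small by shrinking [h]. The
    affine part is again integrated exactly and the quadratic one gives the main term. *)
Lemma kernel_density_expansion :
  `|(\int[leb]_x (Kh (x - a) * f x) - f a) / h ^+ 2 - d2 * (\int[leb]_x (K x * x ^+ 2)) / 2| <=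
  eps * \int[leb]_x (K x * x ^+ 2).
Proof.
have [i2 I2] := moment 2.
have [ia Ia] := affine_moments.
have h20 : 0 < h ^+ 2 by rewrite exprn_gt0.
have -> : (\int[leb]_x (Kh (x - a) * f x) - f a) / h ^+ 2 - d2 * (\int[leb]_x (K x * x ^+ 2)) / 2 =
   (\int[leb]_x (Kh (x - a) * f x) - (f a + d2 / 2 * (h ^+ 2 * \int[leb]_x (K x * x ^+ 2)))) / h ^+ 2.
  by field; rewrite gt_eqF.
rewrite normrM normfV (gtr0_norm h20) ler_pdivrMr// //.
have -> : eps * \int[leb]_x (K x * x ^+ 2) * h ^+ 2 = eps * (h ^+ 2 * \int[leb]_x (K x * x ^+ 2)) by ring.
rewrite -I2 -{1}Ia -(RintegralZl eps measurableT i2).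
have i2' := integrable_mulrl (d2 / 2) measurableT i2.
rewrite -(RintegralZl (d2 / 2) measurableT i2) -RintegralD//.
have -> : \int[leb]_x (Kh (x - a) * (f a + d * (x - a)) + d2 / 2 * (Kh (x - a) * (x - a) ^+ 2)) =
   \int[leb]_x (Kh (x - a) * (f a + d * (x - a) + d2 / 2 * (x - a) ^+ 2)).
  by apply: eq_Rintegral => x _; ring.
have -> : \int[leb]_x (eps * (Kh (x - a) * (x - a) ^+ 2)) = \int[leb]_x (Kh (x - a) * (eps * (x - a) ^+ 2)).
  by apply: eq_Rintegral => x _; ring.
apply: (@Rintegral_local_compare _ a h (fun x => Kh (x - a))) => //.
- exact: measurable_scaled_kernel.
- apply: measurable_funD; last by apply: measurable_funM => //; apply: measurable_funX; exact: measurable_funB.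
  by apply: measurable_funD => //; apply: measurable_funM => //; exact: measurable_funB.
- by move=> x; exact: scaled_kernel_ge0.
- by move=> x; exact: scaled_kernel0.
- by move=> x /f_peano; rewrite subrKC !opprD !addrA.
- exact: iKh.
- have := integrable_addr measurableT ia i2'; apply: eq_integrable => // x _ /=.
  by congr EFin; ring.
- have := integrable_mulrl eps measurableT i2; apply: eq_integrable => // x _ /=.
  by congr EFin; ring.
Qed.

End local_density.

(** The second derivative is given at [a] alone, so no Taylor formula involving its nearby values
    applies. Differentiability of the first derivative at [a] makes the derivative [psi] of the
    remainder o(z), and the mean value theorem turns this into o(t^2). *)
Lemma taylor_peano2 {R : realType} (f : R -> R) (a eps : R) : 0 < eps ->
  twice_differentiable_at f a -> exists2 delta : R, 0 < delta &
  forall t, `|t| <= delta ->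
  `|f (a + t) - f a - (f^`())%classic a * t - (f^`(2))%classic a / 2 * t ^+ 2| <= eps * t ^+ 2.
Proof.
move=> eps0 [df d2f].
have f2E : (f^`(2))%classic a = 'D_1 (f^`()%classic) a by rewrite derive1nS /= derive1E.
set d2 := (f^`(2))%classic a in f2E *.
have /cvgrPdist_le/(_ _ eps0) := d2f.
rewrite -/(derive _ _ _) -f2E => near2.
have near2' : \forall t \near 0, `|f^`()%classic (a + t) - f^`()%classic a - d2 * t| <= eps * `|t|.
  move: near2; rewrite near_withinE; apply: filterS => t tH.
  have [->|t0] := eqVneq t 0; first by rewrite addr0 mulr0 !subrr normr0 mulr0.
  have := tH t0; rewrite /= /GRing.scale/= mulr1 => H.
  have tp : 0 < `|t| by rewrite normr_gt0.
  rewrite -(ler_pdivrMr _ _ tp) -normfV -normrM -normrN.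
  suff -> : - ((f^`()%classic (a + t) - f^`()%classic a - d2 * t) / t) =
    d2 - t^-1 * (f^`()%classic (t + a) - f^`()%classic a) by exact: H.
  by rewrite [t + a]addrC; field.
have df' : \forall t \near 0, derivable f (a + t) 1.
  by move: df; rewrite (near_shift 0) /= subr0; apply: filterS => t; rewrite /= addrC.
have [delta/= delta0 nd] : \forall t \near (0 : R), derivable f (a + t) 1 /\
   `|f^`()%classic (a + t) - f^`()%classic a - d2 * t| <= eps * `|t| by near=> t; split; near: t.
clear near2 near2' df' df d2f; exists (delta / 2); first by rewrite divr_gt0.
move=> t td.
pose phi z := f (a + z) - f a - f^`()%classic a * z - d2 / 2 * z ^+ 2.
pose psi z := f^`()%classic (a + z) - f^`()%classic a - d2 * z.
have nd' z : Num.min 0 t <= z <= Num.max 0 t -> derivable f (a + z) 1 /\ `|psi z| <= eps * `|z|.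
  move=> /between0_norm zt; apply: nd; rewrite /= sub0r normrN; apply: le_lt_trans zt _.
  by move: td delta0; clear; lra.
have [|z zt] := @is_derive_increment_itv _ phi psi 0 t.
  move=> z zt; have [dfz _] := nd' z zt.
  have dfz' : is_derive (a + z) 1 f (f^`()%classic (a + z)).
    by apply: DeriveDef; [exact: dfz|rewrite -derive1E].
  have d1 : is_derive z 1 (fun z => a + z) 1.
    by have := is_deriveD (is_derive_cst a z 1) (is_derive_id z 1); rewrite add0r.
  have dz := @is_derive1_comp _ f (fun z => a + z) z _ _ dfz' d1; rewrite mulr1 in dz.
  by rewrite /phi /psi; apply: is_derive_eq; rewrite /GRing.scale/=; field.
have phi0 : phi 0 = 0 by rewrite /phi addr0; ring.
rewrite phi0 !subr0 -/(phi t) => ->.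
have [_ psiz] := nd' z zt.
rewrite normrM -(real_normK (num_real t)) expr2 mulrA; apply: ler_wpM2r; first exact: normr_ge0.
by apply: (le_trans psiz); apply: ler_wpM2l; [exact: ltW|exact: between0_norm].
Unshelve. all: by end_near.
Qed.

(** * Smoothed densities averaged over the instrument *)

Section kernel_population.
Context {R : realType} dW dZ (W : measurableType dW) (T2 : measurableType dZ).
Local Notation leb := (@lebesgue_measure R).
Context (Q : probability W R).
Variables (X : W -> R) (Z : W -> T2) (D : set W) (q : R -> T2 -> R).
Hypothesis mX : measurable_fun setT X.
Hypothesis mZ : measurable_fun setT Z.
Hypothesis mD : measurable D.
Hypothesis mq : measurable_fun setT (fun xz : R * T2 => q xz.1 xz.2).
Hypothesis q0 : forall x z, 0 <= q x z.
Hypothesis hq : forall (B : set R) C, measurable B -> measurable C ->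
  Q [set o | [/\ B (X o), C (Z o) & D o]] =
  (\int[Q]_(o in [set o | C (Z o) /\ D o]) \int[leb]_(x in B) (q x (Z o))%:E)%E.
Hypothesis q1 : forall o, D o -> (\int[leb]_x (q x (Z o))%:E = 1)%E.
Variables (a C e : R) (d1 d2 : W -> R).
Hypothesis e0 : 0 < e.
Hypothesis q_taylor : forall o t, D o -> `|t| <= e ->
  `|q (a + t) (Z o) - q a (Z o) - d1 o * t| <= C * t ^+ 2.
Hypothesis q_peano : forall o eps, D o -> 0 < eps -> exists2 delta : R, 0 < delta &
  forall t, `|t| <= delta ->
    `|q (a + t) (Z o) - q a (Z o) - d1 o * t - d2 o / 2 * t ^+ 2| <= eps * t ^+ 2.
Variables (K : R -> R) (hK : is_smoothing_kernel K).
Implicit Types (h : R).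

Local Notation Kh h := (fun x : R => scaled_kernel K h (x - a)).
Local Notation kappa2 := (\int[leb]_x (K x * x ^+ 2)).
Local Notation K2 := (\int[leb]_x (K x ^+ 2)).

(** This and the next are the conditional means, given Z, of K_h(X - a) and of its square. *)
Definition kernel_mean h o := \int[leb]_x (Kh h x * q x (Z o)).
Definition kernel_sqr_mean h o := \int[leb]_x (Kh h x ^+ 2 * q x (Z o)).

Let mqz (z : T2) : measurable_fun setT (q ^~ z).
Proof.
have h : measurable_fun setT (fun x : R => (x, z)) by apply: measurable_fun_pair.
exact: (measurableT_comp mq h).
Qed.

Let kappa2_ge0 : 0 <= kappa2. Proof. by case: hK => _ [_ _ /ltW]. Qed.

Let K2_ge0 : 0 <= K2. Proof. by apply: Rintegral_ge0 => x _; exact: sqr_ge0. Qed.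

Lemma kernel_mean_ge0 h o : 0 < h -> 0 <= kernel_mean h o.
Proof. by move=> h0; apply: Rintegral_ge0 => x _; rewrite mulr_ge0// (scaled_kernel_ge0 hK). Qed.

Lemma kernel_sqr_mean_ge0 h o : 0 <= kernel_sqr_mean h o.
Proof. by apply: Rintegral_ge0 => x _; rewrite mulr_ge0// sqr_ge0. Qed.

(** Uniformity in [o] is the point: [local_density_bound] controls the density and its slope at [a]
    by [e] and [C] alone, so all constants are fixed before [o]. *)
Lemma kernel_mean_bounds : exists2 M, 0 < M & forall o h, D o -> 0 < h -> h <= e ->
  [/\ q a (Z o) <= M, `|kernel_mean h o - q a (Z o)| <= M * h ^+ 2,
      kernel_mean h o <= M, `|h * kernel_sqr_mean h o - q a (Z o) * K2| <= M * h
    & h * kernel_sqr_mean h o <= M].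
Proof.
(* [C] is known to be nonnegative only when [D] is inhabited. *)
pose C' := `|C|.
have C'0 : 0 <= C' by exact: normr_ge0.
(* [B] bounds the density at [a] and [Bd] its slope; [M1] and [M3] are the error constants for the
   kernel and its square, [M2] and [M4] the resulting bounds when h <= e. *)
pose B := 2 / e + C' * e ^+ 2.
pose Bd := B * (2 / e).
have B0 : 0 < B by rewrite ltr_pwDl ?divr_gt0// mulr_ge0// sqr_ge0.
have Bd0 : 0 < Bd by rewrite mulr_gt0// divr_gt0.
pose M1 := C' * kappa2; pose M2 := B + M1 * e ^+ 2.
pose M3 := (Bd + C' * e) * K2; pose M4 := B * K2 + M3 * e.
have M10 : 0 <= M1 by rewrite mulr_ge0.
have C'e : 0 <= C' * e by exact: mulr_ge0 C'0 (ltW e0).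
have M30 : 0 <= M3 by exact: mulr_ge0 (addr_ge0 (ltW Bd0) C'e) K2_ge0.
have M20 : 0 <= M2 by exact: addr_ge0 (ltW B0) (mulr_ge0 M10 (sqr_ge0 e)).
have M40 : 0 <= M4 by exact: addr_ge0 (mulr_ge0 (ltW B0) K2_ge0) (mulr_ge0 M30 (ltW e0)).
exists (B + M1 + M2 + M3 + M4); first lra.
move=> o h oD h0 he.
have qT t : `|t| <= e -> `|q (a + t) (Z o) - q a (Z o) - d1 o * t| <= C' * t ^+ 2.
  by move=> te; apply: (le_trans (q_taylor oD te)); rewrite ler_wpM2r ?sqr_ge0// ler_norm.
have mqo := mqz (Z o); have q0o := q0 ^~ (Z o).
have bnd := local_density_bound mqo q0o (q1 oD) e0 qT; rewrite -/B in bnd.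
have qa0 := q0 a (Z o).
have d10 : 0 <= `|d1 o| * (e / 2) by rewrite mulr_ge0// divr_ge0// ltW.
have qaB : q a (Z o) <= B by lra.
have d1B : `|d1 o| <= Bd.
  rewrite /Bd -ler_pdivrMr ?divr_gt0//; apply: le_trans (_ : `|d1 o| * (e / 2) <= _); last lra.
  by rewrite le_eqVlt (_ : _ / (2 / e) = `|d1 o| * (e / 2)) ?eqxx//; field; rewrite gt_eqF.
have h2 : h ^+ 2 <= e ^+ 2 by rewrite lerXn2r// ?nnegrE ltW.
have b1 := kernel_density_bias mqo q0o (q1 oD) qT hK h0 he.
have b2 := kernel_density_sqr mqo q0o (q1 oD) e0 qT hK h0 he.
rewrite -/(kernel_mean h o) in b1; rewrite -/(kernel_sqr_mean h o) in b2.
have b1' : `|kernel_mean h o - q a (Z o)| <= M1 * h ^+ 2 by rewrite /M1 mulrAC.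
have b2' : `|h * kernel_sqr_mean h o - q a (Z o) * K2| <= M3 * h.
  have -> : h * kernel_sqr_mean h o - q a (Z o) * K2 = (kernel_sqr_mean h o - q a (Z o) * K2 / h) * h.
    by field; rewrite gt_eqF.
  rewrite normrM (gtr0_norm h0) ler_wpM2r ?(ltW h0)//; apply: (le_trans b2).
  by rewrite ler_wpM2r// lerD// ler_wpM2l.
have M1h : M1 * h ^+ 2 <= M1 * e ^+ 2 by rewrite ler_wpM2l.
have M3h : M3 * h <= M3 * e by rewrite ler_wpM2l.
have qaK : q a (Z o) * K2 <= B * K2 by rewrite ler_wpM2r.
split; first lra.
- by apply: (le_trans b1'); rewrite ler_wpM2r ?sqr_ge0//; lra.
- move: b1'; rewrite ler_norml => /andP[_]; rewrite /M2 in M20 *; lra.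
- by apply: (le_trans b2'); rewrite ler_wpM2r ?(ltW h0)//; lra.
- move: b2'; rewrite ler_norml => /andP[_]; rewrite /M4 in M40 *; lra.
Qed.

Lemma kernel_mean_expansion (h_ : nat -> R) o : D o -> (forall n, 0 < h_ n) -> h_ n @[n --> \oo] --> 0 ->
  (kernel_mean (h_ n) o - q a (Z o)) / h_ n ^+ 2 @[n --> \oo] --> d2 o * kappa2 / 2.
Proof.
move=> oD h0 hc.
apply/cvgrPdist_le => eps eps0.
have k1 : 0 < kappa2 + 1 by rewrite ltr_wpDl.
have [delta delta0 qP] := q_peano oD (divr_gt0 eps0 k1).
have he : \forall n \near \oo, h_ n <= Num.min delta e.
  have me : 0 < Num.min delta e by rewrite lt_min delta0.
  by move/cvgrPdist_le : hc => /(_ _ me); apply: filterS => n; rewrite sub0r normrN gtr0_norm.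
apply: filterS he => n; rewrite le_min => /andP[hd he].
rewrite distrC.
have qP' t : `|t| <= h_ n -> `|q (a + t) (Z o) - q a (Z o) - d1 o * t - d2 o / 2 * t ^+ 2| <= eps / (kappa2 + 1) * t ^+ 2.
  by move=> th; apply: qP; exact: le_trans hd.
have := kernel_density_expansion (mqz (Z o)) (q0 ^~ (Z o)) (q1 oD) hK (h0 n) qP'.
move/le_trans; apply.
rewrite -mulrA ler_piMr ?(ltW eps0)// mulrC ler_pdivrMr// mul1r lerDl//.
Qed.

(** The hypotheses are restated over [measurableTypeR R], the type carrying Lebesgue measure, so
    that the disintegration applies. *)
Let mX' : measurable_fun setT (X : W -> measurableTypeR R).
Proof. exact: mX. Qed.
Let mq' : measurable_fun setT (fun xz : measurableTypeR R * T2 => q xz.1 xz.2).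
Proof.
have h1 : measurable_fun setT (fun xz : measurableTypeR R * T2 => xz.1 : R).
  exact: (@measurable_fst _ _ (measurableTypeR R) T2).
have h2 := @measurable_snd _ _ (measurableTypeR R) T2.
exact: (measurableT_comp mq (measurable_fun_pair h1 h2)).
Qed.
Let hq' (B : set (measurableTypeR R)) (C' : set T2) : measurable B -> measurable C' ->
  Q [set o | [/\ B (X o), C' (Z o) & D o]] =
  (\int[Q]_(o in [set o | C' (Z o) /\ D o]) \int[leb]_(x in B) (q x (Z o))%:E)%E.
Proof. exact: hq. Qed.

Let measurable_Kh h : measurable_fun setT (fun x : measurableTypeR R => scaled_kernel K h (x - a) : R).
Proof. exact: measurable_scaled_kernel. Qed.

Let Kh_ge0 h x : 0 < h -> 0 <= scaled_kernel K h (x - a).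
Proof. by move=> h0; exact: (scaled_kernel_ge0 hK). Qed.

Let MK := sval (cid2 (kernel_bounded hK)).
Let MK0 : 0 < MK. Proof. by rewrite /MK; case: cid2. Qed.
Let Kh_le h x : 0 < h -> scaled_kernel K h (x - a) <= MK / h.
Proof. by move=> h0; rewrite /MK; case: cid2 => M _ KM /=; rewrite /scaled_kernel ler_pM2r ?invr_gt0. Qed.

Let Kh2_le h x : 0 < h -> scaled_kernel K h (x - a) ^+ 2 <= (MK / h) ^+ 2.
Proof.
by move=> h0; rewrite lerXn2r ?nnegrE ?Kh_ge0 ?Kh_le// divr_ge0// ltW.
Qed.

Let int_Kh h (G : T2 -> R) : 0 < h -> measurable_fun setT G ->
  Q.-integrable D (EFin \o (fun o => G (Z o))) ->
  \int[Q]_(o in D) (Kh h (X o) * G (Z o)) = \int[Q]_(o in D) (kernel_mean h o * G (Z o)).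
Proof.
move=> h0 mG iG.
exact: (disintegration mX' mZ mD mq' q0 hq' q1 (measurable_Kh h) (fun x => Kh_ge0 x h0) (fun x => Kh_le x h0) mG iG).
Qed.

Let int_Kh2 h (G : T2 -> R) : 0 < h -> measurable_fun setT G ->
  Q.-integrable D (EFin \o (fun o => G (Z o))) ->
  \int[Q]_(o in D) (Kh h (X o) ^+ 2 * G (Z o)) = \int[Q]_(o in D) (kernel_sqr_mean h o * G (Z o)).
Proof.
move=> h0 mG iG.
exact: (disintegration mX' mZ mD mq' q0 hq' q1 (measurable_funX _ (measurable_Kh h)) (fun x => sqr_ge0 _) (fun x => Kh2_le x h0) mG iG).
Qed.

Lemma measurable_kernel_mean h : 0 < h -> measurable_fun setT (kernel_mean h).
Proof.
move=> h0; exact: (measurable_cond_expectation leb mZ mq' q0 (measurable_Kh h) (fun x => Kh_ge0 x h0)).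
Qed.

Lemma measurable_kernel_sqr_mean h : 0 < h -> measurable_fun setT (kernel_sqr_mean h).
Proof.
move=> h0; exact: (measurable_cond_expectation leb mZ mq' q0 (measurable_funX _ (measurable_Kh h)) (fun x => sqr_ge0 _)).
Qed.

Let mKX h : measurable_fun D (fun o => Kh h (X o)).
Proof. exact/measurable_funTS/(measurableT_comp (measurable_Kh h) mX'). Qed.

Let iKG h (G : T2 -> R) : 0 < h -> Q.-integrable D (EFin \o (fun o => G (Z o))) ->
  Q.-integrable D (EFin \o (fun o => Kh h (X o) * G (Z o))).
Proof.
move=> h0; apply: (integrableM_bounded (M := MK / h) mD (mKX h)) => o _.
by rewrite ger0_norm ?Kh_ge0 ?Kh_le.
Qed.

Let iK2G h (G : T2 -> R) : 0 < h -> Q.-integrable D (EFin \o (fun o => G (Z o))) ->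
  Q.-integrable D (EFin \o (fun o => Kh h (X o) ^+ 2 * G (Z o))).
Proof.
move=> h0; apply: (integrableM_bounded (M := (MK / h) ^+ 2) mD (measurable_funX _ (mKX h))) => o _.
by rewrite ger0_norm ?sqr_ge0 ?Kh2_le.
Qed.

Let i_sqr_mean h (G : T2 -> R) : 0 < h -> h <= e -> Q.-integrable D (EFin \o (fun o => G (Z o))) ->
  Q.-integrable D (EFin \o (fun o => kernel_sqr_mean h o * G (Z o))).
Proof.
move=> h0 he; have [M M0 hM] := kernel_mean_bounds.
apply: (integrableM_bounded (M := M / h)) mD _ _ => [|o oD].
  exact/measurable_funTS/measurable_kernel_sqr_mean.
rewrite ger0_norm ?kernel_sqr_mean_ge0// ler_pdivlMr// mulrC.
by case: (hM o h oD h0 he).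
Qed.

Let i_mean h (G : T2 -> R) : 0 < h -> h <= e -> Q.-integrable D (EFin \o (fun o => G (Z o))) ->
  Q.-integrable D (EFin \o (fun o => kernel_mean h o * G (Z o))).
Proof.
move=> h0 he; have [M M0 hM] := kernel_mean_bounds.
apply: (integrableM_bounded (M := M)) mD _ _ => [|o oD].
  exact/measurable_funTS/measurable_kernel_mean.
by rewrite ger0_norm ?kernel_mean_ge0//; case: (hM o h oD h0 he).
Qed.

Let m_qa : measurable_fun setT (fun o => q a (Z o)).
Proof.
have h : measurable_fun setT (fun z : T2 => (a, z)) by apply: measurable_fun_pair.
exact: (measurableT_comp (measurableT_comp mq h) mZ).
Qed.

Let i_qa (G : T2 -> R) : Q.-integrable D (EFin \o (fun o => G (Z o))) ->
  Q.-integrable D (EFin \o (fun o => q a (Z o) * G (Z o))).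
Proof.
have [M M0 hM] := kernel_mean_bounds.
apply: (integrableM_bounded (M := M)) mD _ _ => [|o oD].
  exact/measurable_funTS.
by rewrite ger0_norm//; case: (hM o e oD e0 (lexx _)).
Qed.

(** From (x - c)^2 <= 2 x^2 + 2 c^2. The constant does not depend on [F], which is 1 for the
    nuisance sums and a vanishing truncation of [G ^+ 2] in Lindeberg's condition. *)
Lemma kernel_second_moment_le A : exists2 M, 0 < M & forall h c (F : T2 -> R),
  0 < h -> h <= e -> `|c| <= A -> measurable_fun setT F -> (forall z, 0 <= F z) ->
  Q.-integrable D (EFin \o (fun o => F (Z o))) ->
  h * \int[Q]_(o in D) ((Kh h (X o) - c) ^+ 2 * F (Z o)) <= M * \int[Q]_(o in D) F (Z o).
Proof.
have [M M0 hM] := kernel_mean_bounds.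
exists (2 * M + 2 * e * A ^+ 2); first by apply: ltr_pwDl; rewrite ?mulr_gt0// mulr_ge0 ?sqr_ge0// mulr_ge0// ltW.
move=> h c F h0 he cA mF F0 iF.
have mFZ : measurable_fun D (fun o => F (Z o)) by exact/measurable_funTS/(measurableT_comp mF mZ).
have iK2 := iK2G h0 iF.
have i1 := integrable_mulrl 2 mD iK2; have i2 := integrable_mulrl (2 * c ^+ 2) mD iF.
have IF0 : 0 <= \int[Q]_(o in D) F (Z o) by exact: Rintegral_ge0.
have c2 : c ^+ 2 <= A ^+ 2.
  by rewrite -(real_normK (num_real c)) lerXn2r// nnegrE (le_trans _ cA).
apply: (@le_trans _ _ (h * (2 * \int[Q]_(o in D) (kernel_sqr_mean h o * F (Z o)) + 2 * c ^+ 2 * \int[Q]_(o in D) F (Z o)))).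
  rewrite ler_wpM2l ?(ltW h0)// -int_Kh2// -!RintegralZl// -RintegralD//.
  apply: le_Rintegral => //.
  - apply: (le_integrable_norm (g := fun o => 2 * (Kh h (X o) ^+ 2 * F (Z o)) + 2 * c ^+ 2 * F (Z o))) => //.
    + by apply: measurable_funM => //; apply: measurable_funX; apply: measurable_funB.
    + move=> o _; rewrite ger0_norm; last by rewrite mulr_ge0 ?sqr_ge0.
      by rewrite mulrA -mulrDl ler_wpM2r//; have := sqr_ge0 (scaled_kernel K h (X o - a) + c); lra.
    + exact: integrable_addr.
  - exact: integrable_addr.
  - move=> o _; rewrite mulrA -mulrDl ler_wpM2r//.
    by have := sqr_ge0 (scaled_kernel K h (X o - a) + c); lra.
rewrite mulrDr [leRHS]mulrDl; apply: lerD.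
  have isq := i_sqr_mean h0 he iF.
  rewrite mulrCA -mulrA ler_wpM2l// -!RintegralZl//; apply: le_Rintegral => //.
  - exact: integrable_mulrl.
  - exact: integrable_mulrl.
  - by move=> o oD; rewrite mulrA ler_wpM2r//; case: (hM o h oD h0 he).
rewrite mulrA ler_wpM2r// mulrCA -mulrA ler_wpM2l//.
by apply: ler_pM => //; [exact: ltW|exact: sqr_ge0].
Qed.

Variable G : T2 -> R.
Hypothesis mG : measurable_fun setT G.
Hypothesis iG2 : Q.-integrable D (EFin \o (fun o => G (Z o) ^+ 2)).
Hypothesis G_centered : \int[Q]_(o in D) G (Z o) = 0.

Let mGZ : measurable_fun D (fun o => G (Z o)).
Proof. exact/measurable_funTS/(measurableT_comp mG mZ). Qed.

Let iG : Q.-integrable D (EFin \o (fun o => G (Z o))).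
Proof. exact: integrable_of_sqr. Qed.

Let score h c o := (Kh h (X o) - c) * G (Z o).

Let mscore h c : measurable_fun D (score h c).
Proof. by apply: measurable_funM => //; exact: measurable_funB. Qed.

Lemma integrable_score h c : 0 < h -> Q.-integrable D (EFin \o score h c).
Proof.
move=> h0; apply: eq_integrable (integrable_subr mD (iKG h0 iG) (integrable_mulrl c mD iG)) => // o _.
by rewrite /score /= mulrBl.
Qed.

Lemma score_mean h c : 0 < h ->
  \int[Q]_(o in D) score h c o = \int[Q]_(o in D) (kernel_mean h o * G (Z o)).
Proof.
move=> h0; rewrite -int_Kh//.
have -> : \int[Q]_(o in D) score h c o =
   \int[Q]_(o in D) (scaled_kernel K h (X o - a) * G (Z o) - c * G (Z o)).
  by apply: eq_Rintegral => o _; rewrite /score mulrBl.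
rewrite RintegralB//; [|exact: iKG|exact: integrable_mulrl].
by rewrite RintegralZl// G_centered mulr0 subr0.
Qed.

Lemma score_bias_le : exists2 M, 0 < M & forall h c, 0 < h -> h <= e ->
  `|\int[Q]_(o in D) score h c o - \int[Q]_(o in D) (q a (Z o) * G (Z o))| <= M * h ^+ 2.
Proof.
have [M M0 hM] := kernel_mean_bounds.
have iGn : Q.-integrable D (EFin \o (fun o => `|G (Z o)|)) by exact: integrable_norm iG.
have IG0 : 0 <= \int[Q]_(o in D) `|G (Z o)| by exact: Rintegral_ge0.
exists (M * (\int[Q]_(o in D) `|G (Z o)| + 1)); first by rewrite mulr_gt0// ltr_wpDl.
move=> h c h0 he; rewrite score_mean// -RintegralB//; [|exact: i_mean|exact: i_qa].
apply: (@le_trans _ _ (\int[Q]_(o in D) (M * h ^+ 2 * `|G (Z o)|))).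
  apply: le_Rintegral_norm => //.
  - exact: integrable_mulrl.
  - apply: measurable_funB; apply: measurable_funM => //; apply: measurable_funTS => //.
    exact: measurable_kernel_mean.
  - by move=> o oD; rewrite -mulrBl normrM ler_wpM2r//; case: (hM o h oD h0 he).
rewrite RintegralZl// mulrAC ler_wpM2r ?sqr_ge0// ler_wpM2l ?(ltW M0)//; lra.
Qed.

(** Dominated convergence in [o]: the expansion of the smoothed density is pointwise, without a rate
    uniform in [o], and [kernel_mean_bounds] provides the domination. *)
Lemma score_bias_expansion (h_ c_ : nat -> R) : (forall n, 0 < h_ n) -> h_ n @[n --> \oo] --> 0 ->
  (\int[Q]_(o in D) score (h_ n) (c_ n) o - \int[Q]_(o in D) (q a (Z o) * G (Z o))) / h_ n ^+ 2
    @[n --> \oo] --> (\int[Q]_(o in D) (d2 o * G (Z o))) * kappa2 / 2.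
Proof.
move=> h0 hc.
have k0 : 0 < kappa2 by case: hK => _ [].
have [N _ hN] : \forall n \near \oo, h_ n <= e.
  by move/cvgrPdist_le : hc => /(_ _ e0); apply: filterS => n; rewrite sub0r normrN gtr0_norm.
(* Domination is wanted at every index, so the sequence is shifted past the point where h <= e. *)
rewrite -(cvg_shiftn N).
(* The factor 2 / kappa2 makes the pointwise limit exactly [d2 o * G (Z o)], whose measurability
   then comes from its being a limit of measurable functions. *)
pose f n o := ((kernel_mean (h_ (n + N)%N) o - q a (Z o)) / h_ (n + N)%N ^+ 2) * (2 / kappa2 * G (Z o)).
have [M M0 hM] := kernel_mean_bounds.
have fD n : (\int[Q]_(o in D) score (h_ (n + N)%N) (c_ (n + N)%N) o - \int[Q]_(o in D) (q a (Z o) * G (Z o))) / h_ (n + N)%N ^+ 2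
   = \int[Q]_(o in D) f n o * (kappa2 / 2).
  have he : h_ (n + N)%N <= e by apply: hN => /=; rewrite leq_addl.
  have hn2 : h_ (n + N)%N ^+ 2 != 0 by rewrite expf_neq0// gt_eqF.
  rewrite score_mean// -RintegralB//; [|exact: i_mean|exact: i_qa].
  have -> : \int[Q]_(o in D) f n o = \int[Q]_(o in D)
      (2 / kappa2 / h_ (n + N)%N ^+ 2 * (kernel_mean (h_ (n + N)%N) o * G (Z o) - q a (Z o) * G (Z o))).
    by apply: eq_Rintegral => o _; rewrite /f; ring.
  rewrite RintegralZl//; last by apply: integrable_subr => //; [exact: i_mean|exact: i_qa].
  by field; rewrite !gt_eqF.
rewrite (eq_cvg _ _ fD).
rewrite -mulrA; apply: cvgMl.
have mf n : measurable_fun D (f n).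
  apply: measurable_funTS; apply: measurable_funM; last first.
    by apply: measurable_funM => //; exact: (measurableT_comp mG mZ).
  by apply: measurable_funM => //; apply: measurable_funB => //; exact: measurable_kernel_mean.
have cf o : D o -> f n o @[n --> \oo] --> d2 o * G (Z o).
  move=> oD; have := kernel_mean_expansion oD h0 hc; rewrite -(cvg_shiftn N) => /= kc.
  have -> : d2 o * G (Z o) = (d2 o * kappa2 / 2) * (2 / kappa2 * G (Z o)).
    by field; rewrite gt_eqF.
  exact: cvgMl.
apply: (dominated_convergence_Rintegral (g := fun o => M * (2 / kappa2) * `|G (Z o)|)) => //.
- exact: measurable_fun_cvg mf cf.
- exact/aeW.
- by apply: integrable_mulrl => //; exact: integrable_norm iG.
- have k2 : 0 < 2 / kappa2 by rewrite divr_gt0.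
  apply: aeW => o n oD; rewrite /f normrM -(mulrA M); apply: ler_pM => //; last first.
    by rewrite normrM (gtr0_norm k2).
  have h2 : 0 < h_ (n + N)%N ^+ 2 by rewrite exprn_gt0.
  have he : h_ (n + N)%N <= e by apply: hN => /=; rewrite leq_addl.
  rewrite normrM normfV (gtr0_norm h2) ler_pdivrMr//.
  by case: (hM o _ oD (h0 (n + N)%N) he).
Qed.

(** In the expanded square only the term in K_h^2 has order 1 / h. Those created by centering at [c]
    and [m] are bounded and contribute O(h) once multiplied by [h]. *)
Lemma score_variance_le A : exists2 B, 0 < B & forall h c m, 0 < h -> h <= e -> `|c| <= A -> `|m| <= A ->
  `|h * \int[Q]_(o in D) ((score h c o - m) ^+ 2) - K2 * \int[Q]_(o in D) (q a (Z o) * G (Z o) ^+ 2)| <= B * h.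
Proof.
have [M M0 hM] := kernel_mean_bounds.
pose I2 := \int[Q]_(o in D) (G (Z o) ^+ 2); pose I1 := \int[Q]_(o in D) `|G (Z o)|.
pose I0 := \int[Q]_(o in D) 1.
have I20 : 0 <= I2 by apply: Rintegral_ge0 => o _; exact: sqr_ge0.
have I10 : 0 <= I1 by exact: Rintegral_ge0.
have I00 : 0 <= I0 by exact: Rintegral_ge0.
pose A' := `|A|; have A'0 : 0 <= A' by exact: normr_ge0.
pose B := M * I2 + 2 * A' * (M * I2) + A' ^+ 2 * I2 + 2 * A' * (M * I1) + A' ^+ 2 * I0.
have B0 : 0 <= B.
  by rewrite /B !addr_ge0// !mulr_ge0 ?sqr_ge0// ?mulr_ge0// ltW.
exists (B + 1); first lra.
move=> h c m h0 he cA mA.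
have cA' : `|c| <= A' by exact: le_trans cA (ler_norm _).
have mA' : `|m| <= A' by exact: le_trans mA (ler_norm _).
pose G2 z := G z ^+ 2.
have mG2 : measurable_fun setT G2 by exact: measurable_funX.
have G20 o : 0 <= G2 (Z o) by exact: sqr_ge0.
have iG2' : Q.-integrable D (EFin \o (fun o => G2 (Z o))) by exact: iG2.
have i1 := iK2G h0 iG2'; have i2 := integrable_mulrl (- 2 * c) mD (iKG h0 iG2').
have i3 := integrable_mulrl (c ^+ 2) mD iG2'.
have i4 := integrable_mulrl (- 2 * m) mD (integrable_score c h0).
have i5 : Q.-integrable D (EFin \o (fun=> m ^+ 2 * 1)).
  by apply: integrable_mulrl => //; exact: finite_measure_integrable_cst.
have i12 := integrable_addr mD i1 i2; have i123 := integrable_addr mD i12 i3.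
have i1234 := integrable_addr mD i123 i4.
pose J2 := \int[Q]_(o in D) (kernel_mean h o * G2 (Z o)).
pose J1 := \int[Q]_(o in D) (kernel_mean h o * G (Z o)).
have E : \int[Q]_(o in D) ((score h c o - m) ^+ 2) =
  \int[Q]_(o in D) (kernel_sqr_mean h o * G2 (Z o)) + (- 2 * c) * J2 +
  c ^+ 2 * I2 + (- 2 * m) * J1 + m ^+ 2 * I0.
  rewrite /J1 -(score_mean c h0) /J2 -(int_Kh h0 mG2 iG2') -(int_Kh2 h0 mG2 iG2').
  rewrite -(RintegralZl (- 2 * c) mD (iKG h0 iG2')) -(RintegralZl (c ^+ 2) mD iG2').
  rewrite -(RintegralZl (- 2 * m) mD (integrable_score c h0)).
  rewrite /I0 -RintegralZl//; last exact: finite_measure_integrable_cst.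
  rewrite -(RintegralD mD i1 i2) -(RintegralD mD i12 i3) -(RintegralD mD i123 i4) -(RintegralD mD i1234 i5).
  by apply: eq_Rintegral => o _; rewrite /score /G2; ring.
have isq := i_sqr_mean h0 he iG2'; have iqa := i_qa iG2'.
have T1 : `|h * \int[Q]_(o in D) (kernel_sqr_mean h o * G2 (Z o)) - K2 * \int[Q]_(o in D) (q a (Z o) * G2 (Z o))| <= M * I2 * h.
  have isq' := integrable_mulrl h mD isq; have iqa' := integrable_mulrl K2 mD iqa.
  rewrite -(RintegralZl h mD isq) -(RintegralZl K2 mD iqa) -RintegralB//.
  rewrite mulrAC -(RintegralZl _ mD iG2'); apply: le_Rintegral_norm => //.
  - exact: integrable_mulrl.
  - apply: measurable_funB; (do 2 apply: measurable_funM => //); apply: measurable_funTS => //.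
    + exact: measurable_kernel_sqr_mean.
    + exact: measurableT_comp mG2 mZ.
    + exact: measurableT_comp mG2 mZ.
  - move=> o oD; 
    have -> : h * (kernel_sqr_mean h o * G2 (Z o)) - K2 * (q a (Z o) * G2 (Z o)) =
      (h * kernel_sqr_mean h o - q a (Z o) * K2) * G2 (Z o) by ring.
    by rewrite normrM (ger0_norm (G20 o)); apply: ler_wpM2r; [exact: G20|case: (hM o h oD h0 he)].
have J2B : `|J2| <= M * I2.
  rewrite -(RintegralZl _ mD iG2'); apply: le_Rintegral_norm => //.
  - exact: integrable_mulrl.
  - apply: measurable_funM; apply: measurable_funTS; first exact: measurable_kernel_mean.
    exact: measurableT_comp mG2 mZ.
  - move=> o oD; rewrite normrM (ger0_norm (G20 o)); apply: ler_wpM2r; first exact: G20.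
    by rewrite ger0_norm ?kernel_mean_ge0//; case: (hM o h oD h0 he).
have iGn : Q.-integrable D (EFin \o (fun o => `|G (Z o)|)) by exact: integrable_norm iG.
have J1B : `|J1| <= M * I1.
  rewrite -(RintegralZl _ mD iGn); apply: le_Rintegral_norm => //.
  - exact: integrable_mulrl.
  - by apply: measurable_funM => //; apply: measurable_funTS; exact: measurable_kernel_mean.
  - move=> o oD; rewrite normrM ler_wpM2r//.
    by rewrite ger0_norm ?kernel_mean_ge0//; case: (hM o h oD h0 he).
have sqA (x : R) : `|x| <= A' -> x ^+ 2 <= A' ^+ 2.
  by move=> xA; rewrite -(real_normK (num_real x)) lerXn2r// nnegrE.
rewrite E.
set J := \int[Q]_(o in D) (kernel_sqr_mean h o * G2 (Z o)) in T1 *.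
have -> : h * (J + - 2 * c * J2 + c ^+ 2 * I2 + - 2 * m * J1 + m ^+ 2 * I0) -
    K2 * \int[Q]_(o in D) (q a (Z o) * G (Z o) ^+ 2) =
  (h * J - K2 * \int[Q]_(o in D) (q a (Z o) * G2 (Z o))) +
  h * (- 2 * c * J2) + h * (c ^+ 2 * I2) + h * (- 2 * m * J1) + h * (m ^+ 2 * I0).
  by rewrite /G2; ring.
apply: (le_trans (ler_normD _ _)); apply: (le_trans (lerD (ler_normD _ _) (lexx _))).
apply: (le_trans (lerD (lerD (ler_normD _ _) (lexx _)) (lexx _))).
apply: (le_trans (lerD (lerD (lerD (ler_normD _ _) (lexx _)) (lexx _)) (lexx _))).
have twoA (x : R) : `|x| <= A' -> `|- 2 * x| <= 2 * A'.
  by move=> xA; rewrite mulNr normrN normrM (ger0_norm (ler0n _ 2)); apply: ler_wpM2l.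
have S2 : `|h * (- 2 * c * J2)| <= 2 * A' * (M * I2) * h.
  rewrite normrM (gtr0_norm h0) mulrC ler_wpM2r ?(ltW h0)// normrM ler_pM//.
  exact: twoA.
have S3 : `|h * (c ^+ 2 * I2)| <= A' ^+ 2 * I2 * h.
  rewrite normrM (gtr0_norm h0) mulrC ler_wpM2r ?(ltW h0)// (ger0_norm (mulr_ge0 (sqr_ge0 c) I20)).
  by rewrite ler_wpM2r// sqA.
have S4 : `|h * (- 2 * m * J1)| <= 2 * A' * (M * I1) * h.
  rewrite normrM (gtr0_norm h0) mulrC ler_wpM2r ?(ltW h0)// normrM ler_pM//.
  exact: twoA.
have S5 : `|h * (m ^+ 2 * I0)| <= A' ^+ 2 * I0 * h.
  rewrite normrM (gtr0_norm h0) mulrC ler_wpM2r ?(ltW h0)// (ger0_norm (mulr_ge0 (sqr_ge0 m) I00)).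
  by rewrite ler_wpM2r// sqA.
rewrite mulrDl mul1r.
have -> : B * h = M * I2 * h + 2 * A' * (M * I2) * h + A' ^+ 2 * I2 * h + 2 * A' * (M * I1) * h + A' ^+ 2 * I0 * h.
  by rewrite /B; ring.
apply: (le_trans (lerD (lerD (lerD (lerD T1 S2) S3) S4) S5)).
by rewrite lerDl ltW.
Qed.

Lemma kernel_integral_bounded : exists2 M, 0 < M & forall h, 0 < h -> h <= e ->
  `|\int[Q]_(o in D) Kh h (X o)| <= M.
Proof.
have [M M0 hM] := kernel_mean_bounds.
have i1 : Q.-integrable D (EFin \o (fun o => (fun=> 1 : R) (Z o))) by exact: finite_measure_integrable_cst.
have I0 : 0 <= \int[Q]_(o in D) 1 by exact: Rintegral_ge0.
exists (M * (\int[Q]_(o in D) 1 + 1)); first by rewrite mulr_gt0// ltr_wpDl.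
move=> h h0 he; apply: (@le_trans _ _ (M * \int[Q]_(o in D) 1)); last by rewrite ler_wpM2l ?(ltW M0)//; lra.
have -> : \int[Q]_(o in D) Kh h (X o) = \int[Q]_(o in D) (kernel_mean h o * 1).
  rewrite -(int_Kh h0 (measurable_cst (1 : R)) i1).
  by apply: eq_Rintegral => o _; rewrite mulr1.
rewrite -RintegralZl//; apply: le_Rintegral_norm => //.
- exact: integrable_mulrl i1.
- by apply: measurable_funM => //; apply: measurable_funTS; exact: measurable_kernel_mean.
- by move=> o oD; rewrite !mulr1 ger0_norm ?kernel_mean_ge0//; case: (hM o h oD h0 he).
Qed.

Lemma score_integral_bounded : exists2 M, 0 < M & forall h c, 0 < h -> h <= e ->
  `|\int[Q]_(o in D) score h c o| <= M.
Proof.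
have [M M0 hM] := score_bias_le.
set z := \int[Q]_(o in D) (q a (Z o) * G (Z o)) in hM.
exists (M * e ^+ 2 + `|z|); first by rewrite ltr_pwDl// mulr_gt0// exprn_gt0.
move=> h c h0 he; rewrite -(subrK z (\int[Q]_(o in D) score h c o)).
apply: (le_trans (ler_normD _ _)); rewrite lerD2r; apply: (le_trans (hM h c h0 he)).
by rewrite ler_wpM2l ?(ltW M0)// lerXn2r// nnegrE ltW.
Qed.

(** As K_h <= MK / h, the normalised summand u is at most a constant times (|G| + 1) / sqrt(n h).
    Thus min(1, |u|) is bounded by a function [tau] of Z alone, which passes through the conditional
    mean of K_h^2; the remaining integral of G^2 [tau] tends to 0 by dominated convergence, with G^2
    as dominating function. *)
Lemma score_lindeberg (A k : R) (h_ c_ m_ : nat -> R) : (forall n, 0 < h_ n) ->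
  h_ n @[n --> \oo] --> 0 -> n%:R * h_ n @[n --> \oo] --> +oo ->
  (\forall n \near \oo, `|c_ n| <= A) -> (\forall n \near \oo, `|m_ n| <= A) ->
  n%:R * \int[Q]_(o in D) lindeberg_fun (Num.sqrt (h_ n / n%:R) * k * (score (h_ n) (c_ n) o - m_ n))
    @[n --> \oo] --> 0.
Proof.
move=> h0 hc nhc cA mA.
have [M M0 hM] := kernel_second_moment_le A.
pose A' := `|A|; have A'0 : 0 <= A' by exact: normr_ge0.
pose r n := (Num.sqrt (n%:R * h_ n))^-1.
have r0 n : 0 <= r n by rewrite invr_ge0 sqrtr_ge0.
pose B := `|k| * (MK + 2 * A' * e).
have B0 : 0 <= B by rewrite mulr_ge0// addr_ge0 ?(ltW MK0)// !mulr_ge0// ltW.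
pose tau n z := Num.min 1 (B * (`|G z| + 1) * r n).
have tau0 n z : 0 <= tau n z.
  rewrite le_min ler01/=; apply: mulr_ge0 => //; apply: mulr_ge0 => //; exact: addr_ge0.
have tau1 n z : tau n z <= 1 by rewrite ge_min lexx.
pose F n z := G z ^+ 2 * tau n z.
have mtau n : measurable_fun setT (tau n).
  apply: measurable_minr => //; apply: measurable_funM => //; apply: measurable_funM => //.
  by apply: measurable_funD => //; exact: measurableT_comp mG.
have mF n : measurable_fun setT (F n).
  by apply: measurable_funM => //; exact: measurable_funX.
have F0 n z : 0 <= F n z by rewrite mulr_ge0 ?sqr_ge0.
have iF n : Q.-integrable D (EFin \o (fun o => F n (Z o))).
  apply: (le_integrable_norm (g := fun o => G (Z o) ^+ 2)) => //.
    exact/measurable_funTS/(measurableT_comp (mF n) mZ).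
  by move=> o _; rewrite ger0_norm// ler_piMr ?sqr_ge0.
pose I0 := \int[Q]_(o in D) 1.
have rc : r n @[n --> \oo] --> 0 by exact: cvg_inv_sqrt.
have IFc : \int[Q]_(o in D) F n (Z o) @[n --> \oo] --> 0.
  rewrite (_ : 0 = \int[Q]_(o in D) (0 : R)); last first.
    by rewrite Rintegral_cst// mul0r.
  apply: (dominated_convergence_Rintegral (g := fun o => G (Z o) ^+ 2)) => //.
  - by move=> n; exact/measurable_funTS/(measurableT_comp (mF n) mZ).
  - apply: aeW => o _; rewrite /F -[X in _ --> X](mulr0 (G (Z o) ^+ 2)); apply: cvgMr.
    apply: (@squeeze_cvgr _ _ _ _ (fun=> 0) (fun n => B * (`|G (Z o)| + 1) * r n)).
    + by apply: nearW => n; rewrite tau0 ge_min lexx orbT.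
    + exact: cvg_cst.
    + by rewrite -[X in _ --> X](mulr0 (B * (`|G (Z o)| + 1))); apply: cvgMr.
  - by apply: aeW => o n _; rewrite ger0_norm// ler_piMr ?sqr_ge0.
apply: (@squeeze_cvgr _ _ _ _ (fun=> 0) (fun n => 2 * k ^+ 2 * (M * \int[Q]_(o in D) F n (Z o) + h_ n * (A' ^+ 2 * I0)))).
- near=> n.
  have n0 : (0 < n)%N by near: n; exists 1%N.
  have he : h_ n <= e.
    near: n; move/cvgrPdist_le : hc => /(_ _ e0); apply: filterS => n.
    by rewrite sub0r normrN gtr0_norm.
  have cn : `|c_ n| <= A by near: n.
  have mn : `|m_ n| <= A by near: n.
  have nR : 0 < n%:R :> R by rewrite ltr0n.
  set h := h_ n in he *; set c := c_ n in cn *; set m := m_ n in mn *.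
  have hn0 : 0 < h by exact: h0.
  have cA' : `|c| <= A' by exact: le_trans cn (ler_norm _).
  have mA' : `|m| <= A' by exact: le_trans mn (ler_norm _).
  set s := Num.sqrt (h / n%:R).
  have s2 : s ^+ 2 = h / n%:R by rewrite sqr_sqrtr// divr_ge0// ltW.
  have s0 : 0 <= s by exact: sqrtr_ge0.
  (* The normalisation sqrt(h / n) is h / sqrt(n h): its factor h cancels the 1 / h of the kernel
     bound. *)
  have sr : s = h * r n.
    have S0 : 0 < Num.sqrt (n%:R * h) by rewrite sqrtr_gt0 mulr_gt0.
    have sS : s * Num.sqrt (n%:R * h) = h.
      rewrite -sqrtrM ?divr_ge0 ?ltW// (_ : h / n%:R * (n%:R * h) = h ^+ 2).
        by rewrite sqrtr_sqr gtr0_norm.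
      by field; rewrite gt_eqF.
    by rewrite /r -/h -{1}sS mulfK// gt_eqF.
  have KcB o : `|scaled_kernel K h (X o - a) - c| <= MK / h + A'.
    apply: (le_trans (ler_normB _ _)); apply: lerD => //.
    by rewrite ger0_norm ?Kh_ge0 ?Kh_le.
  have minB o : Num.min 1 `|s * k * (score h c o - m)| <= tau n (Z o).
    rewrite /tau le_min ge_min lexx/= ge_min; apply/orP; right.
    rewrite !normrM (ger0_norm s0) sr.
    have scB : `|score h c o - m| <= (MK / h + A') * `|G (Z o)| + A'.
      apply: (le_trans (ler_normB _ _)); apply: lerD => //.
      by rewrite normrM ler_wpM2r.
    have hs : h * ((MK / h + A') * `|G (Z o)| + A') <= (MK + 2 * A' * e) * (`|G (Z o)| + 1).
      have -> : h * ((MK / h + A') * `|G (Z o)| + A') = (MK + h * A') * `|G (Z o)| + h * A'.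
        by field; rewrite gt_eqF.
      have hA : h * A' <= A' * e by rewrite mulrC ler_wpM2l.
      have Ae : 0 <= A' * e by rewrite mulr_ge0// ltW.
      have g0 := normr_ge0 (G (Z o)).
      have : (MK + h * A') * `|G (Z o)| <= (MK + 2 * A' * e) * `|G (Z o)|.
        by rewrite ler_wpM2r//; lra.
      by have := MK0; rewrite -/MK; lra.
    have := ler_wpM2l (mulr_ge0 (normr_ge0 k) (r0 n)) (le_trans (ler_wpM2l (ltW hn0) scB) hs).
    rewrite (_ : `|k| * r n * ((MK + 2 * A' * e) * (`|G (Z o)| + 1)) = B * (`|G (Z o)| + 1) * r n); last by rewrite /B; ring.
    by apply: le_trans; rewrite le_eqVlt; apply/orP; left; apply/eqP; ring.
  pose rhs o := 2 * k ^+ 2 * (h * ((scaled_kernel K h (X o - a) - c) ^+ 2 * F n (Z o))) + 2 * k ^+ 2 * (h * A' ^+ 2 * 1).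
  have lindB o : n%:R * lindeberg_fun (s * k * (score h c o - m)) <= rhs o.
    have min0 : 0 <= Num.min 1 `|s * k * (score h c o - m)| by rewrite le_min ler01/=.
    have -> : n%:R * lindeberg_fun (s * k * (score h c o - m)) =
       k ^+ 2 * h * ((score h c o - m) ^+ 2 * Num.min 1 `|s * k * (score h c o - m)|).
      by rewrite /lindeberg_fun !exprMn s2; field; rewrite gt_eqF.
    have -> : rhs o = k ^+ 2 * h * (2 * score h c o ^+ 2 * tau n (Z o) + 2 * A' ^+ 2).
      by rewrite /rhs /F /score; ring.
    apply: ler_wpM2l; first exact: mulr_ge0 (sqr_ge0 k) (ltW hn0).
    apply: (@le_trans _ _ ((2 * score h c o ^+ 2 + 2 * m ^+ 2) * Num.min 1 `|s * k * (score h c o - m)|)).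
      by rewrite ler_wpM2r//; have := sqr_ge0 (score h c o + m); lra.
    rewrite mulrDl; apply: lerD; first by rewrite ler_wpM2l// mulr_ge0// sqr_ge0.
    apply: (@le_trans _ _ (2 * m ^+ 2)); first by apply: ler_piMr; [exact: mulr_ge0 (ler0n _ 2) (sqr_ge0 m)|rewrite ge_min lexx].
    by rewrite ler_wpM2l// -(real_normK (num_real m)) lerXn2r// nnegrE.
  have i1 : Q.-integrable D (EFin \o (fun o => (scaled_kernel K h (X o - a) - c) ^+ 2 * F n (Z o))).
    apply: (integrableM_bounded (M := (MK / h + A') ^+ 2)) mD _ _ (iF n) => [|o _].
      by apply: measurable_funX; exact: measurable_funB.
    by rewrite normrX lerXn2r ?nnegrE// addr_ge0// divr_ge0// ltW.
  have i2 : Q.-integrable D (EFin \o (fun=> 1)) by exact: finite_measure_integrable_cst.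
  have i1' := integrable_mulrl (2 * k ^+ 2) mD (integrable_mulrl h mD i1).
  have i2' := integrable_mulrl (2 * k ^+ 2) mD (integrable_mulrl (h * A' ^+ 2) mD i2).
  have irhs : Q.-integrable D (EFin \o rhs) by exact: integrable_addr mD i1' i2'.
  have mu_ : measurable_fun D (fun o => lindeberg_fun (s * k * (score h c o - m))).
    apply: (measurableT_comp measurable_lindeberg_fun).
    by apply: measurable_funM => //; exact: measurable_funB.
  have iu : Q.-integrable D (EFin \o (fun o => lindeberg_fun (s * k * (score h c o - m)))).
    apply: le_integrable_norm irhs => // o _.
    rewrite (ger0_norm (lindeberg_fun_ge0 _)); apply: le_trans (lindB o).
    by rewrite ler_peMl ?lindeberg_fun_ge0// ler1n.
  apply/andP; split.
    by rewrite mulr_ge0// Rintegral_ge0// => o _; exact: lindeberg_fun_ge0.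
  rewrite -RintegralZl//; apply: (@le_trans _ _ (\int[Q]_(o in D) rhs o)).
    apply: le_Rintegral => //; exact: integrable_mulrl.
  rewrite /rhs RintegralD// (RintegralZl _ mD (integrable_mulrl h mD i1)) (RintegralZl _ mD (integrable_mulrl (h * A' ^+ 2) mD i2)).
  rewrite (RintegralZl _ mD i1) (RintegralZl _ mD i2) -mulrDr.
  apply: ler_wpM2l; first exact: mulr_ge0 (ler0n _ 2) (sqr_ge0 k).
  by rewrite -(mulrA h) lerD2r; exact: hM.
- exact: cvg_cst.
- rewrite (_ : 0 = 2 * k ^+ 2 * (M * 0 + 0 * (A' ^+ 2 * I0))); last by ring.
  by apply: cvgMr; apply: cvgD; [exact: cvgMr|exact: cvgMl].
Unshelve. all: by end_near.
Qed.

End kernel_population.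

(** * The population quantities on one level *)

Section target.
Context {R : realType} {m d : nat} (Q : probability (obs R m d) R).
Variables (Zs : set (d.-tuple R)) (p : R -> d.-tuple R -> 'I_m.+1 -> R).
Hypothesis hZs : {ae Q, forall o, Zs (oZ o)}.
Hypothesis hpL : forall l, 0 < pL Q l.
Hypothesis hp : is_cond_densityA Q Zs p.
Hypothesis hpos : {ae Q, forall o, forall x, interior (supportA Q) x -> 0 < pAL Q p x (oL o)}.
Variable pi : d.-tuple R -> 'I_m.+1 -> R.
Hypothesis hpi_meas : forall l, measurable_fun [set: d.-tuple R] (pi ^~ l).
Hypothesis hpi_L2 : (\int[Q]_o ((pi (oZ o) (oL o)) ^+ 2)%:E < +oo)%E.
Variables (a : R) (l : 'I_m.+1).
Hypothesis ha : interior (supportA Q) a.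
Variable K : R -> R.
Hypothesis hK : is_smoothing_kernel K.
Hypothesis hp2 : forall z l', Zs z -> twice_differentiable_at (fun x => p x z l') a.
Hypothesis hp2_unif : uniformly_second_order Zs p a.
Local Notation leb := (@lebesgue_measure R).

Definition level : set (obs R m d) := [set o | oL o = l].

Lemma measurable_oL : measurable_fun setT (@oL R m d).
Proof.
apply: (measurableT_comp (f := fst)) => //; exact: (measurableT_comp (f := fst)).
Qed.

Lemma measurable_oZ : measurable_fun setT (@oZ R m d).
Proof.
apply: (measurableT_comp (f := snd)) => //; exact: (measurableT_comp (f := fst)).
Qed.

Lemma measurable_oA : measurable_fun setT (@oA R m d).
Proof. exact: (measurableT_comp (f := snd)). Qed.

Lemma measurable_level : measurable level.
Proof. by rewrite -[level]setTI; exact: (measurable_oL measurableT (_ : measurable [set l])). Qed.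

Definition centered_weight (z : d.-tuple R) : R := pi z l - rho Q pi l.

Definition score (h : R) (o : obs R m d) : R :=
  (scaled_kernel K h (oA o - a) - gamma Q K h a l) * centered_weight (oZ o).

Definition score_mean_level (h : R) : R := condmeanL Q (score h) l.

(** [Zs] need not be measurable; [N] is a measurable null set off which Z lies in [Zs]. Integrals on
    the level are taken over [D], where the density hypotheses hold at every point. *)
Let N : set (obs R m d) := sval (cid hZs).
Let mN : measurable N. Proof. by rewrite /N; case: cid => /= ? []. Qed.
Let QN : Q N = 0%E. Proof. by rewrite /N; case: cid => /= ? []. Qed.
Let notN o : ~ N o -> Zs (oZ o).
Proof. by rewrite /N; case: cid => /= M [_ _ +] NM => /(_ o)/contra_notP; apply. Qed.

Let D := level `\` N.
Let mD : measurable D. Proof. exact: measurableD measurable_level mN. Qed.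

Let D_Zs o : D o -> Zs (oZ o). Proof. by case=> _ /notN. Qed.
Let D_l o : D o -> oL o = l. Proof. by case. Qed.

(** The integrand is arbitrary because the lemma is also applied to the second derivative of [p],
    whose measurability is not at hand. *)
Let aeD (f : obs R m d -> \bar R) : (\int[Q]_(o in level) f o = \int[Q]_(o in D) f o)%E.
Proof.
rewrite integral_mkcond [RHS]integral_mkcond; apply: eq_integral_ae.
exists N; split => // o /=; apply: contra_notP => oN; move=> _.
have e : (o \in level) = (o \in D).
  by apply/idP/idP; rewrite !inE; [move=> ol; split|case].
by rewrite !patchE e.
Qed.

Let RaeD (f : obs R m d -> R) : \int[Q]_(o in level) f o = \int[Q]_(o in D) f o.
Proof. by rewrite /Rintegral aeD. Qed.

Let QD : Q D = Q level.
Proof.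
have := aeD (fun=> 1%E); rewrite !integral_cst//; last exact: measurable_level.
by rewrite !mul1e.
Qed.

Let QDE : fine (Q D) = pL Q l. Proof. by rewrite QD. Qed.

(* The truncation only matters off [Zs], where [p] is not assumed to be nonnegative. *)
Let q (x : R) (z : d.-tuple R) : R := Num.max (p x z l) 0.

Let q0 x z : 0 <= q x z. Proof. by rewrite /q le_max lexx orbT. Qed.

Let qE x o : D o -> q x (oZ o) = p x (oZ o) l.
Proof. by move=> oD; rewrite /q max_l//; case: hp => _ + _ _; apply; exact: D_Zs. Qed.

Let mq : measurable_fun setT (fun xz : R * d.-tuple R => q xz.1 xz.2).
Proof. by apply: measurable_maxr => //; case: hp. Qed.

Let q1 o : D o -> (\int[leb]_x (q x (oZ o))%:E = 1)%E.
Proof.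
move=> oD; under eq_integral do rewrite qE//.
by case: hp => _ _ + _; apply; exact: D_Zs.
Qed.

Let hq (B : set R) (C : set (d.-tuple R)) : measurable B -> measurable C ->
  Q [set o | [/\ B (oA o), C (oZ o) & D o]] =
  (\int[Q]_(o in [set o | C (oZ o) /\ D o]) \int[leb]_(x in B) (q x (oZ o))%:E)%E.
Proof.
move=> mB mC.
pose E := [set o | [/\ B (oA o), C (oZ o) & oL o = l]].
have mE : measurable E.
  rewrite (_ : E = (oA @^-1` B) `&` ((oZ @^-1` C) `&` level)).
    apply: measurableI; first by rewrite -[X in measurable X]setTI; exact: measurable_oA.
    apply: measurableI; last exact: measurable_level.
    by rewrite -[X in measurable X]setTI; exact: measurable_oZ.
  by apply/seteqP; split => o; [case|move=> [? []]].
have -> : [set o | [/\ B (oA o), C (oZ o) & D o]] = E `\` N.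
  by apply/seteqP; split => o [] => [? ? []|[? ? ?] ?].
have QEN : Q (E `&` N) = 0%E.
  by apply/eqP; rewrite -measure_le0 -QN; apply: le_measure; rewrite ?inE//; exact: measurableI.
transitivity (Q E); first by rewrite (measureDI Q mE mN) -[LHS]adde0; congr (_ + _)%E; rewrite -QEN.
have [_ _ _ hpBC] := hp; rewrite (hpBC B C l mB mC).
rewrite integral_mkcond [RHS]integral_mkcond; apply: eq_integral_ae.
exists N; split => // o /=; apply: contra_notP => oN; move=> _.
have e : (o \in [set o | C (oZ o) /\ oL o = l]) = (o \in [set o | C (oZ o) /\ D o]).
  by apply/idP/idP; rewrite !inE/= => -[oC]; [move=> ol; split|case].
rewrite !patchE e; case: ifPn => //; rewrite inE/= => -[_ oD].
by apply: eq_integral => x _; rewrite qE.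
Qed.

Let d1 (o : obs R m d) : R := ((fun x : R => p x (oZ o) l)^`())%classic a.
Let d2 (o : obs R m d) : R := ((fun x : R => p x (oZ o) l)^`(2))%classic a.

Let C := sval (cid hp2_unif).
(** The radius of the uniform expansion, named because the later statements on small bandwidths
    refer to it. *)
Definition smooth_range : R := sval (cid (svalP (cid hp2_unif))).
Local Notation e := smooth_range.

Lemma smooth_range_gt0 : 0 < e.
Proof. by rewrite /smooth_range; case: (svalP (cid (svalP (cid hp2_unif)))). Qed.
Let e0 := smooth_range_gt0.

Let q_taylor o t : D o -> `|t| <= e -> `|q (a + t) (oZ o) - q a (oZ o) - d1 o * t| <= C * t ^+ 2.
Proof.
move=> oD te; rewrite !qE//.
by case: (svalP (cid (svalP (cid hp2_unif)))) => _ /(_ (oZ o) l t (D_Zs oD) te).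
Qed.

Let q_peano o eps : D o -> 0 < eps -> exists2 delta : R, 0 < delta &
  forall t, `|t| <= delta ->
    `|q (a + t) (oZ o) - q a (oZ o) - d1 o * t - d2 o / 2 * t ^+ 2| <= eps * t ^+ 2.
Proof.
move=> oD eps0; have [delta delta0 H] := taylor_peano2 eps0 (hp2 l (D_Zs oD)).
by exists delta => // t td; rewrite !qE//; exact: H.
Qed.

Let mpi : measurable_fun setT (fun o : obs R m d => pi (oZ o) l).
Proof. exact: measurableT_comp (hpi_meas l) measurable_oZ. Qed.

Let iPi2 : Q.-integrable D (EFin \o (fun o => pi (oZ o) l ^+ 2)).
Proof.
apply/integrableP; split.
  by apply/measurable_EFinP; apply: measurable_funTS; exact: measurable_funX.
apply: le_lt_trans hpi_L2.
have -> : (\int[Q]_(o in D) `|(EFin \o (fun o => (pi (oZ o) l ^+ 2)%R)) o| =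
    \int[Q]_(o in D) ((pi (oZ o) (oL o)) ^+ 2)%:E)%E.
  by apply: eq_integral => o /set_mem oD; rewrite /= ger0_norm ?sqr_ge0// D_l.
apply: ge0_subset_integral => //.
  apply/measurable_EFinP; apply: measurable_funX.
  (* Joint measurability in (z, l): a finite sum over the levels, each [pi ^~ l'] being
     measurable. *)
  rewrite (_ : (fun o => pi (oZ o) (oL o)) =
     (fun o : obs R m d => \sum_(l' < m.+1) (pi (oZ o) l' * \1_[set o | oL o = l'] o))).
    apply: measurable_sum => l'; apply: measurable_funM; first exact: measurableT_comp (hpi_meas l') measurable_oZ.
    apply: measurable_indic; rewrite -[X in measurable X]setTI.
    exact: (measurable_oL measurableT (_ : measurable [set l'])).
  apply/funext => o; rewrite (bigD1 (oL o))//= indicE mem_set// mulr1 big1 ?addr0// => i io.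
  by rewrite indicE memNset ?mulr0//= => oi; rewrite oi eqxx in io.
by move=> o _; rewrite lee_fin sqr_ge0.
Qed.

Let iPi : Q.-integrable D (EFin \o (fun o => pi (oZ o) l)).
Proof. by apply: integrable_of_sqr => //; exact: measurable_funTS. Qed.

Local Notation G := centered_weight.

Let mG : measurable_fun setT G.
Proof. exact: measurable_funB. Qed.

Let i1 (c : R) : Q.-integrable D (EFin \o (fun=> c)).
Proof. exact: finite_measure_integrable_cst. Qed.

Let iG : Q.-integrable D (EFin \o (fun o => G (oZ o))).
Proof. exact: integrable_subr. Qed.

Let iG2 : Q.-integrable D (EFin \o (fun o => G (oZ o) ^+ 2)).
Proof.
have := integrable_addr mD (integrable_addr mD iPi2 (integrable_mulrl (- 2 * rho Q pi l) mD iPi)) (i1 (rho Q pi l ^+ 2)).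
by apply: eq_integrable => // o _; congr EFin; rewrite /G; ring.
Qed.

Let pl := pL Q l.
Let pl0 : 0 < pl. Proof. exact: hpL. Qed.

Let I1 (c : R) : \int[Q]_(o in D) c = c * pl.
Proof. by rewrite Rintegral_cst// QDE. Qed.

Lemma centered_weight_centered : \int[Q]_(o in D) G (oZ o) = 0.
Proof.
rewrite /G RintegralB// I1 /rho /condmeanL -/level RaeD.
rewrite divfK ?gt_eqF//; apply/eqP; rewrite subr_eq0; apply/eqP.
by apply: eq_Rintegral => o /set_mem oD; rewrite D_l.
Qed.

Let bounds := kernel_mean_bounds mq q0 q1 e0 q_taylor hK.

Let m_qa : measurable_fun setT (fun o : obs R m d => q a (oZ o)).
Proof.
have h : measurable_fun setT (fun z : d.-tuple R => (a, z)) by apply: measurable_fun_pair.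
exact: (measurableT_comp (measurableT_comp mq h) measurable_oZ).
Qed.

Let i_qa (F : obs R m d -> R) : Q.-integrable D (EFin \o F) ->
  Q.-integrable D (EFin \o (fun o => q a (oZ o) * F o)).
Proof.
have [M M0 hM] := bounds.
apply: (integrableM_bounded (M := M)) mD _ _ => [|o oD]; first exact/measurable_funTS.
by rewrite ger0_norm//; case: (hM o e oD e0 (lexx _)).
Qed.

(** Otherwise all of [D] would lie in the null set excluded by [hpos], although the level has
    positive probability. *)
Let pA_gt0 : 0 < pAL Q p a l.
Proof.
apply: contrapT => pA.
suff : Q D = 0%E by move=> QD0; move: pl0; rewrite /pl -QDE QD0 ltxx.
have [M [mM QM HM]] := hpos.
apply/eqP; rewrite -measure_le0 -QM; apply: le_measure; rewrite ?inE// => o oD.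
apply: HM => /= H; apply: pA; rewrite -(D_l oD); exact: H.
Qed.

Let pAE : pAL Q p a l = (\int[Q]_(o in D) q a (oZ o)) / pl.
Proof.
rewrite /pAL /condmeanL -/level RaeD; congr (_ / _).
by apply: eq_Rintegral => o /set_mem oD; rewrite qE.
Qed.

(** The density in [zeta] cancels the denominator of Bayes' formula, leaving
    E[p(a | Z, l) (pi - rho) | L = l], the limit of the mean score. The cancellation is where
    [pA_gt0] enters. *)
Lemma zetaE : zeta Q p pi a l = (\int[Q]_(o in D) (q a (oZ o) * G (oZ o))) / pl.
Proof.
rewrite /zeta /kappa /condmeanAL mulrBr [_ * (_ / _)]mulrC divfK ?gt_eqF//.
rewrite pAE {1}/condmeanL -/level RaeD.
have -> : \int[Q]_(o in D) (pi (oZ o) l * p a (oZ o) l) = \int[Q]_(o in D) (q a (oZ o) * pi (oZ o) l).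
  by apply: eq_Rintegral => o /set_mem oD; rewrite qE// mulrC.
have -> : \int[Q]_(o in D) (q a (oZ o) * G (oZ o)) =
   \int[Q]_(o in D) (q a (oZ o) * pi (oZ o) l - rho Q pi l * (q a (oZ o) * 1)).
  by apply: eq_Rintegral => o _; rewrite /G; ring.
have iq := i_qa (i1 1).
rewrite RintegralB//; [|exact: i_qa|exact: integrable_mulrl].
rewrite RintegralZl// mulrBl; congr (_ - _).
have -> : \int[Q]_(o in D) (q a (oZ o) * 1) = \int[Q]_(o in D) q a (oZ o).
  by apply: eq_Rintegral => o _; rewrite mulr1.
by ring.
Qed.

Lemma sigma2_zetaE : sigma2_zeta Q p pi K a l =
  (\int[leb]_x (K x ^+ 2)) * (\int[Q]_(o in D) (q a (oZ o) * G (oZ o) ^+ 2)) / pl ^+ 2.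
Proof.
rewrite /sigma2_zeta /condmeanAL.
have -> : condmeanL Q (fun o => (pi (oZ o) l - rho Q pi l) ^+ 2 * p a (oZ o) l) l =
    (\int[Q]_(o in D) (q a (oZ o) * G (oZ o) ^+ 2)) / pl.
  rewrite /condmeanL -/level RaeD; congr (_ / _).
  by apply: eq_Rintegral => o /set_mem oD; rewrite qE// mulrC.
by rewrite -/pl; field; rewrite !gt_eqF.
Qed.

Lemma sigma2_zeta_ge0 : 0 <= sigma2_zeta Q p pi K a l.
Proof.
rewrite sigma2_zetaE divr_ge0 ?sqr_ge0// mulr_ge0//; apply: Rintegral_ge0 => x _; first exact: sqr_ge0.
by rewrite mulr_ge0// sqr_ge0.
Qed.

Lemma bias_zetaE h : bias_zeta Q p pi K h a l =
  h ^+ 2 * ((\int[Q]_(o in D) (d2 o * G (oZ o))) * (\int[leb]_x (K x * x ^+ 2)) / 2) / pl.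
Proof.
rewrite /bias_zeta.
have -> : condmeanL Q (fun o => ((fun x => p x (oZ o) (oL o))^`(2))%classic a *
                      (pi (oZ o) (oL o) - rho Q pi (oL o))) l =
   (\int[Q]_(o in D) (d2 o * G (oZ o))) / pl.
  rewrite /condmeanL -/level RaeD; congr (_ / _).
  by apply: eq_Rintegral => o /set_mem oD; rewrite D_l.
by field; rewrite gt_eqF.
Qed.

Lemma gammaE h : gamma Q K h a l = (\int[Q]_(o in D) scaled_kernel K h (oA o - a)) / pl.
Proof. by rewrite /gamma /condmeanL -/level RaeD. Qed.

Lemma score_mean_levelE h : score_mean_level h = (\int[Q]_(o in D) score h o) / pl.
Proof. by rewrite /score_mean_level /condmeanL -/level RaeD. Qed.

Let mA := measurable_oA. Let mZ := measurable_oZ.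
Let G0 := centered_weight_centered.

Lemma gamma_bounded : exists2 M, 0 < M & forall h, 0 < h -> h <= e -> `|gamma Q K h a l| <= M.
Proof.
have [M M0 hM] := kernel_integral_bounded mA mZ mD mq q0 hq q1 e0 q_taylor hK.
exists (M / pl); first by rewrite divr_gt0.
move=> h h0 he; rewrite gammaE normrM normfV (gtr0_norm pl0) ler_pM2r ?invr_gt0//.
exact: hM.
Qed.

Lemma score_mean_bounded : exists2 M, 0 < M & forall h, 0 < h -> h <= e -> `|score_mean_level h| <= M.
Proof.
have [M M0 hM] := score_integral_bounded mA mZ mD mq q0 hq q1 e0 q_taylor hK mG iG2 G0.
exists (M / pl); first by rewrite divr_gt0.
move=> h h0 he; rewrite score_mean_levelE normrM normfV (gtr0_norm pl0) ler_pM2r ?invr_gt0//.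
exact: hM.
Qed.

Lemma score_mean_bias : exists2 M, 0 < M & forall h, 0 < h -> h <= e ->
  `|score_mean_level h - zeta Q p pi a l| <= M * h ^+ 2.
Proof.
have [M M0 hM] := score_bias_le mA mZ mD mq q0 hq q1 e0 q_taylor hK mG iG2 G0.
exists (M / pl); first by rewrite divr_gt0.
move=> h h0 he; rewrite score_mean_levelE zetaE -mulrBl normrM normfV (gtr0_norm pl0).
rewrite mulrAC ler_pM2r ?invr_gt0//; exact: hM.
Qed.

Lemma score_mean_expansion (h : nat -> R) : (forall n, 0 < h n) -> h n @[n --> \oo] --> 0 ->
  (score_mean_level (h n) - zeta Q p pi a l - bias_zeta Q p pi K (h n) a l) / h n ^+ 2
    @[n --> \oo] --> 0.
Proof.
move=> h0 hc.
have H := score_bias_expansion mA mZ mD mq q0 hq q1 e0 q_taylor q_peano hK mG iG2 G0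
  (fun n => gamma Q K (h n) a l) h0 hc.
set L := _ / 2 in H.
have -> : (fun n => (score_mean_level (h n) - zeta Q p pi a l - bias_zeta Q p pi K (h n) a l) / h n ^+ 2)
  = (fun n => ((\int[Q]_(o in D) score (h n) o - \int[Q]_(o in D) (q a (oZ o) * G (oZ o))) / h n ^+ 2 - L) / pl).
  apply/funext => n; rewrite score_mean_levelE zetaE bias_zetaE -/L.
  by field; rewrite !gt_eqF.
rewrite -[X in _ --> X](mul0r pl^-1); apply: cvgMl.
by rewrite -(subrr L); apply: cvgB => //; exact: cvg_cst.
Qed.

Lemma score_variance (h : nat -> R) : (forall n, 0 < h n) -> h n @[n --> \oo] --> 0 ->
  h n * \int[Q]_(o in level) ((score (h n) o - score_mean_level (h n)) ^+ 2) / pl ^+ 2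
    @[n --> \oo] --> sigma2_zeta Q p pi K a l.
Proof.
move=> h0 hc.
have [M1 M10 hM1] := gamma_bounded; have [M2 M20 hM2] := score_mean_bounded.
have [B B0 hB] := score_variance_le mA mZ mD mq q0 hq q1 e0 q_taylor hK mG iG2 G0 (M1 + M2).
rewrite sigma2_zetaE; apply: cvgMl; rewrite -subr_cvg0.
have he : \forall n \near \oo, h n <= e.
  by move/cvgrPdist_le : hc => /(_ _ e0); apply: filterS => n; rewrite sub0r normrN gtr0_norm.
have Bh : B * h n @[n --> \oo] --> 0 by rewrite -[X in _ --> X](mulr0 B); apply: cvgMr.
apply: norm_cvg0; apply: (@squeeze_cvgr _ _ _ _ (fun=> 0) (fun n => B * h n)) => //; last exact: cvg_cst.
apply: filterS he => n he; rewrite normr_ge0/= RaeD; apply: hB => //.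
- by apply: (le_trans (hM1 _ (h0 n) he)); rewrite lerDl ltW.
- by apply: (le_trans (hM2 _ (h0 n) he)); rewrite lerDr ltW.
Qed.

(** Extension by 0 off the level: sums over the observations of the level become sums over the whole
    i.i.d. sample. *)
Definition on_level (f : obs R m d -> R) (o : obs R m d) : R := (oL o == l)%:R * f o.

Lemma on_levelE f : on_level f = f \_ level.
Proof.
apply/funext => o; rewrite /on_level patchE; case: ifPn; rewrite ?notin_setE/level ?inE/=.
  by move=> ->; rewrite eqxx mul1r.
by move=> /eqP/negPf ->; rewrite mul0r.
Qed.

Lemma Rintegral_on_level f : \int[Q]_o on_level f o = \int[Q]_(o in level) f o.
Proof. by rewrite on_levelE [RHS]Rintegral_mkcond. Qed.

Lemma measurable_on_level f : measurable_fun setT f -> measurable_fun setT (on_level f).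
Proof.
by move=> mf; rewrite on_levelE; apply/(measurable_restrictT _ measurable_level)/measurable_funTS.
Qed.

Let integrable_on_level f : measurable_fun setT f -> Q.-integrable D (EFin \o f) ->
  Q.-integrable setT (EFin \o on_level f).
Proof.
move=> mf iF; rewrite on_levelE.
have : Q.-integrable level (EFin \o f).
  apply/(negligible_integrable mN measurable_level) => //.
  by apply/measurable_EFinP; exact: measurable_funTS.
move/(integrable_mkcond _ measurable_level); apply: eq_integrable => // o _.
by rewrite /= !patchE; case: ifP.
Qed.

Lemma on_level_sqr f o : on_level f o ^+ 2 = on_level (fun o => f o ^+ 2) o.
Proof. by rewrite /on_level; case: eqP => _; rewrite ?mul1r// !mul0r expr0n. Qed.

Lemma Rintegral_on_level_sqr f : \int[Q]_o (on_level f o ^+ 2) = \int[Q]_(o in level) (f o ^+ 2).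
Proof. by rewrite -Rintegral_on_level; apply: eq_Rintegral => o _; exact: on_level_sqr. Qed.

Let integrable_on_level_sqr (f : obs R m d -> R) : measurable_fun setT f -> Q.-integrable D (EFin \o (fun o => f o ^+ 2)) ->
  Q.-integrable setT (EFin \o (fun o => on_level f o ^+ 2)).
Proof.
move=> mf if2; rewrite (_ : (fun o => _) = on_level (fun o => f o ^+ 2)).
  by apply: integrable_on_level => //; exact: measurable_funX.
by apply/funext => o; exact: on_level_sqr.
Qed.

(** With the two definitions below, the centered variables of the cross-fitting expansion: the
    weight and the kernel multiply the nuisance errors, the centered score is the oracle term. *)
Definition weight_on_level := on_level (fun o => G (oZ o)).
Definition kernel_on_level (h : R) :=
  on_level (fun o => scaled_kernel K h (oA o - a) - gamma Q K h a l).
Definition score_on_level (h : R) := on_level (fun o => score h o - score_mean_level h).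

Let mGZ : measurable_fun setT (fun o : obs R m d => G (oZ o)).
Proof. exact: measurableT_comp mG mZ. Qed.

Let mKA h : measurable_fun setT (fun o : obs R m d => scaled_kernel K h (oA o - a) - gamma Q K h a l).
Proof.
apply: measurable_funB => //; exact: measurableT_comp (measurable_scaled_kernel hK a h) mA.
Qed.

Let mscore h : measurable_fun setT (score h).
Proof. exact: measurable_funM. Qed.

Lemma measurable_weight_on_level : measurable_fun setT weight_on_level.
Proof. exact: measurable_on_level. Qed.

Lemma measurable_kernel_on_level h : measurable_fun setT (kernel_on_level h).
Proof. exact: measurable_on_level. Qed.

Lemma measurable_score_on_level h : measurable_fun setT (score_on_level h).
Proof. by apply: measurable_on_level; exact: measurable_funB. Qed.

Lemma weight_on_level_sqr : Q.-integrable setT (EFin \o (fun o => weight_on_level o ^+ 2)).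
Proof. exact: integrable_on_level_sqr. Qed.

Lemma weight_on_level_mean : \int[Q]_o weight_on_level o = 0.
Proof. by rewrite Rintegral_on_level RaeD. Qed.

Let KA_bounded h : 0 < h -> exists M : R, forall o : obs R m d,
  `|scaled_kernel K h (oA o - a) - gamma Q K h a l| <= M.
Proof.
move=> h0; have [M M0 KM] := kernel_bounded hK.
exists (M / h + `|gamma Q K h a l|) => o; apply: (le_trans (ler_normB _ _)); rewrite lerD2r.
by rewrite ger0_norm ?(scaled_kernel_ge0 hK)// /scaled_kernel ler_pM2r ?invr_gt0.
Qed.

Let iKA2 h : 0 < h ->
  Q.-integrable D (EFin \o (fun o => (scaled_kernel K h (oA o - a) - gamma Q K h a l) ^+ 2)).
Proof.
move=> /KA_bounded[M KM]; apply: (@bounded_integrable _ _ _ Q D _ (M ^+ 2)) => //.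
  by apply: measurable_funTS; exact: measurable_funX.
by move=> o _; rewrite normrX lerXn2r// nnegrE//; exact: le_trans (KM o).
Qed.

Let iKA h : 0 < h ->
  Q.-integrable D (EFin \o (fun o => scaled_kernel K h (oA o - a) - gamma Q K h a l)).
Proof. by move=> h0; apply: integrable_of_sqr; [exact: mD|exact: measurable_funTS|exact: iKA2]. Qed.

Lemma kernel_on_level_sqr h : 0 < h ->
  Q.-integrable setT (EFin \o (fun o => kernel_on_level h o ^+ 2)).
Proof. by move=> h0; apply: integrable_on_level_sqr => //; exact: iKA2. Qed.

Lemma kernel_on_level_mean h : 0 < h -> \int[Q]_o kernel_on_level h o = 0.
Proof.
move=> h0; rewrite Rintegral_on_level RaeD RintegralB//; last first.
  have := integrable_addr mD (iKA h0) (i1 (gamma Q K h a l)).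
  by apply: eq_integrable => // o _; rewrite /= subrK.
by rewrite I1 gammaE divfK ?subrr// gt_eqF.
Qed.

Lemma kernel_on_level_moment : exists2 M, 0 < M & forall h, 0 < h -> h <= e ->
  h * \int[Q]_o (kernel_on_level h o ^+ 2) <= M.
Proof.
have [M1 M10 hM1] := gamma_bounded.
have [M M0 hM] := kernel_second_moment_le mA mZ mD mq q0 hq q1 e0 q_taylor hK M1.
exists (M * pl); first exact: mulr_gt0.
move=> h h0 he; have := hM h (gamma Q K h a l) (fun=> 1) h0 he (hM1 h h0 he) (measurable_cst _) (fun _ => ler01) (i1 1).
rewrite I1 mul1r; apply: le_trans; rewrite ler_wpM2l ?(ltW h0)//.
rewrite Rintegral_on_level_sqr RaeD.
by rewrite le_eqVlt; apply/orP; left; apply/eqP; apply: eq_Rintegral => o _; rewrite mulr1.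
Qed.

Let iscore2 h : 0 < h -> Q.-integrable D (EFin \o (fun o => score h o ^+ 2)).
Proof.
move=> /KA_bounded[M KM].
have := @integrableM_bounded _ _ _ Q D (fun o => (scaled_kernel K h (oA o - a) - gamma Q K h a l) ^+ 2)
  (fun o => G (oZ o) ^+ 2) (M ^+ 2) mD.
rewrite (_ : (fun o => score h o ^+ 2) = (fun x => (scaled_kernel K h (oA x - a) - gamma Q K h a l) ^+ 2 * G (oZ x) ^+ 2)); last first.
  by apply/funext => o; rewrite /score exprMn.
apply => //; first by apply: measurable_funTS; exact: measurable_funX.
by move=> o _; rewrite normrX lerXn2r// nnegrE//; exact: le_trans (KM o).
Qed.

Let iscore h : 0 < h -> Q.-integrable D (EFin \o score h).
Proof. by move=> h0; apply: integrable_of_sqr; [exact: mD|exact: measurable_funTS|exact: iscore2]. Qed.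

Lemma score_on_level_sqr h : 0 < h ->
  Q.-integrable setT (EFin \o (fun o => score_on_level h o ^+ 2)).
Proof.
move=> h0; apply: integrable_on_level_sqr; first exact: measurable_funB.
have := integrable_addr mD (integrable_addr mD (iscore2 h0)
  (integrable_mulrl (- 2 * score_mean_level h) mD (iscore h0))) (i1 (score_mean_level h ^+ 2)).
by apply: eq_integrable => // o _; congr EFin; ring.
Qed.

Lemma score_on_level_mean h : 0 < h -> \int[Q]_o score_on_level h o = 0.
Proof.
move=> h0; rewrite Rintegral_on_level RaeD RintegralB//; last exact: iscore.
by rewrite I1 score_mean_levelE divfK ?subrr// gt_eqF.
Qed.

Lemma score_on_level_variance (h : nat -> R) : (forall n, 0 < h n) -> h n @[n --> \oo] --> 0 ->
  h n * \int[Q]_o (score_on_level (h n) o ^+ 2) / pl ^+ 2 @[n --> \oo] --> sigma2_zeta Q p pi K a l.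
Proof.
move=> h0 hc; have := score_variance h0 hc.
rewrite (eq_cvg _ _ (fun n => congr1 (fun x => h n * x / pl ^+ 2)
  (_ : \int[Q]_o (score_on_level (h n) o ^+ 2) = \int[Q]_(o in level) ((score (h n) o - score_mean_level (h n)) ^+ 2))))// => n.
exact: Rintegral_on_level_sqr.
Qed.

Lemma score_on_level_lindeberg (h : nat -> R) : (forall n, 0 < h n) -> h n @[n --> \oo] --> 0 ->
  n%:R * h n @[n --> \oo] --> +oo ->
  n%:R * \int[Q]_o lindeberg_fun (Num.sqrt (h n / n%:R) * pl^-1 * score_on_level (h n) o)
    @[n --> \oo] --> 0.
Proof.
move=> h0 hc nhc.
have [M1 M10 hM1] := gamma_bounded; have [M2 M20 hM2] := score_mean_bounded.
have he : \forall n \near \oo, h n <= e.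
  by move/cvgrPdist_le : hc => /(_ _ e0); apply: filterS => n; rewrite sub0r normrN gtr0_norm.
have b1 : \forall n \near \oo, `|gamma Q K (h n) a l| <= M1 + M2.
  by apply: filterS he => n he; apply: (le_trans (hM1 _ (h0 n) he)); rewrite lerDl ltW.
have b2 : \forall n \near \oo, `|score_mean_level (h n)| <= M1 + M2.
  by apply: filterS he => n he; apply: (le_trans (hM2 _ (h0 n) he)); rewrite lerDr ltW.
have := score_lindeberg mA mZ mD mq q0 hq q1 e0 q_taylor hK mG iG2 pl^-1 h0 hc nhc b1 b2.
apply: cvg_trans; apply: near_eq_cvg; apply: nearW => n; congr (_ * _).
rewrite -RaeD -Rintegral_on_level; apply: eq_Rintegral => o _.
rewrite /score_on_level /on_level; case: eqP => _; rewrite ?mul1r// !mul0r mulr0.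
by rewrite /lindeberg_fun expr0n mul0r.
Qed.

Lemma level_mean : \int[Q]_o on_level (fun=> 1) o = pl.
Proof. by rewrite Rintegral_on_level RaeD I1 mul1r. Qed.

End target.

(** * Cross-fitting *)

Section random_partition.
Context d (T : measurableType d) (R : realType) (P : probability T R).

Lemma prob_partition (I : finType) (F : T -> I) (E : set T) :
  (forall i, measurable [set w | F w = i]) -> measurable E ->
  P E = (\sum_(i : I) P ([set w | F w = i] `&` E))%E.
Proof.
move=> mF mE.
have {1}-> : E = \bigcup_(i in [set: I]) ([set w | F w = i] `&` E).
  by apply/seteqP; split => [w Ew|w [i _ []]//]; exists (F w).
rewrite measure_fin_bigcup//.
- have -> : [set: I] = [set` enum I] by apply/seteqP; split => i _ //=; rewrite mem_enum.
  by rewrite -fsbig_seq ?enum_uniq// big_enum.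
- exact: finite_finset.
- by apply/trivIsetP => i j _ _ ij; apply/seteqP; split => // w [[/= wi _] [/= wj _]]; rewrite -wi -wj eqxx in ij.
- by move=> i _; exact: measurableI.
Qed.

(** The estimates involve a random partition; splitting over its finitely many values reduces
    measurability to each fixed one. *)
Lemma measurable_fun_partition (I : finType) (F : T -> I) (g : I -> T -> R) :
  (forall i, measurable [set w | F w = i]) -> (forall i, measurable_fun setT (g i)) ->
  measurable_fun setT (fun w => g (F w) w).
Proof.
move=> mF mg.
rewrite (_ : (fun w => _) = (fun w => \sum_(i : I) (\1_[set w | F w = i] w * g i w))).
  by apply: measurable_sum => i; apply: measurable_funM => //; exact: measurable_indic.
apply/funext => w; rewrite (bigD1 (F w))//= indicE mem_set// mul1r big1 ?addr0// => i iw.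
by rewrite indicE memNset ?mul0r//= => wi; rewrite wi eqxx in iw.
Qed.

Context d' (U : measurableType d') (Q : probability U R) (X : nat -> T -> U).
Hypothesis mX : forall i, measurable_fun setT (X i).
Hypothesis iid : forall n (B : 'I_n -> set U), (forall i, measurable (B i)) ->
  P (\bigcap_(i in [set: 'I_n]) (X i @^-1` B i)) = (\prod_(i < n) Q (B i))%E.
Variables (Kf : nat) (fold : forall n, T -> {ffun 'I_n -> 'I_Kf}).
Hypothesis mfold : forall n f, measurable [set w | fold n w = f].
Hypothesis fold_indep : forall n f (B : 'I_n -> set U), (forall i, measurable (B i)) ->
  P ([set w | fold n w = f] `&` \bigcap_(i in [set: 'I_n]) (X i @^-1` B i)) =
  (P [set w | fold n w = f] * P (\bigcap_(i in [set: 'I_n]) (X i @^-1` B i)))%E.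

Definition fold_sum (u : U -> R) (k : 'I_Kf) n (w : T) : R :=
  \sum_(i < n) (fold n w i == k)%:R * u (X i w).

Lemma measurable_fold_sum u k n : measurable_fun setT u -> measurable_fun setT (fold_sum u k n).
Proof.
move=> mu; apply: (measurable_fun_partition (F := fold n)
  (g := fun f w => \sum_(i < n) (f i == k)%:R * u (X i w))) => f; first exact: mfold.
by apply: measurable_sum => i; apply: measurable_funM => //; exact: (measurableT_comp mu (mX i)).
Qed.

(* Conditionally on the folds, a fold sum is a sum of i.i.d. terms with weights 0 or 1. *)
Lemma fold_sum_tail (u : U -> R) k n (s : R) : measurable_fun setT u ->
  Q.-integrable setT (EFin \o (fun z => u z ^+ 2)) -> \int[Q]_z u z = 0 -> 0 < s ->
  (P [set w | (s < `|fold_sum u k n w|)%R] <= (n%:R * (\int[Q]_z (u z ^+ 2)) / s ^+ 2)%:E)%E.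
Proof.
move=> mu u2 u0 s0; set V := n%:R * _ / _.
have V0 : 0 <= V.
  by rewrite divr_ge0 ?sqr_ge0// mulr_ge0//; apply: Rintegral_ge0 => z _; exact: sqr_ge0.
have mS : measurable [set w | (s < `|fold_sum u k n w|)%R].
  by apply: measurable_gt_norm; exact: measurable_fold_sum.
rewrite (prob_partition (F := fold n) (mfold (n := n)) mS).
apply: (@le_trans _ _ (\sum_(f : {ffun 'I_n -> 'I_Kf}) (P [set w | fold n w = f] * V%:E))%E).
  apply: lee_sum => f _.
  (* [weighted_sum] takes weights indexed by nat; past the first n indices the value 0 respects the
     bound 1. *)
  pose c (j : nat) : R := if insub j is Some i then (f i == k)%:R else 0.
  have cE (i : 'I_n) : c i = (f i == k)%:R by rewrite /c valK.
  have c1 i : `|c i| <= 1.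
    by rewrite /c; case: insubP => [j _ _|_]; rewrite ?normr0// normr_nat lern1 leq_b1.
  pose h (t : n.-tuple U) : R := \sum_(i < n) (f i == k)%:R * u (tnth t i).
  have mh : measurable_fun setT h.
    apply: measurable_sum => i; apply: measurable_funM => //.
    by apply: (measurableT_comp mu); exact: measurable_tnth.
  have hE w : h (tuple_of X n w) = weighted_sum X u c n w.
    by apply: eq_bigr => i _; rewrite tnth_mktuple cE.
  have mE := measurable_gt_norm s mh.
  have -> : [set w | fold n w = f] `&` [set w | (s < `|fold_sum u k n w|)%R] =
    [set w | fold n w = f] `&` tuple_of X n @^-1` [set t | s < `|h t|].
    apply/seteqP; split => w [/= fw]; rewrite /fold_sum fw => H; split => //=; move: H;
      (rewrite /h; congr (_ < `|_|); apply: eq_bigr => i _; rewrite tnth_mktuple//).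
  have c0 : 0 <= fine (P [set w | fold n w = f]) by rewrite fine_ge0.
  have cfE : (NngNum c0)%:num%:E = P [set w | fold n w = f] by rewrite /= fineK// fin_num_measure.
  rewrite (@event_indep_tuple _ _ _ P _ _ X mX _ (NngNum c0) n (mfold f) _ _ mE); last first.
    by move=> B mB; rewrite cfE; exact: fold_indep.
  rewrite cfE; apply: lee_wpmul2l => //.
  have -> : tuple_of X n @^-1` [set t | s < `|h t|] = [set w | s < `|weighted_sum X u c n w|].
    by apply/seteqP; split => w /=; rewrite hE.
  have [S2 S2le] := weighted_sum_sqr mX iid mu c1 u2 u0 n.
  apply: markov_sqr => //; first exact: measurable_weighted_sum.
  by rewrite EFin_Rintegral// lee_fin.
rewrite -ge0_sume_distrl//.
have <- : P setT = (\sum_(f : {ffun 'I_n -> 'I_Kf}) P [set w | fold n w = f])%E.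
  rewrite (prob_partition (F := fold n) (mfold (n := n)) measurableT); by apply: eq_bigr => f _; rewrite setIT.
by rewrite (_ : P setT = 1%E) ?mul1e//; exact: probability_setT.
Qed.

Lemma fold_sum_tight (u : nat -> U -> R) k (C : R) :
  (forall n, measurable_fun setT (u n)) ->
  (forall n, Q.-integrable setT (EFin \o (fun z => u n z ^+ 2))) ->
  (forall n, \int[Q]_z u n z = 0) ->
  (\forall n \near \oo, \int[Q]_z (u n z ^+ 2) <= C) ->
  tight P (fun n w => fold_sum (u n) k n w / Num.sqrt n%:R).
Proof.
move=> mu u2 u0 uC del del0.
have C1 : 0 < `|C| + 1 by rewrite ltr_wpDl.
set M := Num.sqrt ((`|C| + 1) / del).
have M0 : 0 < M by rewrite sqrtr_gt0 divr_gt0.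
exists M => //; near=> n.
have n0 : 0 < Num.sqrt n%:R :> R by rewrite sqrtr_gt0 ltr0n; near: n; exists 1%N.
have -> : [set w | M < `|fold_sum (u n) k n w / Num.sqrt n%:R|] = [set w | M * Num.sqrt n%:R < `|fold_sum (u n) k n w|].
  by apply/seteqP; split => w /=; rewrite normrM normfV (gtr0_norm n0) ltr_pdivlMr.
apply: (le_trans (fold_sum_tail k n (mu n) (u2 n) (u0 n) (mulr_gt0 M0 n0))).
have nR : 0 < n%:R :> R by rewrite -sqrtr_gt0.
have Cd : 0 <= (`|C| + 1) / del by rewrite divr_ge0 ?(ltW C1) ?(ltW del0).
rewrite lee_fin exprMn !sqr_sqrtr ?ler0n//.
have uCn : \int[Q]_z (u n z ^+ 2) <= C by near: n.
have -> : n%:R * \int[Q]_z (u n z ^+ 2) / ((`|C| + 1) / del * n%:R) =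
    del * (\int[Q]_z (u n z ^+ 2) / (`|C| + 1)) by field; rewrite !gt_eqF.
rewrite ler_piMr ?(ltW del0)// ler_pdivrMr// mul1r.
by apply: (le_trans uCn); apply: (le_trans (ler_norm C)); rewrite lerDl.
Unshelve. all: by end_near.
Qed.

End random_partition.

Section stochastic_order_eq.
Context d (T : measurableType d) (R : realType) (P : probability T R).
Implicit Types X Y : nat -> T -> R.

Lemma near_eq_cvg_prob0 X Y : (\forall n \near \oo, forall w, X n w = Y n w) ->
  cvg_prob0 P X -> cvg_prob0 P Y.
Proof.
move=> XY X0 e del e0 del0; apply: filterS2 XY (X0 _ _ e0 del0) => n XY.
by rewrite (funext XY).
Qed.

Lemma eq_cvg_prob0 X Y : (forall n w, X n w = Y n w) -> cvg_prob0 P X -> cvg_prob0 P Y.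
Proof. by move=> XY; apply: near_eq_cvg_prob0; apply: nearW. Qed.

Lemma eq_tight X Y : (forall n w, X n w = Y n w) -> tight P X -> tight P Y.
Proof. by move=> XY; have -> : X = Y by apply/funext => n; exact: funext. Qed.

Lemma cvg_prob0N X : cvg_prob0 P X -> cvg_prob0 P (fun n w => - X n w).
Proof.
move=> X0 e del e0 del0; have := X0 _ _ e0 del0; apply: filterS => n.
by under eq_set do rewrite -normrN.
Qed.

End stochastic_order_eq.

Section cross_fitting.
Context d (T : measurableType d) (R : realType) (P : probability T R).
Context d' (U : measurableType d') (Q : probability U R) (X : nat -> T -> U).
Hypothesis mX : forall i, measurable_fun setT (X i).
Hypothesis iid : forall n (B : 'I_n -> set U), (forall i, measurable (B i)) ->
  P (\bigcap_(i in [set: 'I_n]) (X i @^-1` B i)) = (\prod_(i < n) Q (B i))%E.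
Variables (Kf : nat) (fold : forall n, T -> {ffun 'I_n -> 'I_Kf}).
Hypothesis mfold : forall n f, measurable [set w | fold n w = f].
Hypothesis fold_indep : forall n f (B : 'I_n -> set U), (forall i, measurable (B i)) ->
  P ([set w | fold n w = f] `&` \bigcap_(i in [set: 'I_n]) (X i @^-1` B i)) =
  (P [set w | fold n w = f] * P (\bigcap_(i in [set: 'I_n]) (X i @^-1` B i)))%E.
Variables (h : nat -> R) (h_gt0 : forall n, 0 < h n).
Variables (ind eta : U -> R) (xi om : nat -> U -> R) (pl : R).
Hypothesis ind01 : forall z, ind z = 0 \/ ind z = 1.
Hypothesis m_ind : measurable_fun setT ind.
Hypothesis pl_gt0 : 0 < pl.
Hypothesis ind_mean : \int[Q]_z ind z = pl.
Hypothesis m_eta : measurable_fun setT eta.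
Hypothesis eta_sqr : Q.-integrable setT (EFin \o (fun z => eta z ^+ 2)).
Hypothesis eta_mean : \int[Q]_z eta z = 0.
Hypothesis m_xi : forall n, measurable_fun setT (xi n).
Hypothesis xi_sqr : forall n, Q.-integrable setT (EFin \o (fun z => xi n z ^+ 2)).
Hypothesis xi_mean : forall n, \int[Q]_z xi n z = 0.
Hypothesis m_om : forall n, measurable_fun setT (om n).
Hypothesis om_sqr : forall n, Q.-integrable setT (EFin \o (fun z => om n z ^+ 2)).
Hypothesis om_mean : forall n, \int[Q]_z om n z = 0.
Variable C : R.
Hypothesis xi_moment : \forall n \near \oo, h n * \int[Q]_z (xi n z ^+ 2) <= C.
Hypothesis om_moment : \forall n \near \oo, h n * \int[Q]_z (om n z ^+ 2) <= C.
Variables (mu : nat -> R) (g r : nat -> 'I_Kf -> T -> R).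
Hypothesis mg : forall n k, measurable_fun setT (g n k).
Hypothesis mr : forall n k, measurable_fun setT (r n k).
Hypothesis g_cvg : forall k, cvg_prob0 P (fun n w => Num.sqrt (h n) * g n k w).
Hypothesis r_cvg : forall k, cvg_prob0 P (fun n => r n k).
Hypothesis gr_cvg : forall k, cvg_prob0 P (fun n w => Num.sqrt (n%:R * h n) * (g n k w * r n k w)).

Definition level_count n w : R := \sum_(i < n) ind (X i w).

(** The estimator with its scores expanded, in abstract form: [ind], [eta], [xi] and [om] are the
    level indicator, the centered weight, the centered kernel and the centered score, [mu] is the
    mean score, [g] and [r] are the nuisance errors. *)
Definition crossfit_mean n w : R := (level_count n w)^-1 *
  \sum_(i < n) (om n (X i w) + mu n * ind (X i w) - g n (fold n w i) w * eta (X i w)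
    - r n (fold n w i) w * xi n (X i w) + g n (fold n w i) w * r n (fold n w i) w * ind (X i w)).

(** The random count of the level is replaced by n pl, whence the factor sqrt(n h) / (n pl) = sqrt(h
    / n) / pl. *)
Definition oracle_sum n w : R :=
  weighted_sum X (fun z => Num.sqrt (h n / n%:R) * pl^-1 * om n z) (fun=> 1) n w.

Let fs (u : U -> R) k n w := fold_sum X fold u k n w.

Lemma sum_by_fold n w (c : 'I_Kf -> R) (u : U -> R) :
  \sum_(i < n) c (fold n w i) * u (X i w) = \sum_k c k * fs u k n w.
Proof.
rewrite /fs /fold_sum; under [RHS]eq_bigr do rewrite mulr_sumr.
rewrite exchange_big/=; apply: eq_bigr => i _.
rewrite (bigD1 (fold n w i))//= eqxx mul1r big1 ?addr0// => k /negPf ki.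
by rewrite eq_sym ki mul0r mulr0.
Qed.

Lemma measurable_level_count n : measurable_fun setT (level_count n).
Proof. by apply: measurable_sum => i; exact: (measurableT_comp m_ind (mX i)). Qed.

Let inv n w := n%:R / level_count n w.

Let minv : measurable_seq inv.
Proof.
move=> n; apply: measurable_funM => //.
exact: (measurableT_comp (@measurable_invr R) (measurable_level_count n)).
Qed.

Lemma level_frequency : cvg_prob0 P (fun n w => level_count n w / n%:R - pl).
Proof.
have mu_ : measurable_fun setT (fun z => ind z - pl) by exact: measurable_funB.
have ind_int : Q.-integrable setT (EFin \o ind).
  apply: (@bounded_integrable _ _ _ Q setT _ 1) => // z _.
  by case: (ind01 z) => ->; rewrite ?normr0 ?normr1.
have cint : Q.-integrable setT (EFin \o (fun=> pl)) by exact: finite_measure_integrable_cst.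
have B z : `|(ind z - pl) ^+ 2| <= (1 + pl) ^+ 2.
  rewrite normrX lerXn2r ?nnegrE//; first by rewrite addr_ge0// ltW.
  apply: (le_trans (ler_normB _ _)); rewrite (gtr0_norm pl_gt0) lerD2r.
  by case: (ind01 z) => ->; rewrite ?normr0 ?normr1.
have u2 : Q.-integrable setT (EFin \o (fun z => (ind z - pl) ^+ 2)).
  by apply: (@bounded_integrable _ _ _ Q setT _ ((1 + pl) ^+ 2)) => //; exact: measurable_funX.
have u0 : \int[Q]_z (ind z - pl) = 0.
  by rewrite RintegralB// ind_mean Rintegral_prob_cst subrr.
have uB : \int[Q]_z ((ind z - pl) ^+ 2) <= (1 + pl) ^+ 2.
  rewrite -[leRHS](Rintegral_prob_cst Q); apply: le_Rintegral => //.
    exact: finite_measure_integrable_cst.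
  by move=> z _; exact: le_trans (ler_norm _) (B z).
have c1 (i : nat) : `|1 : R| <= 1 by rewrite normr1.
apply: (@cvg_prob0_sqr _ _ _ _ _ (fun n => (1 + pl) ^+ 2 * n%:R^-1)).
- by move=> n; apply: measurable_funB => //; apply: measurable_funM => //; exact: measurable_level_count.
- by rewrite -[X in _ --> X](mulr0 ((1 + pl) ^+ 2)); apply: cvgMr;
    rewrite -(cvg_shiftS (fun n => n%:R^-1 : R)); exact: cvg_harmonic.
exists 1%N => // n /= n0.
have nR : 0 < n%:R :> R by rewrite ltr0n.
have [S2 S2le] := weighted_sum_sqr mX iid mu_ c1 u2 u0 n.
have E w : level_count n w / n%:R - pl = n%:R^-1 * weighted_sum X (fun z => ind z - pl) (fun=> 1) n w.
  rewrite /weighted_sum; under eq_bigr do rewrite mul1r.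
  rewrite sumrB sumr_const card_ord -[pl *+ n]mulr_natl /level_count.
  by field; rewrite gt_eqF.
under eq_integral do rewrite E exprMn.
have S2' := integrable_mulrl (n%:R^-1 ^+ 2) measurableT S2.
rewrite EFin_Rintegral// lee_fin RintegralZl//.
apply: (@le_trans _ _ (n%:R^-1 ^+ 2 * (n%:R * (1 + pl) ^+ 2))).
  by rewrite ler_wpM2l ?sqr_ge0// (le_trans S2le)// ler_wpM2l.
by rewrite le_eqVlt; apply/orP; left; apply/eqP; field; rewrite gt_eqF.
Qed.

Let inv_cvg : cvg_prob0 P (fun n w => inv n w - pl^-1).
Proof.
have mf : measurable_seq (fun n w => level_count n w / n%:R).
  by move=> n; apply: measurable_funM => //; exact: measurable_level_count.
by apply: eq_cvg_prob0 (cvg_prob0_inv mf pl_gt0 level_frequency) => n w; rewrite invf_div.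
Qed.

Let inv_tight : tight P inv.
Proof.
have h2 : tight P (fun _ _ => pl^-1) by apply: (@tight_cst _ _ _ _ _ (`|pl^-1|)); exact: nearW.
apply: eq_tight (tightD _ _ (cvg_prob0_tight inv_cvg) h2) => [n w|n|n//]; first by rewrite subrK.
exact: measurable_funB.
Qed.

Let S n w := weighted_sum X (om n) (fun=> 1) n w.

Let mS n : measurable_fun setT (S n). Proof. exact: (measurable_weighted_sum mX (fun=> 1) (m_om n)). Qed.

Let S_tight : tight P (fun n w => Num.sqrt (h n) * (S n w / Num.sqrt n%:R)).
Proof.
apply: (@tight_sqr _ _ _ _ _ C) => [n|].
  by apply: measurable_funM => //; exact: measurable_funM.
have n1 : \forall n \near \oo, (0 < n)%N by exists 1%N.
apply: filterS2 om_moment n1 => n omC n0.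
have nR : 0 < n%:R :> R by rewrite ltr0n.
have c1 (i : nat) : `|1 : R| <= 1 by rewrite normr1.
have [S2 S2le] := weighted_sum_sqr mX iid (m_om n) c1 (om_sqr n) (om_mean n) n.
have E w : (Num.sqrt (h n) * (S n w / Num.sqrt n%:R)) ^+ 2 = h n / n%:R * S n w ^+ 2.
  by rewrite !exprMn exprVn !sqr_sqrtr ?(ltW nR) ?(ltW (h_gt0 n))//; ring.
under eq_integral do rewrite E.
have S2' := integrable_mulrl (h n / n%:R) measurableT S2.
rewrite EFin_Rintegral// lee_fin RintegralZl//; apply: le_trans omC.
have -> : h n * \int[Q]_z (om n z ^+ 2) = h n / n%:R * (n%:R * \int[Q]_z (om n z ^+ 2)).
  by field; rewrite gt_eqF.
by rewrite ler_wpM2l// divr_ge0// ltW.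
Qed.

Lemma oracle_sumE n w : (0 < n)%N ->
  oracle_sum n w = Num.sqrt (h n) * (S n w / Num.sqrt n%:R) * pl^-1.
Proof.
move=> n0; rewrite /oracle_sum /S /weighted_sum.
rewrite sqrtrM ?(ltW (h_gt0 n))// sqrtrV//.
under eq_bigr do rewrite mul1r; under [in RHS]eq_bigr do rewrite mul1r.
by rewrite -mulr_sumr; ring.
Qed.

Lemma measurable_oracle_sum n : measurable_fun setT (oracle_sum n).
Proof.
have mu_ : measurable_fun setT (fun z => Num.sqrt (h n / n%:R) * pl^-1 * om n z) by exact: measurable_funM.
exact: (measurable_weighted_sum mX (fun=> 1) mu_).
Qed.

Lemma oracle_sum_tight : tight P oracle_sum.
Proof.
have h2 : tight P (fun _ _ => pl^-1) by apply: (@tight_cst _ _ _ _ _ (`|pl^-1|)); exact: nearW.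
have mSS n : measurable_fun setT (fun w => Num.sqrt (h n) * (S n w / Num.sqrt n%:R)).
  by apply: measurable_funM => //; exact: measurable_funM.
apply: le_tight (tightM _ _ S_tight h2) => //.
- exact: measurable_oracle_sum.
- by move=> n; exact: measurable_funM.
- by exists 1%N => // n /= n0 w; rewrite oracle_sumE.
Qed.

(** Each of [E0] to [E3] is bracketed as a factor tending to 0 in probability times a tight one. In
    [E2] the factor sqrt(h) is moved into the sum, since h E[xi^2] is what stays bounded. *)
Let E1 k n w := Num.sqrt (h n) * g n k w * (fs eta k n w / Num.sqrt n%:R * inv n w).
Let E2 k n w := r n k w * (fs (fun z => Num.sqrt (h n) * xi n z) k n w / Num.sqrt n%:R * inv n w).
Let E3 k n w := Num.sqrt (n%:R * h n) * (g n k w * r n k w) * (fs ind k n w * (level_count n w)^-1).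
Let E0 n w := (inv n w - pl^-1) * (Num.sqrt (h n) * (S n w / Num.sqrt n%:R)).
Let E4 n w := Num.sqrt (n%:R * h n) * (mu n * ((level_count n w)^-1 * level_count n w - 1)).

Let mfs u k n : measurable_fun setT u -> measurable_fun setT (fs u k n).
Proof. by move=> mu_; exact: (measurable_fold_sum mX mfold). Qed.

Let mlci n : measurable_fun setT (fun w => (level_count n w)^-1).
Proof. exact: (measurableT_comp (@measurable_invr R) (measurable_level_count n)). Qed.

Let mE1 k : measurable_seq (E1 k).
Proof. by move=> n; apply: measurable_funM; do ?apply: measurable_funM => //; exact: mfs. Qed.

Let mE2 k : measurable_seq (E2 k).
Proof.
move=> n; apply: measurable_funM => //; apply: measurable_funM => //; apply: measurable_funM => //.
by apply: mfs; exact: measurable_funM.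
Qed.

Let mE3 k : measurable_seq (E3 k).
Proof. by move=> n; apply: measurable_funM; do ?apply: measurable_funM => //; exact: mfs. Qed.

Let mE0 : measurable_seq E0.
Proof.
move=> n; apply: measurable_funM; first exact: measurable_funB.
by apply: measurable_funM => //; exact: measurable_funM.
Qed.

Let mE4 : measurable_seq E4.
Proof.
move=> n; apply: measurable_funM => //; apply: measurable_funM => //; apply: measurable_funB => //.
by apply: measurable_funM => //; exact: measurable_level_count.
Qed.

Let E1_cvg k : cvg_prob0 P (E1 k).
Proof.
apply: cvg_prob0M (g_cvg k) _ => [n|n|].
- exact: measurable_funM.
- by apply: measurable_funM => //; apply: measurable_funM => //; exact: mfs.
apply: tightM inv_tight => // [n|].
  by apply: measurable_funM => //; exact: mfs.
have := @fold_sum_tight _ _ _ P _ _ Q X mX iid Kf fold mfold fold_indep (fun=> eta) k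
  (\int[Q]_z (eta z ^+ 2)) (fun=> m_eta) (fun=> eta_sqr) (fun=> eta_mean).
by apply; exact: nearW.
Qed.

Let E2_cvg k : cvg_prob0 P (E2 k).
Proof.
have mx n : measurable_fun setT (fun z => Num.sqrt (h n) * xi n z) by exact: measurable_funM.
apply: cvg_prob0M (r_cvg k) _ => [n//|n|].
  by apply: measurable_funM => //; apply: measurable_funM => //; exact: mfs.
apply: tightM inv_tight => // [n|].
  by apply: measurable_funM => //; exact: mfs.
have sqE n : (fun z => (Num.sqrt (h n) * xi n z) ^+ 2) = (fun z => h n * xi n z ^+ 2).
  by apply/funext => z; rewrite exprMn sqr_sqrtr// ltW.
apply: (@fold_sum_tight _ _ _ P _ _ Q X mX iid Kf fold mfold fold_indep
  (fun n z => Num.sqrt (h n) * xi n z) k C mx) => [n|n|].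
- by rewrite sqE; exact: integrable_mulrl.
- rewrite RintegralZl ?xi_mean ?mulr0//.
  exact: (integrable_of_sqr (f := xi n) measurableT (m_xi n) (xi_sqr n)).
- by apply: filterS xi_moment => n; rewrite sqE RintegralZl.
Qed.

(** The share of one fold in the level lies between 0 and 1; for an empty level it is 0 by the
    convention on inverses. *)
Let E3_cvg k : cvg_prob0 P (E3 k).
Proof.
have mN n : measurable_fun setT (fun w => fs ind k n w * (level_count n w)^-1).
  by apply: measurable_funM => //; exact: mfs.
apply: cvg_prob0M (gr_cvg k) _ => // [n|].
  by apply: measurable_funM => //; exact: measurable_funM.
apply: (le_tight (Y := fun _ _ => 1)) => //; last first.
  by apply: (@tight_cst _ _ _ _ _ 1); apply: nearW => n; rewrite normr1.
apply: nearW => n w.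
have ind0 z : 0 <= ind z by case: (ind01 z) => ->.
have fs0 : 0 <= fs ind k n w by apply: sumr_ge0 => i _; rewrite mulr_ge0.
have fs1 : fs ind k n w <= level_count n w.
  apply: ler_sum => i _; rewrite ler_piMl//; by case: eqP.
have lc0 : 0 <= level_count n w by exact: le_trans fs1.
rewrite normr1 ger0_norm ?mulr_ge0 ?invr_ge0//.
have [->|lc] := eqVneq (level_count n w) 0; first by rewrite invr0 mulr0.
by rewrite ler_pdivrMr ?mul1r// lt0r lc.
Qed.

Let E0_cvg : cvg_prob0 P E0.
Proof.
apply: cvg_prob0M inv_cvg S_tight => [n|n]; first exact: measurable_funB.
by apply: measurable_funM => //; exact: measurable_funM.
Qed.

(** By the convention on inverses the bracket is -1 when the level is empty. The frequency then
    misses [pl] by [pl] itself, which has small probability, so the size of the prefactor does not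
    matter. *)
Let E4_cvg : cvg_prob0 P E4.
Proof.
apply: (cvg_prob0_event (A := fun n => [set w | pl / 2 < `|level_count n w / n%:R - pl|])) => //.
- move=> n; apply: measurable_gt_norm; apply: measurable_funB => //; apply: measurable_funM => //.
  exact: measurable_level_count.
- by move=> del del0; apply: level_frequency => //; rewrite divr_gt0.
- apply: nearW => n w /= H; rewrite /E4.
  have [lc|lc] := eqVneq (level_count n w) 0; last by rewrite mulVf// subrr !mulr0.
  exfalso; apply: H; rewrite lc mul0r sub0r normrN (gtr0_norm pl_gt0).
  by rewrite ltr_pdivrMr// ltr_pMr// ltr1n.
Qed.

Lemma measurable_crossfit_mean : measurable_seq crossfit_mean.
Proof.
move=> n; apply: (measurable_fun_partition (F := fold n) (g := fun f w => (level_count n w)^-1 *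
  \sum_(i < n) (om n (X i w) + mu n * ind (X i w) - g n (f i) w * eta (X i w)
    - r n (f i) w * xi n (X i w) + g n (f i) w * r n (f i) w * ind (X i w)))) => f; first exact: mfold.
have mi := measurableT_comp m_ind (mX _); have me := measurableT_comp m_eta (mX _).
have mx i := measurableT_comp (m_xi n) (mX i); have mo i := measurableT_comp (m_om n) (mX i).
apply: measurable_funM => //; apply: measurable_sum => i.
apply: measurable_funD; last by apply: measurable_funM; [exact: measurable_funM|exact: mi].
apply: measurable_funB; last by apply: measurable_funM; [exact: mr|exact: mx].
apply: measurable_funB; last by apply: measurable_funM; [exact: mg|exact: me].
by apply: measurable_funD; [exact: mo|apply: measurable_funM => //; exact: mi].
Qed.

(* [E1], [E2], [E3] carry the nuisance errors; [E0] replaces the frequency of the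
   level by its probability, and [E4] vanishes unless the level is empty. *)
Lemma crossfit_expansion :
  cvg_prob0 P (fun n w => Num.sqrt (n%:R * h n) * (crossfit_mean n w - mu n) - oracle_sum n w).
Proof.
pose E n w := E0 n w + (- \sum_k E1 k n w) + (- \sum_k E2 k n w) + \sum_k E3 k n w + E4 n w.
have ms (F : 'I_Kf -> nat -> T -> R) : (forall k, measurable_seq (F k)) ->
    measurable_seq (fun n w => \sum_k F k n w).
  by move=> mF n; apply: measurable_sum => k; exact: mF.
have mn (F : nat -> T -> R) : measurable_seq F -> measurable_seq (fun n w => - F n w).
  by move=> mF n; exact: measurableT_comp (mF n).
have mE1s := mn _ (ms _ mE1); have mE2s := mn _ (ms _ mE2); have mE3s := ms _ mE3.
have mD (F F' : nat -> T -> R) : measurable_seq F -> measurable_seq F' -> measurable_seq (fun n w => F n w + F' n w).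
  by move=> mF mF' n; exact: measurable_funD.
have m1 := mD _ _ mE0 mE1s; have m2 := mD _ _ m1 mE2s; have m3 := mD _ _ m2 mE3s.
have c1 := cvg_prob0D mE0 mE1s E0_cvg (cvg_prob0N (cvg_prob0_sum mE1 E1_cvg)).
have c2 := cvg_prob0D m1 mE2s c1 (cvg_prob0N (cvg_prob0_sum mE2 E2_cvg)).
have c3 := cvg_prob0D m2 mE3s c2 (cvg_prob0_sum mE3 E3_cvg).
have : cvg_prob0 P E by exact: cvg_prob0D m3 mE4 c3 E4_cvg.
apply: near_eq_cvg_prob0; exists 1%N => // n /= n0 w.
have n0' : 0 < n%:R :> R by rewrite ltr0n.
rewrite oracle_sumE//.
have -> : crossfit_mean n w = (level_count n w)^-1 *
   (S n w + mu n * level_count n w - \sum_k g n k w * fs eta k n w - \sum_k r n k w * fs (xi n) k n w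
    + \sum_k (g n k w * r n k w) * fs ind k n w).
  rewrite /crossfit_mean; congr (_ * _).
  rewrite -!sum_by_fold /S /weighted_sum /level_count mulr_sumr -!sumrN -!big_split/=.
  by apply: eq_bigr => i _; rewrite mul1r; ring.
have sn : Num.sqrt n%:R ^+ 2 = n%:R :> R by rewrite sqr_sqrtr// ltW.
have sn0 : Num.sqrt n%:R != 0 :> R by rewrite gt_eqF// sqrtr_gt0.
have snh : Num.sqrt (n%:R * h n) = Num.sqrt n%:R * Num.sqrt (h n) by rewrite sqrtrM// ltW.
have invE : inv n w = Num.sqrt n%:R ^+ 2 * (level_count n w)^-1 by rewrite sn.
set L := (level_count n w)^-1 in invE *.
have e1 : \sum_k E1 k n w = Num.sqrt (n%:R * h n) * L * \sum_k g n k w * fs eta k n w.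
  by rewrite mulr_sumr; apply: eq_bigr => k _; rewrite /E1 invE snh; field.
have e2 : \sum_k E2 k n w = Num.sqrt (n%:R * h n) * L * \sum_k r n k w * fs (xi n) k n w.
  rewrite mulr_sumr; apply: eq_bigr => k _; rewrite /E2 invE snh.
  have -> : fs (fun z => Num.sqrt (h n) * xi n z) k n w = Num.sqrt (h n) * fs (xi n) k n w.
    by rewrite /fs /fold_sum mulr_sumr; apply: eq_bigr => i _; ring.
  by field.
have e3 : \sum_k E3 k n w = Num.sqrt (n%:R * h n) * L * \sum_k (g n k w * r n k w) * fs ind k n w.
  by rewrite mulr_sumr; apply: eq_bigr => k _; rewrite /E3 -/L; ring.
rewrite /E e1 e2 e3 /E0 /E4 -/L invE snh.
move: (\sum_k _) (\sum_k _) (\sum_k _) => s1 s2 s3.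
by field; rewrite sn0 gt_eqF.
Qed.

End cross_fitting.

(** * Consequences of the assumed rates, and the conclusion *)

Lemma norm2L_ge {R : realType} {m d : nat} (Q : probability (obs R m d) R) (g : 'I_m.+1 -> R) l :
  (forall l, 0 < pL Q l) -> `|g l| * Num.sqrt (pL Q l) <= norm2L Q g.
Proof.
move=> hpL; have t0 l' : 0 <= `|g l'| ^+ 2 * pL Q l' by rewrite mulr_ge0 ?sqr_ge0// ltW.
rewrite -[`|g l|]ger0_norm// -sqrtr_sqr -sqrtrM ?sqr_ge0//; apply: ler_wsqrtr.
by rewrite (bigD1 l)//= lerDl sumr_ge0.
Qed.

(** Chebyshev's inequality for [a n * G n]: as a^2 <= s eventually, its second moment is at most s
    E[N^2] / c^2. The expectation stays in the extended reals because it may be infinite for small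
    n. *)
Lemma rate_cvg_prob0 d (T : measurableType d) (R : realType) (P : probability T R)
    (G N : nat -> T -> R) (s a : nat -> R) (c : R) :
  measurable_seq G -> measurable_seq N -> 0 < c -> (forall n, 0 <= s n) ->
  (forall n w, `|G n w| * c <= N n w) ->
  ((s n)%:E * \int[P]_w (N n w ^+ 2)%:E)%E @[n --> \oo] --> 0%E ->
  (\forall n \near \oo, a n ^+ 2 <= s n) ->
  cvg_prob0 P (fun n w => a n * G n w).
Proof.
move=> mG mN c0 s0 GN /fine_cvgP[fin sN] as_.
have c20 : 0 < c ^+ 2 by rewrite exprn_gt0.
have mN2 n : measurable_fun setT (fun w => (N n w ^+ 2)%:E).
  by apply/measurable_EFinP; exact: measurable_funX.
apply: (cvg_prob0_sqr (r := fun n => (c ^+ 2)^-1 * fine ((s n)%:E * \int[P]_w (N n w ^+ 2)%:E)%E)).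
- by move=> n; exact: measurable_funM.
- by rewrite -[X in _ --> X](mulr0 (c ^+ 2)^-1); apply: cvgMr.
apply: filterS2 fin as_ => n fin an.
rewrite EFinM fineK// muleA -EFinM -ge0_integralZl_EFin//.
- apply: ge0_le_integral => //.
  + by move=> w _; rewrite lee_fin sqr_ge0.
  + by apply/measurable_EFinP; apply: measurable_funX; exact: measurable_funM.
  + by apply: emeasurable_funM => //; exact: measurable_cst.
  move=> w _; rewrite -EFinM lee_fin exprMn.
  have -> : (c ^+ 2)^-1 * s n * N n w ^+ 2 = s n * (N n w ^+ 2 / c ^+ 2) by ring.
  apply: ler_pM => //; try exact: sqr_ge0.
  rewrite ler_pdivlMr// -exprMn -(real_normK (num_real (G n w * c))) lerXn2r// ?nnegrE.
    by rewrite (le_trans _ (GN n w))// mulr_ge0// ltW.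
  by rewrite normrM (gtr0_norm c0).
- by move=> w _; rewrite lee_fin sqr_ge0.
- by rewrite mulr_ge0 ?invr_ge0 ?sqr_ge0.
Qed.

Lemma littleop_cvg_prob0 d (T : measurableType d) (R : realType) (P : probability T R)
    (G N : nat -> T -> R) (s : nat -> R) (c : R) :
  measurable_seq G -> measurable_seq N -> 0 < c -> (\forall n \near \oo, 0 < s n) ->
  (forall n w, `|G n w| * c <= N n w) -> littleop P N (fun n => (s n)^-1) ->
  cvg_prob0 P (fun n w => s n * G n w).
Proof.
move=> mG mN c0 s0 GN No e del e0 del0.
have mA n : measurable [set w | e * c * (s n)^-1 < `|N n w|] by exact: measurable_gt_norm.
apply: filterS2 s0 (near_prob_le mA (No _ (mulr_gt0 e0 c0)) del0) => n s0.
apply: le_trans; apply: le_prob => //; first by apply: measurable_gt_norm; exact: measurable_funM.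
move=> w /=; rewrite normrM (gtr0_norm s0) ltr_pdivrMr// => H.
apply: lt_le_trans (_ : `|G n w| * c * s n <= _).
  by rewrite mulrAC ltr_pM2r// mulrC.
by rewrite ler_wpM2r ?(ltW s0)//; exact: le_trans (GN n w) (ler_norm _).
Qed.

(** The quantity is sqrt(n h^5), and h <= k n^(-1/5) bounds n h^5 by k^5. *)
Lemma bandwidth_rate {R : realType} (h : nat -> R) : (forall n, 0 < h n) ->
  h =O_\oo (fun n => n%:R `^ (- 5^-1)) ->
  exists C : R, \forall n \near \oo, Num.sqrt (n%:R * h n) * h n ^+ 2 <= C.
Proof.
move=> h0 /eqO_exP[k k0 hk].
exists (Num.sqrt (k ^+ 5)); have n1 : \forall n \near \oo, (0 < n)%N by exists 1%N.
apply: filterS2 n1 hk => n n0 hk.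
have nR : 0 < n%:R :> R by rewrite ltr0n.
have s0 : 0 <= Num.sqrt (n%:R * h n) * h n ^+ 2 by rewrite mulr_ge0 ?sqrtr_ge0 ?sqr_ge0.
rewrite -(ger0_norm s0) -sqrtr_sqr ler_wsqrtr// exprMn sqr_sqrtr ?mulr_ge0 ?(ltW nR) ?(ltW (h0 n))//.
have t0 : 0 <= n%:R `^ (- 5^-1) :> R by exact: powR_ge0.
have t5 : (n%:R `^ (- 5^-1)) ^+ 5 = n%:R^-1 :> R.
  rewrite -powR_mulrn// -powRrM mulNr mulVf ?powR_inv1 ?(ltW nR)//.
rewrite (gtr0_norm (h0 n)) (ger0_norm t0) in hk.
have h5 : h n ^+ 5 <= k ^+ 5 * n%:R^-1.
  by rewrite -t5 -exprMn lerXn2r// ?nnegrE ?(ltW (h0 n))// mulr_ge0// ltW.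
have -> : n%:R * h n * (h n ^+ 2) ^+ 2 = n%:R * h n ^+ 5 by ring.
by rewrite mulrC -ler_pdivlMr.
Qed.

Unset Implicit Arguments.

Theorem theorem5p4
  (R : realType) (m d : nat)
  (* the law of O = [L, Z, A, Y] and the ranges of Z and Y *)
  (Q : probability (obs R m d) R)
  (Zs : set (d.-tuple R)) (Ys : set R)
  (hZs : {ae Q, forall o, Zs (oZ o)}) (hYs : {ae Q, forall o, Ys (oY o)})
  (hpL : forall l, 0 < pL Q l)
  (p : R -> d.-tuple R -> 'I_m.+1 -> R)
  (hp : is_cond_densityA Q Zs p)
  (hpos : {ae Q, forall o, forall x, interior (supportA Q) x -> 0 < pAL Q p x (oL o)})
  (pi : d.-tuple R -> 'I_m.+1 -> R)
  (hpi_meas : forall l, measurable_fun [set: d.-tuple R] (pi ^~ l))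
  (hpi_L2 : (\int[Q]_o ((pi (oZ o) (oL o)) ^+ 2)%:E < +oo)%E)
  (a : R) (ha : interior (supportA Q) a) (l : 'I_m.+1)
  (* the sample, the folds and the nuisance estimators *)
  (dT : measure_display) (T : measurableType dT) (P : probability T R)
  (O : nat -> {RV P >-> obs R m d}) (hO : iid_copies O Q)
  (Kf : nat) (fold : forall n, T -> {ffun 'I_n -> 'I_Kf})
  (hfold : random_folds O fold)
  (K : R -> R) (h : nat -> R) (h_gt0 : forall n, 0 < h n)
  (gam_fit rho_fit : fit_procedure R m d Kf)
  (hgam_fit : fitted_out_of_fold gam_fit)
  (hrho_fit : fitted_out_of_fold rho_fit) :
  let gam_err n k w l' :=
    gam_fit n k (fold n w) (sample O n w) l' - gamma Q K (h n) a l' in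
  let rho_err n k w l' :=
    rho_fit n k (fold n w) (sample O n w) l' - rho Q pi l' in
  let zt n w := zeta_tilde pi K (h n) a gam_fit rho_fit
                  (fold n w) (sample O n w) l in
  forall
  (* (i) *)
  (hZ_bounded : exists M : R, forall z, Zs z -> forall i, `|tnth z i| <= M)
  (hY_bounded : exists M : R, forall y, Ys y -> `|y| <= M)
  (* (ii) *)
  (hK : is_smoothing_kernel K)
  (* (iii) *)
  (hp2 : forall z l', Zs z -> twice_differentiable_at (fun x => p x z l') a)
  (hp2_unif : uniformly_second_order Zs p a)
  (* (iv) *)
  (hnh : (n%:R * h n) @[n --> \oo] --> +oo)
  (hh : h n @[n --> \oo] --> 0)
  (* (v) *)
  (hgam : forall k, (((h n `^ (- 2^-1))^-1)%:E *
            'E_P[fun w => (norm2L Q (gam_err n k w) ^+ 2)%R])%E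
            @[n --> \oo] --> 0%E)
  (hrho : forall k, 'E_P[fun w => (norm2L Q (rho_err n k w) ^+ 2)%R]%E
            @[n --> \oo] --> 0%E)
  (hgamrho : forall k, littleop P
     (fun n w => norm2L Q (gam_err n k w) * norm2L Q (rho_err n k w))
     (fun n => (Num.sqrt (n%:R * h n))^-1)),
  bigOp P (fun n w => zt n w - zeta Q p pi a l)
    (fun n => (Num.sqrt (n%:R * h n))^-1 + h n ^+ 2) /\
  (h =O_\oo (fun n => n%:R `^ (- 5^-1)) ->
   cvg_in_law P
     (fun n w => Num.sqrt (n%:R * h n) *
        (zt n w - zeta Q p pi a l - bias_zeta Q p pi K (h n) a l))
     (centered_normal (sigma2_zeta Q p pi K a l))).
Proof.
move=> gam_err rho_err zt _ _ hK hp2 hp2_unif hnh hh hgam hrho hgamrho.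
set pl := pL Q l; have pl0 : 0 < pl by exact: hpL.
have [hO1 hO2] := hO; have [mfold fold_indep] := hfold.
pose X i : T -> obs R m d := O i.
have mX i : measurable_fun setT (X i) by exact: measurable_funPT.
have iid n (B : 'I_n -> set (obs R m d)) : (forall i, measurable (B i)) ->
    P (\bigcap_(i in [set: 'I_n]) (X i @^-1` B i)) = (\prod_(i < n) Q (B i))%E.
  by move=> mB; rewrite hO2//; apply: eq_bigr => i _; exact: hO1.
have msample n : measurable_fun setT (sample O n).
  apply/measurable_fun_tnthP => i; rewrite (_ : _ \o _ = X i); first exact: mX.
  by apply/funext => w /=; rewrite tnth_mktuple.
have mfit (fit : fit_procedure R m d Kf) : fitted_out_of_fold fit -> forall n k l',
    measurable_fun setT (fun w => fit n k (fold n w) (sample O n w) l').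
  move=> [mfit _] n k l'.
  apply: (measurable_fun_partition (F := fold n) (g := fun f w => fit n k f (sample O n w) l')) => f.
    exact: mfold.
  exact: (measurableT_comp (mfit n k f l') (msample n)).
have mgam n k l' : measurable_fun setT (fun w => gam_err n k w l').
  by apply: measurable_funB => //; exact: mfit.
have mrho n k l' : measurable_fun setT (fun w => rho_err n k w l').
  by apply: measurable_funB => //; exact: mfit.
have mnorm (err : T -> 'I_m.+1 -> R) : (forall l', measurable_fun setT (err ^~ l')) ->
    measurable_fun setT (fun w => norm2L Q (err w)).
  move=> merr.
  have ms : measurable_fun setT (@Num.sqrt R) by apply: continuous_measurable_fun; exact: sqrt_continuous.
  apply: (measurableT_comp ms); apply: measurable_sum => l'; apply: measurable_funM => //.
  by apply: measurable_funX; exact: measurableT_comp (merr l').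
pose sp := Num.sqrt pl; have sp0 : 0 < sp by rewrite sqrtr_gt0.
pose g n k w := gam_err n k w l; pose r n k w := rho_err n k w l.
have gN n k w : `|g n k w| * sp <= norm2L Q (gam_err n k w) by exact: norm2L_ge.
have rN n k w : `|r n k w| * sp <= norm2L Q (rho_err n k w) by exact: norm2L_ge.
have h_le (e : R) : 0 < e -> \forall n \near \oo, h n <= e.
  by move=> e0; move/cvgrPdist_le : hh => /(_ _ e0); apply: filterS => n; rewrite sub0r normrN gtr0_norm.
have sE n : (h n `^ (- 2^-1))^-1 = Num.sqrt (h n).
  by rewrite powRN invrK powR12_sqrt// ltW.
(* The rate o(h^(-1/2)) on the squared error says that sqrt(h) E[|g|^2] tends to 0; since h <= 1
   eventually, so does h E[|g|^2]. *)
have g_cvg k : cvg_prob0 P (fun n w => Num.sqrt (h n) * g n k w).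
  apply: (@rate_cvg_prob0 _ _ _ _ _ (fun n w => norm2L Q (gam_err n k w))
    (fun n => Num.sqrt (h n)) _ sp) => //.
  - by move=> n; exact: mgam.
  - by move=> n; exact: mnorm.
  - by have := hgam k; rewrite unlock; under eq_fun do rewrite sE.
  - apply: filterS (h_le 1 ltr01) => n h1.
    rewrite expr2 ler_piMr ?sqrtr_ge0// -[leRHS]sqrtr1 ler_wsqrtr//.
have r_cvg k : cvg_prob0 P (fun n => r n k).
  have H : cvg_prob0 P (fun n w => 1 * r n k w).
    apply: (@rate_cvg_prob0 _ _ _ _ _ (fun n w => norm2L Q (rho_err n k w)) (fun=> 1) (fun=> 1) sp) => //.
    - by move=> n; exact: mrho.
    - by move=> n; exact: mnorm.
    - by have := hrho k; rewrite unlock => H; under eq_fun do rewrite mul1e.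
    - by apply: nearW => n; rewrite expr1n.
  by apply: eq_cvg_prob0 H => n w; rewrite mul1r.
have snh : \forall n \near \oo, 0 < Num.sqrt (n%:R * h n).
  by exists 1%N => // n /= n0; rewrite sqrtr_gt0 mulr_gt0// ltr0n.
have gr_cvg k : cvg_prob0 P (fun n w => Num.sqrt (n%:R * h n) * (g n k w * r n k w)).
  apply: (@littleop_cvg_prob0 _ _ _ _ _ (fun n w => norm2L Q (gam_err n k w) * norm2L Q (rho_err n k w)) _ (sp * sp)) => //.
  - by move=> n; apply: measurable_funM; [exact: mgam|exact: mrho].
  - by move=> n; apply: measurable_funM; exact: mnorm.
  - exact: mulr_gt0.
  - by move=> n w; rewrite normrM mulrACA ler_pM// mulr_ge0// ltW.
have e0 := smooth_range_gt0 hp2_unif.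
have [C1 C10 xi_mom] := kernel_on_level_moment hZs hpL hp l hK hp2_unif.
have var_cvg := score_on_level_variance hZs hpL hp hpos hpi_meas hpi_L2 (l := l) ha hK hp2_unif h_gt0 hh.
set v := sigma2_zeta Q p pi K a l in var_cvg *.
pose om n := score_on_level Q pi a l K (h n).
pose xi n := kernel_on_level Q a l K (h n).
(* The second entry bounds h E[om^2] eventually, because h E[om^2] / pl^2 tends to [v]. *)
pose C := Num.max C1 ((v + 1) * pl ^+ 2).
have xi_moment : \forall n \near \oo, h n * \int[Q]_z (xi n z ^+ 2) <= C.
  by apply: filterS (h_le _ e0) => n he; rewrite le_max xi_mom.
have om_moment : \forall n \near \oo, h n * \int[Q]_z (om n z ^+ 2) <= C.
  have v1 : v < v + 1 by rewrite ltrDl ltr01.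
  apply: filterS (cvgr_le _ var_cvg _ v1) => n; rewrite ler_pdivrMr ?exprn_gt0// => H.
  by rewrite le_max H orbT.
have m_om n : measurable_fun setT (om n) by exact: measurable_score_on_level.
have om_sqr n : Q.-integrable setT (EFin \o (fun z => om n z ^+ 2)).
  exact: (score_on_level_sqr hZs hpi_meas hpi_L2 a l hK (h_gt0 n)).
have om_mean n : \int[Q]_z om n z = 0.
  exact: (score_on_level_mean hZs hpL hpi_meas hpi_L2 a l hK (h_gt0 n)).
pose ind := on_level l (fun _ : obs R m d => 1 : R).
have ind01 z : ind z = 0 \/ ind z = 1.
  by rewrite /ind /on_level mulr1; case: eqP => _; [right|left].
have m_ind : measurable_fun setT ind by apply: measurable_on_level; exact: measurable_cst.
pose mu n := score_mean_level Q pi a l K (h n).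
pose eta := weight_on_level Q pi l.
(* On the level, substitute gam_fit = gamma + g and rho_fit = rho + r in the scores and expand; off
   the level every term is 0. *)
have zt_cf n w : zt n w = crossfit_mean X fold ind eta xi om mu g r n w.
  rewrite /zt /zeta_tilde /crossfit_mean /level_count.
  congr (_^-1 * _); first by apply: eq_bigr => i _; rewrite tnth_mktuple /ind /on_level mulr1.
  apply: eq_bigr => i _; rewrite tnth_mktuple /S_hat.
  rewrite /om /eta /xi /ind /score_on_level /weight_on_level /kernel_on_level /on_level.
  rewrite /X; case: eqP => [->|_]; last first.
    by rewrite !(mul0r, mulr0, subr0, addr0).
  rewrite /g /r /gam_err /rho_err /score /centered_weight /mu; ring.
have expansion : cvg_prob0 P (fun n w => Num.sqrt (n%:R * h n) * (zt n w - mu n) - oracle_sum X h om pl n w).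
  have := crossfit_expansion mX iid mfold fold_indep h_gt0 ind01 m_ind pl0 (level_mean hZs l)
    (measurable_weight_on_level Q hpi_meas l) (weight_on_level_sqr hZs hpi_meas hpi_L2 l)
    (weight_on_level_mean hZs hpL hpi_meas hpi_L2 l)
    (fun n => measurable_kernel_on_level Q a l hK (h n))
    (fun n => kernel_on_level_sqr hZs a l hK (h_gt0 n))
    (fun n => kernel_on_level_mean hZs hpL a l hK (h_gt0 n))
    m_om om_sqr om_mean xi_moment om_moment mu
    (fun n k => mgam n k l) (fun n k => mrho n k l) g_cvg r_cvg gr_cvg.
  by apply: eq_cvg_prob0 => n w; rewrite zt_cf.
have o_tight := oracle_sum_tight mX iid h_gt0 pl m_om om_sqr om_mean om_moment.
have m_or : measurable_seq (oracle_sum X h om pl) by exact: measurable_oracle_sum.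
have mzt : measurable_seq zt.
  have := measurable_crossfit_mean mX mfold m_ind (measurable_weight_on_level Q hpi_meas l)
    (fun n => measurable_kernel_on_level Q a l hK (h n)) m_om mu
    (fun n k => mgam n k l) (fun n k => mrho n k l).
  by move=> mcf n; rewrite (funext (zt_cf n)); exact: mcf.
pose Y n w := Num.sqrt (n%:R * h n) * (zt n w - mu n).
have mY : measurable_seq Y by move=> n; apply: measurable_funM => //; exact: measurable_funB.
have mYo : measurable_seq (fun n w => Y n w - oracle_sum X h om pl n w) by move=> n; exact: measurable_funB.
have Y_tight : tight P Y.
  by apply: eq_tight (tightD mYo m_or (cvg_prob0_tight expansion) o_tight) => n w; rewrite subrK.
split.
  move=> eps eps0; have [M1 M10 YM] := Y_tight eps eps0.
  have [M2 M20 bias] := score_mean_bias hZs hpL hp hpos hpi_meas hpi_L2 l ha hK hp2_unif.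
  have M0 : 0 < Num.max M1 M2 by rewrite lt_max M10.
  exists (Num.max M1 M2) => //; near=> n.
  have s0 : 0 < Num.sqrt (n%:R * h n) by near: n.
  have he : h n <= smooth_range hp2_unif by near: n; exact: h_le.
  have YMn : (P [set w | (M1 < `|Y n w|)%R] <= eps%:E)%E by near: n.
  apply: le_trans YMn; apply: le_prob; try (apply: measurable_gt_norm; last exact: mY).
    by apply: measurable_gt_norm; exact: measurable_funB.
  move=> w /=; apply: contraTT; rewrite -!leNgt => Yn.
  (* Stochastic part plus deterministic bias: the first is at most M1 / sqrt(n h) off the rare
     event, the second at most M2 h^2. *)
  rewrite (_ : zt n w - zeta Q p pi a l = Y n w / Num.sqrt (n%:R * h n) + (mu n - zeta Q p pi a l)); last first.
    by rewrite /Y; field; rewrite gt_eqF.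
  apply: (le_trans (ler_normD _ _)); rewrite mulrDr; apply: lerD.
    rewrite normrM normfV (gtr0_norm s0) ler_pM2r ?invr_gt0// (le_trans Yn)// le_max lexx//.
  apply: (le_trans (bias (h n) (h_gt0 n) he)); rewrite ler_wpM2r ?sqr_ge0// le_max lexx orbT//.
move=> /(bandwidth_rate h_gt0)[B hB].
have bias_cvg := score_mean_expansion hZs hpL hp hpos hpi_meas hpi_L2 l ha hK hp2 hp2_unif h_gt0 hh.
(* The bias beyond [bias_zeta] is o(h^2), and sqrt(n h) h^2 stays bounded at this bandwidth. *)
pose b n := Num.sqrt (n%:R * h n) * (mu n - zeta Q p pi a l - bias_zeta Q p pi K (h n) a l).
have b_cvg : b n @[n --> \oo] --> 0.
  apply: norm_cvg0; apply: (@squeeze_cvgr _ _ _ _ (fun=> 0)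
    (fun n => B * `|(mu n - zeta Q p pi a l - bias_zeta Q p pi K (h n) a l) / h n ^+ 2|)).
  - apply: filterS hB => n hB; rewrite normr_ge0/=.
    have h2 : 0 < h n ^+ 2 by rewrite exprn_gt0.
    rewrite normrM (ger0_norm (sqrtr_ge0 _)) normrM normfV (gtr0_norm h2).
    set x := `|_|; have -> : Num.sqrt (n%:R * h n) * x = Num.sqrt (n%:R * h n) * h n ^+ 2 * (x / h n ^+ 2).
      by field; rewrite gt_eqF.
    apply: ler_wpM2r; last exact: hB.
    by apply: divr_ge0; [exact: normr_ge0|exact: ltW].
  - exact: cvg_cst.
  - by rewrite -[X in _ --> X](mulr0 B); apply: cvgMr; rewrite -(@normr0 _ R); exact: cvg_norm bias_cvg.
pose c n := Num.sqrt (h n / n%:R) * pl^-1.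
have m_u n : measurable_fun setT (fun z => c n * om n z) by exact: measurable_funM.
have uE n : (fun z => (c n * om n z) ^+ 2) = (fun z => c n ^+ 2 * om n z ^+ 2).
  by apply/funext => z; rewrite exprMn.
refine (@lindeberg_clt _ _ T P _ _ Q X (fun n z => c n * om n z) v _ mX iid m_u _ _ _ _ _ _ _).
- by move=> n; rewrite uE; exact: integrable_mulrl.
- move=> n; rewrite RintegralZl ?om_mean ?mulr0//.
  exact: (integrable_of_sqr (f := om n) measurableT (m_om n) (om_sqr n)).
- exact: (sigma2_zeta_ge0 hZs hpL hp hpos pi l ha).
- apply: cvg_trans var_cvg; apply: near_eq_cvg; exists 1%N => // n /= n0.
  rewrite uE RintegralZl// /c exprMn sqr_sqrtr ?divr_ge0 ?(ltW (h_gt0 n))// -/(om n) -/pl.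
  by field; rewrite gt_eqF// gt_eqF// ltr0n.
- exact: (score_on_level_lindeberg hZs hpL hp hpi_meas hpi_L2 l hK hp2_unif h_gt0 hh hnh).
- by move=> n; apply: measurable_funM => //; apply: measurable_funB => //; exact: measurable_funB.
(* The statistic differs from the oracle sum by the cross-fitting error and the deterministic [b n],
   both negligible. *)
have := cvg_prob0D mYo (fun n => measurable_cst (b n)) expansion (cvg_prob0_cst P b_cvg).
apply: eq_cvg_prob0 => n w; rewrite /Y /b /oracle_sum /cst /=.
set S1 := weighted_sum _ _ _ _ _; set S2 := (X in _ = _ - X).
by rewrite addrAC -mulrDr; congr (_ * _ - _); rewrite 2!addrA subrK.
Unshelve. all: by end_near.
Qed.
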